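(* Let $\rho,\delta\in[0,1]$, $\tau<-mn(1-\rho)$, and $a\in\mathcal{S}^\tau_{\rho,\delta}(\mathbb{R}^n\times\mathbb{R}^{nm})$. Then the $m$-linear Fourier integral operator $$T_a(\vec f)(x):=\int_{\mathbb{R}^{nm}}a(x,\vec\xi)\,e^{2\pi ix\cdot(\xi_1+\cdots+\xi_m)}\widehat f_1(\xi_1)\cdots\widehat f_m(\xi_m)\,d\vec\xi$$ is a multilinear bounded oscillation operator with respect to $\mathscr{B}$ and the exponent $r=1$, where $\mathscr{B}$ is the collection of all cubes in $\mathbb{R}^n$ with sides parallel to the coordinate axes.
   Context: $T_a$ is defined initially for Schwartz functions $f_i$; $\widehat f$ is the Fourier transform, $\vec\xi=(\xi_1,\ldots,\xi_m)$, $\xi_i\in\mathbb{R}^n$. $a\in\mathcal{S}^\tau_{\rho,\delta}(\mathbb{R}^n\times\mathbb{R}^{nm})$ means that for all multi-indices $\alpha,\beta_1,\ldots,\beta_m$ there is a constant $C_{\alpha,\vec\beta}$ with $|\partial_x^\alpha\partial_{\xi_1}^{\beta_1}\cdots\partial_{\xi_m}^{\beta_m}a(x,\vec\xi)|\le C_{\alpha,\vec\beta}(1+|\vec\xi|)^{\tau-\rho\sum_j|\beta_j|+\delta|\alpha|}$ for all $x,\vec\xi$. $\mathbb{R}^n$ carries Lebesgue measure and $\mathscr{B}$ is a ball-basis with $Q^*:=5Q$ for each cube $Q$. Let $\langle f\rangle_Q:=\frac1{|Q|}\int_Q|f|$, $\lfloor f\rfloor_Q:=\sup_{Q'\in\mathscr{B},Q'\supset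 Q}\langle f\rangle_{Q'}$, $\vec f\mathbf{1}_E=(f_1\mathbf{1}_E,\ldots,f_m\mathbf{1}_E)$. A scalar-valued $m$-linear operator $T$ is a multilinear bounded oscillation operator with respect to $\mathscr{B}$ and $r=1$ if there are constants $\mathfrak{C}_1,\mathfrak{C}_2\in(0,\infty)$ such that: (T1) for every $Q_0\in\mathscr{B}$ there is $Q\in\mathscr{B}$, $Q\supsetneq Q_0$, such that for all $\vec f\in L^1(\mathbb{R}^n)^m$, $\sup_{x\in Q_0}|T(\vec f\mathbf{1}_{Q^*})(x)-T(\vec f\mathbf{1}_{Q_0^*})(x)|\le\mathfrak{C}_1\prod_{i=1}^m\langle f_i\rangle_{Q^*}$; (T2) for every $Q\in\mathscr{B}$ and such $\vec f$, $\sup_{x,x'\in Q}|(T(\vec f)-T(\vec f\mathbf{1}_{Q^*}))(x)-(T(\vec f)-T(\vec f\mathbf{1}_{Q^*}))(x')|\le\mathfrak{C}_2\prod_{i=1}^m\lfloor f_i\rfloor_Q$. *)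

(* Defs.v *)
From HB Require Import structures.
From mathcomp Require Import all_boot all_order all_algebra.
From mathcomp Require Import complex lra.
From mathcomp Require Import all_classical all_reals all_analysis.

Set Implicit Arguments.
Unset Strict Implicit.
Unset Printing Implicit Defensive.

Import Order.TTheory GRing.Theory Num.Theory.
Import Normc.
Import numFieldNormedType.Exports.

Local Open Scope classical_set_scope.
Local Open Scope ring_scope.

(* Points of R^n are row vectors ['rV[R]_n]; points of R^(nm) are matrices
   ['M[R]_(m, n)], whose m rows are xi_1, ..., xi_m. *)

(* Generators of the Borel sigma-algebra of a space of matrices. *)
Definition mx_cylinders (R : realType) (p q : nat) : set (set 'M[R]_(p, q)) :=
  [set A | exists i j, exists2 B : set R,
     @measurable _ (measurableTypeR R) B &
     A = [set x : 'M[R]_(p, q) | B (x i j)]].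

HB.instance Definition _ (R : realType) (p q : nat) :=
  Measurable.copy 'M[R]_(p, q) (g_sigma_algebraType (@mx_cylinders R p q)).

Lemma measurable_mx_coord (R : realType) (p q : nat) (i : 'I_p) (j : 'I_q) :
  measurable_fun [set: 'M[R]_(p, q)]
    (fun x : 'M[R]_(p, q) => x i j : measurableTypeR R).
Proof.
move=> _ B mB; rewrite setTI; apply: sub_sigma_algebra.
by exists i, j, B.
Qed.

Lemma measurable_fun_mx d (T : measurableType d) (R : realType) (p q : nat)
    (f : T -> 'M[R]_(p, q)) :
  (forall i j, measurable_fun [set: T] (fun t => f t i j : measurableTypeR R)) ->
  measurable_fun [set: T] f.
Proof.
move=> mf; apply: (@measurability _ _ _ _ _ _ (@mx_cylinders R p q)) => //.
move=> _ [_ [i [j [B mB ->]]] <-].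
exact: mf.
Qed.

Definition rV_cons (R : realType) (n : nat)
    (p : measurableTypeR R * 'rV[R]_n) : 'rV[R]_n.+1 :=
  \row_j (if unlift ord0 j is Some k then p.2 ord0 k else p.1).

Lemma measurable_rV_cons (R : realType) (n : nat) :
  measurable_fun [set: measurableTypeR R * 'rV[R]_n] (@rV_cons R n).
Proof.
apply: measurable_fun_mx => i j.
have [k jk|j0] := unliftP ord0 j.
  apply: (eq_measurable_fun
    (fun p : measurableTypeR R * 'rV[R]_n => p.2 ord0 k : measurableTypeR R)).
    by move=> p _; rewrite mxE jk liftK.
  exact: (measurableT_comp (@measurable_mx_coord R 1 n ord0 k)
    (@measurable_snd _ _ _ _)).
apply: (eq_measurable_fun
  (fun p : measurableTypeR R * 'rV[R]_n => p.1 : measurableTypeR R)).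
  by move=> p _; rewrite mxE j0 unlift_none.
exact: measurable_fst.
Qed.

Definition image_measure d d' (T : measurableType d) (U : measurableType d')
  (R : realType) (mu : {measure set T -> \bar R}) (f : T -> U)
  (mf : measurable_fun [set: T] f) : {measure set U -> \bar R}.
Proof. by unshelve refine (pushforward mu f : {measure set U -> \bar R}). Defined.

(* Lebesgue measure on R^n, by R^(n+1) = R x R^n. *)
Fixpoint leb (R : realType) (n : nat) : {measure set 'rV[R]_n -> \bar R} :=
  match n return {measure set 'rV[R]_n -> \bar R} with
  | 0 => dirac (0 : 'rV[R]_0)
  | k.+1 => image_measure (@lebesgue_measure R \x^ leb R k)%E
              (@measurable_rV_cons R k)
  end.

Lemma measurable_vec_mx (R : realType) (p q : nat) :
  measurable_fun [set: 'rV[R]_(p * q)] (@vec_mx R p q).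
Proof.
apply: measurable_fun_mx => i j.
apply: (eq_measurable_fun (fun x : 'rV[R]_(p * q) =>
    x ord0 (mxvec_index i j) : measurableTypeR R)).
  by move=> x _; rewrite mxE.
exact: measurable_mx_coord.
Qed.

(* Lebesgue measure on R^(pq). *)
Definition leb_mx (R : realType) (p q : nat) :
    {measure set 'M[R]_(p, q) -> \bar R} :=
  image_measure (leb R (p * q)) (@measurable_vec_mx R p q).

(* The defining property of Lebesgue measure. *)
Lemma leb_box (R : realType) (n : nat) (a b : 'rV[R]_n) :
  (forall j, a ord0 j <= b ord0 j) ->
  leb R n [set x | forall j, a ord0 j <= x ord0 j <= b ord0 j] =
  (\prod_j (b ord0 j - a ord0 j))%:E.
Proof.
elim: n a b => [|n IHn] a b ab.
  rewrite /= diracE big_ord0 mem_set//; by case.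
pose a' : 'rV[R]_n := \row_j a ord0 (lift ord0 j).
pose b' : 'rV[R]_n := \row_j b ord0 (lift ord0 j).
rewrite /= /pushforward.
rewrite (_ : _ @^-1` _ = `[a ord0 ord0, b ord0 ord0] `*`
    [set x : 'rV[R]_n | forall j, a' ord0 j <= x ord0 j <= b' ord0 j]).
  rewrite product_measure2E//.
  - rewrite IHn; last by move=> j; rewrite !mxE.
    rewrite [X in (X * _)%E](_ : _ = (b ord0 ord0 - a ord0 ord0)%:E); last first.
      have /= -> := @lebesgue_measure_itv R `[a ord0 ord0, b ord0 ord0].
      rewrite lte_fin; case: ltP => // ba.
      by rewrite (@le_anti _ _ (a ord0 ord0) (b ord0 ord0)) ?subrr// ab ba.
    rewrite big_ord_recl EFinM; congr (_ * _)%E.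
    by congr EFin; apply: eq_bigr => j _; rewrite !mxE.
  - rewrite (_ : mkset _ = \bigcap_(j in [set: 'I_n])
        [set x : 'rV[R]_n | `[a' ord0 j, b' ord0 j]%classic (x ord0 j)]).
      apply: fin_bigcap_measurable => // j _.
      have := @measurable_mx_coord R 1 n ord0 j measurableT
        `[a' ord0 j, b' ord0 j]%classic (measurable_itv _).
      by rewrite setTI.
    apply/seteqP; split=> x /=.
      by move=> h j _ /=; rewrite in_itv/=; exact: h.
    by move=> h j; have := h j I; rewrite /= in_itv.
apply/seteqP; split=> -[t x] /=.
  move=> h; split=> /=.
    by have := h ord0; rewrite !mxE unlift_none in_itv.
  by move=> j; have := h (lift ord0 j); rewrite !mxE liftK.
rewrite in_itv/= => -[ht hx] j.
case: (unliftP ord0 j) => [k ->|->]; rewrite mxE ?liftK ?unlift_none//.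
by have := hx k; rewrite !mxE.
Qed.

Section complex_calculus.
Context {R : realType}.

Definition cintegrable d (T : measurableType d) (mu : {measure set T -> \bar R})
    (f : T -> R[i]) : Prop :=
  mu.-integrable setT (fun x => (complex.Re (f x))%:E) /\
  mu.-integrable setT (fun x => (complex.Im (f x))%:E).

Definition cintegral d (T : measurableType d) (mu : {measure set T -> \bar R})
    (f : T -> R[i]) : R[i] :=
  (\int[mu]_x complex.Re (f x) +i* \int[mu]_x complex.Im (f x))%C.

(* The limit of [f] at 0 from the right. *)
Definition clim0 (f : R -> R[i]) : R[i] :=
  (lim ((fun e => complex.Re (f e)) @ 0^'+)
   +i* lim ((fun e => complex.Im (f e)) @ 0^'+))%C.

(* e^(it) *)
Definition cexpi (t : R) : R[i] := (cos t +i* sin t)%C.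

Definition cderive (V : normedModType R) (v : V) (f : V -> R[i]) : V -> R[i] :=
  fun p => ('D_v (fun q => complex.Re (f q)) p
            +i* 'D_v (fun q => complex.Im (f q)) p)%C.

Definition cderives (V : normedModType R) (vs : seq V) (f : V -> R[i]) :
  V -> R[i] := foldr (@cderive V) f vs.

(* C^oo: every iterated directional derivative is differentiable. *)
Definition csmooth (V : normedModType R) (f : V -> R[i]) : Prop :=
  forall (vs : seq V) (p : V),
    differentiable (fun q => complex.Re (cderives vs f q)) p /\
    differentiable (fun q => complex.Im (cderives vs f q)) p.

End complex_calculus.

Section euclidean.
Context {R : realType}.

Definition dotp n (x y : 'rV[R]_n) : R := \sum_j x ord0 j * y ord0 j.

(* The library norm on matrices is the sup norm. *)
Definition enorm m n (xi : 'M[R]_(m, n)) : R :=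
  Num.sqrt (\sum_i \sum_j xi i j ^+ 2).

Definition L1 n (f : 'rV[R]_n -> R[i]) : Prop := cintegrable (leb R n) f.

Definition fourier n (f : 'rV[R]_n -> R[i]) (xi : 'rV[R]_n) : R[i] :=
  cintegral (leb R n) (fun x => f x * cexpi (- (2 * pi * dotp x xi))).

Definition indic_mul n (f : 'rV[R]_n -> R[i]) (E : set 'rV[R]_n) :
  'rV[R]_n -> R[i] := fun x => if x \in E then f x else 0.

End euclidean.

Section symbols.
Context {R : realType} (m n : nat).

(* The coordinate directions of the multi-index (alpha, beta_1, ..., beta_m),
   with multiplicity, in R^n x R^(nm). *)
Definition directions (alpha : 'I_n -> nat) (beta : 'I_m -> 'I_n -> nat) :
    seq ('rV[R]_n * 'M[R]_(m, n))%type :=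
  flatten [seq nseq (alpha j) (delta_mx ord0 j, 0) | j : 'I_n] ++
  flatten [seq nseq (beta ij.1 ij.2) (0, delta_mx ij.1 ij.2)
            | ij : ('I_m * 'I_n)%type].

Definition partials (alpha : 'I_n -> nat) (beta : 'I_m -> 'I_n -> nat)
    (a : 'rV[R]_n * 'M[R]_(m, n) -> R[i]) : 'rV[R]_n * 'M[R]_(m, n) -> R[i] :=
  cderives (directions alpha beta) a.

Definition symbol_class (tau rho delta : R)
    (a : 'rV[R]_n * 'M[R]_(m, n) -> R[i]) : Prop :=
  csmooth a /\
  forall (alpha : 'I_n -> nat) (beta : 'I_m -> 'I_n -> nat),
    exists C : R, forall (x : 'rV[R]_n) (xi : 'M[R]_(m, n)),
      normc (partials alpha beta a (x, xi)) <=
      C * (1 + enorm xi) `^ (tau - rho * (\sum_i \sum_j beta i j)%:R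
                                 + delta * (\sum_j alpha j)%:R).

End symbols.

Section fourier_integral_operator.
Context {R : realType} (m n : nat).
Variable a : 'rV[R]_n * 'M[R]_(m, n) -> R[i].

Definition fio_integrand (f : 'I_m -> 'rV[R]_n -> R[i]) (x : 'rV[R]_n)
    (xi : 'M[R]_(m, n)) : R[i] :=
  a (x, xi) * cexpi (2 * pi * dotp x (\sum_i row i xi)) *
  \prod_i fourier (f i) (row i xi).

(* The defining integral wherever it converges absolutely, in particular for
   Schwartz functions.  For general f_i in L^1 it need not converge absolutely
   (when tau >= -mn), and is then read as an oscillatory integral, i.e., as the
   limit of its Gaussian regularisations; by dominated convergence the two
   readings agree whenever the first one applies. *)
Definition fio (f : 'I_m -> 'rV[R]_n -> R[i]) (x : 'rV[R]_n) : R[i] :=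
  if `[< cintegrable (leb_mx R m n) (fio_integrand f x) >]
  then cintegral (leb_mx R m n) (fio_integrand f x)
  else clim0 (fun e => cintegral (leb_mx R m n)
         (fun xi => (expR (- (e * enorm xi ^+ 2)))%:C%C * fio_integrand f x xi)).

End fourier_integral_operator.

Section cubes.
Context {R : realType} (n : nat).

(* Center c, side length l. *)
Definition cube (c : 'rV[R]_n) (l : R) : set 'rV[R]_n :=
  [set x | forall j, `|x ord0 j - c ord0 j| <= l / 2].

Definition cubes : set (set 'rV[R]_n) :=
  [set Q | exists c l, 0 < l /\ Q = cube c l].

(* 5Q: the cube with the same center as Q and five times its side length. *)
Definition cube5 (Q : set 'rV[R]_n) : set 'rV[R]_n :=
  [set x | exists c l, [/\ 0 < l, Q = cube c l & cube c (5 * l) x]].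

Lemma cube5E (c : 'rV[R]_n) (l : R) : 0 < l -> cube5 (cube c l) = cube c (5 * l).
Proof.
move=> l0; apply/seteqP; split=> x; last by exists c, l.
move=> [c' [l' [l'0 e xc]]] j.
pose pt (d : 'rV[R]_n) (r s : R) : 'rV[R]_n := \row_k (d ord0 k + s * (r / 2)).
have ptP d r s : 0 < r -> `|s| <= 1 -> cube d r (pt d r s).
  move=> r0 s1 k; rewrite mxE addrAC subrr add0r normrM.
  by rewrite (ger0_norm (ltW (divr_gt0 r0 _)))// ler_piMl// ltW// divr_gt0.
have s1 : `|1 : R| <= 1 by rewrite normr1.
have sN1 : `|-1 : R| <= 1 by rewrite normrN normr1.
have := ptP c l 1 l0 s1; have := ptP c l (-1) l0 sN1.
rewrite e => /(_ j) + /(_ j).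
have := ptP c' l' 1 l'0 s1; have := ptP c' l' (-1) l'0 sN1.
rewrite -e => /(_ j) + /(_ j).
move: (xc j); rewrite !mxE !ler_norml => /andP[x1 x2].
move=> /andP[a1 a2] /andP[b1 b2] /andP[c1 c2] /andP[d1 d2].
by apply/andP; split; lra.
Qed.

End cubes.

Section bounded_oscillation.
Context {R : realType} (m n : nat).

(* <f>_Q *)
Definition avg (f : 'rV[R]_n -> R[i]) (Q : set 'rV[R]_n) : \bar R :=
  ((fine (leb R n Q))^-1%:E * \int[leb R n]_(x in Q) (normc (f x))%:E)%E.

Definition avg_sup (B : set (set 'rV[R]_n)) (f : 'rV[R]_n -> R[i])
    (Q : set 'rV[R]_n) : \bar R :=
  ereal_sup [set avg f Q' | Q' in [set Q' | B Q' /\ Q `<=` Q']].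

Definition upd (f : 'I_m -> 'rV[R]_n -> R[i]) (i : 'I_m)
    (g : 'rV[R]_n -> R[i]) : 'I_m -> 'rV[R]_n -> R[i] :=
  fun j => if j == i then g else f j.

(* m-linearity on L^1 x ... x L^1, values being considered up to null sets. *)
Definition multilinear_L1
    (T : ('I_m -> 'rV[R]_n -> R[i]) -> 'rV[R]_n -> R[i]) : Prop :=
  forall (f : 'I_m -> 'rV[R]_n -> R[i]) (i : 'I_m)
         (u v : 'rV[R]_n -> R[i]) (c : R[i]),
    (forall j, L1 (f j)) -> L1 u -> L1 v ->
    {ae leb R n, forall x,
       T (upd f i (fun y => c * u y + v y)) x =
       c * T (upd f i u) x + T (upd f i v) x}.

Definition bounded_oscillation (B : set (set 'rV[R]_n))
    (star : set 'rV[R]_n -> set 'rV[R]_n)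
    (T : ('I_m -> 'rV[R]_n -> R[i]) -> 'rV[R]_n -> R[i]) : Prop :=
  let on f E := fun i : 'I_m => indic_mul (f i) E in
  multilinear_L1 T /\
  exists C1 C2 : R, [/\ 0 < C1, 0 < C2,
    forall Q0, B Q0 -> exists Q, [/\ B Q, Q0 `<` Q &
      forall f : 'I_m -> 'rV[R]_n -> R[i], (forall i, L1 (f i)) ->
      forall x, Q0 x ->
        ((normc (T (on f (star Q)) x - T (on f (star Q0)) x))%:E <=
         C1%:E * \prod_i avg (f i) (star Q))%E] &
    forall Q, B Q ->
      forall f : 'I_m -> 'rV[R]_n -> R[i], (forall i, L1 (f i)) ->
      forall x x', Q x -> Q x' ->
        ((normc ((T f x - T (on f (star Q)) x) -
                 (T f x' - T (on f (star Q)) x')))%:E <=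
         C2%:E * \prod_i avg_sup B (f i) Q)%E].

End bounded_oscillation.

(* Main.v *)
Require Import Defs.
From HB Require Import structures.
From mathcomp Require Import all_boot all_order all_algebra.
From mathcomp Require Import complex ring lra.
From mathcomp Require Import all_classical all_reals all_analysis.
From mathcomp Require Import measurable_realfun.

Set Implicit Arguments.
Unset Strict Implicit.
Unset Printing Implicit Defensive.

Import Order.TTheory GRing.Theory Num.Theory.
Import numFieldNormedType.Exports.

Local Open Scope classical_set_scope.
Local Open Scope ring_scope.

(** Damp the symbol by a Gaussian [expR (- (e * |xi| ^ 2))], [0 < e <= 1].  By
    Fubini the damped operator is an integral operator
<<
      Treg a e f x = \int tensor f y * kern a x e (diag x - y) dy,
      kern a x e z = \int expR (- (e * |xi| ^ 2)) * a (x, xi) * cexpi (2 * pi * z . xi) dxi,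
>>
    where [tensor f] is the product of the [f i] and all rows of [diag x] are
    [x]; the operator of the theorem is the limit as [e] tends to 0
    ([Treg_kern], [fio_clim0]).  Write [d = m * n], the dimension of the
    frequency space.  The hypothesis on [tau] leaves room for some [s > 0] with
    [4 * s <= - tau - d * (1 - rho)], and three estimates follow, uniformly in
    [x] and [0 < e <= h <= 1]:

    - [|kern a x e z| <= C e ^ (s - d / 2)], by size alone ([kernel_size]);
    - [|kern a x e z| <= C |z| ^ (- d - 1)], by [d + 1] integrations by parts,
      each of which improves the symbol by [|xi| ^ (- rho)] ([kernel_decay]);
    - [|kern a x e z - kern a x h z| <= C h ^ s |z| ^ (- d)], by [d] integrations
      by parts, the difference of the two Gaussians being at most
      [(h |xi| ^ 2) ^ s] ([kernel_diff]).

    Comparing with the scale [e = |z| ^ 2], the first and the third bound the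
    kernel by [|z| ^ (s - d)] for [|z| <= 1]; half of the gain can be spent on a
    factor [h ^ (s / 2)] for the differences ([interpolate]).  The kernels are
    thus dominated by a fixed integrable function of [z], which is written as
    a sum of indicators of balls whose radii run through all powers of two
    ([kernel_dyadic]).  A ball in the [m * n] variables is a product of [m]
    cubes, so integrals of [tensor f] against this majorant factor into
    integrals of the separate [f i] over cubes ([majorant], [tensor_dball]).

    Two consequences.  First, the integrals of one [f i] over the dyadic cubes
    centred at [x], suitably weighted, have a finite sum at almost every [x]
    ([dyadic_sum_fin]); there [Treg a e f x] is a Cauchy family with rate
    [e ^ (s / 2)], it converges, and the limit is linear in each [f i].
    Second, if [x] lies in the cube [Q = cube c l], the function
    [tensor f - tensor (f 1_(5Q))] vanishes unless some row of [y] is at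
    distance at least [2 * l] from [x].  Only radii [rad j >= 2 * l] then
    contribute, and for these the integrals of [f i] are bounded by averages
    over cubes containing [Q].  At every point [x] of [Q] the difference between
    the values at [f] and at [f 1_(5Q)] is therefore at most a constant times
    the product of the suprema of these averages ([fio_local]).

    The second oscillation condition is the triangle inequality.  The first
    one, with [Q] the double of [Q0], is the same bound for the functions
    [f i 1_(5Q)], all of whose averages over cubes containing [Q0] are at most
    [10 ^ n] times the average of [f i] over [5Q] ([avg_sup_indic]). *)

(** * Lebesgue measure on spaces of matrices *)

Section boxes.
Context {R : realType}.

Definition box p q (a b : 'M[R]_(p, q)) : set 'M[R]_(p, q) :=
  [set x | forall i j, a i j <= x i j <= b i j].

Definition boxes p q : set (set 'M[R]_(p, q)) :=
  [set A | exists a b, A = box a b].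

Lemma measurable_box p q (a b : 'M[R]_(p, q)) : measurable (box a b).
Proof.
rewrite (_ : box a b = \bigcap_(i in [set: 'I_p]) \bigcap_(j in [set: 'I_q])
    [set x : 'M[R]_(p, q) | `[a i j, b i j]%classic (x i j)]).
  apply: fin_bigcap_measurable => // i _; apply: fin_bigcap_measurable => // j _.
  have := @measurable_mx_coord R p q i j measurableT
    `[a i j, b i j]%classic (measurable_itv _).
  by rewrite setTI.
apply/seteqP; split=> x /= h.
  by move=> i _ j _ /=; rewrite in_itv/=; exact: h.
by move=> i j; have := h i I j I; rewrite /= in_itv.
Qed.

Lemma setI_closed_boxes p q : setI_closed (@boxes p q).
Proof.
move=> _ _ [a [b ->]] [c [d ->]].
exists (\matrix_(i, j) Num.max (a i j) (c i j)),
  (\matrix_(i, j) Num.min (b i j) (d i j)).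
apply/seteqP; split=> x /=.
  move=> [h1 h2] i j; move: (h1 i j) (h2 i j); rewrite !mxE ge_max le_min.
  by move=> /andP[-> ->] /andP[-> ->].
move=> h; split=> i j; move: (h i j); rewrite !mxE ge_max le_min;
by move=> /andP[/andP[? ?] /andP[? ?]]; apply/andP.
Qed.

Definition big_box p q (k : nat) : set 'M[R]_(p, q) :=
  box (const_mx (- k%:R)) (const_mx k%:R).

Lemma big_box_ex p q (x : 'M[R]_(p, q)) : exists k, big_box k x.
Proof.
pose s := \sum_i \sum_j `|x i j|.
have xs i j : `|x i j| <= s.
  rewrite /s (bigD1 i)//= (bigD1 j)//= -addrA lerDl addr_ge0 ?sumr_ge0// => k _.
  exact: sumr_ge0.
exists (Num.truncn s).+1 => i j; rewrite !mxE -ler_norml.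
apply: le_trans (xs i j) _; apply: ltW.
by rewrite truncnS_gt.
Qed.

Lemma big_box_cover p q : \bigcup_k (@big_box p q k) = setT.
Proof. by apply/seteqP; split=> // x _; have [k xk] := big_box_ex x; exists k. Qed.

(** A half-space in one coordinate is an increasing union of boxes. *)
Lemma measurable_boxesE p q :
  (@measurable _ 'M[R]_(p, q)) = <<s @boxes p q >>.
Proof.
apply/seteqP; split; last first.
  apply: smallest_sub; first exact: sigma_algebra_measurable.
  by move=> _ [a [b ->]]; exact: measurable_box.
apply: smallest_sub; first exact: smallest_sigma_algebra.
move=> _ [i [j [B mB ->]]].
pose T := g_sigma_algebraType (@boxes p q).
have : @measurable_fun _ _ T (measurableTypeR R) setT (fun x => (x : 'M[R]_(p, q)) i j).
  refine (@measurability _ _ T (measurableTypeR R) _ _ (@RGenCInfty.G R) _ _).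
    exact: RGenCInfty.measurableE.
  move=> _ [_ [a ->] <-]; rewrite setTI.
  pose lo k : 'M[R]_(p, q) := \matrix_(i', j')
    (if (i' == i) && (j' == j) then Num.max a (- k%:R) else - k%:R).
  rewrite (_ : _ @^-1` _ = \bigcup_k (box (lo k) (const_mx k%:R))).
    by apply: bigcup_measurable => k _; apply: sub_sigma_algebra; exists (lo k), (const_mx k%:R).
  apply/seteqP; split=> x /=.
    rewrite in_itv/= andbT => ax; have [k xk] := big_box_ex x; exists k => // i' j'.
    move: (xk i' j'); rewrite !mxE => /andP[x1 x2]; rewrite x2 andbT.
    by case: ifP => // /andP[/eqP -> /eqP ->]; rewrite ge_max ax; move: (xk i j); rewrite !mxE => /andP[].
  move=> [k _ /(_ i j)]; rewrite !mxE !eqxx/= in_itv/= andbT ge_max.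
  by move=> /andP[/andP[]].
by move=> /(_ measurableT B mB); rewrite setTI.
Qed.

Lemma box_eq0 p q (a b : 'M[R]_(p, q)) i j : b i j < a i j -> box a b = set0.
Proof.
move=> ba; apply/seteqP; split=> // x /(_ i j) /andP[ax xb].
by have := lt_le_trans ba (le_trans ax xb); rewrite ltxx.
Qed.

(** Lebesgue measure is determined by the volumes of boxes; translation
    invariance and the product decomposition below are read off from this. *)
Lemma box_measure_unique p q (m1 m2 : {measure set 'M[R]_(p, q) -> \bar R}) :
  (forall a b : 'M[R]_(p, q), (forall i j, a i j <= b i j) ->
     m1 (box a b) = (\prod_i \prod_j (b i j - a i j))%:E) ->
  (forall a b : 'M[R]_(p, q), (forall i j, a i j <= b i j) ->
     m2 (box a b) = (\prod_i \prod_j (b i j - a i j))%:E) ->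
  forall A, measurable A -> m1 A = m2 A.
Proof.
move=> h1 h2; apply: (measure_unique (@boxes p q) (@big_box p q)).
- exact: measurable_boxesE.
- exact: setI_closed_boxes.
- by move=> k; exists (const_mx (- k%:R)), (const_mx k%:R).
- exact: big_box_cover.
- move=> _ [a [b ->]].
  have [[i [j /box_eq0 ->]]|ab] := pselect (exists i j, b i j < a i j).
    by rewrite !measure0.
  have ab' i j : a i j <= b i j.
    by rewrite leNgt; apply/negP => ba; apply: ab; exists i, j.
  by rewrite h1// h2.
- move=> k; rewrite h1 ?ltry// => i j; rewrite !mxE.
  by rewrite (@le_trans _ _ 0)// ?oppr_le0.
Qed.

Lemma leb_boxE n (a b : 'rV[R]_n) : (forall i j, a i j <= b i j) ->
  leb R n (box a b) = (\prod_i \prod_j (b i j - a i j))%:E.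
Proof.
move=> ab; rewrite big_ord1 -leb_box; last by move=> j; exact: ab.
congr (leb R n _); apply/seteqP; split=> x /= h; first by move=> j; exact: h.
by move=> i j; rewrite ord1; exact: h.
Qed.

Lemma leb_mx_boxE p q (a b : 'M[R]_(p, q)) : (forall i j, a i j <= b i j) ->
  leb_mx R p q (box a b) = (\prod_i \prod_j (b i j - a i j))%:E.
Proof.
move=> ab; rewrite /leb_mx /image_measure/= /pushforward.
rewrite (_ : _ @^-1` _ = box (mxvec a) (mxvec b)).
  rewrite leb_boxE; last first.
    by move=> i k; rewrite ord1; case/mxvec_indexP: k => i' j'; rewrite !mxvecE.
  rewrite big_ord1 pair_bigA/= (reindex _ (@curry_mxvec_bij _ _))/=.
  by congr EFin; apply: eq_bigr => -[i j] _ /=; rewrite !mxvecE.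
apply/seteqP; split=> x /= h.
  move=> i k; rewrite ord1; case/mxvec_indexP: k => i' j'.
  by rewrite !mxvecE; move: (h i' j'); rewrite !mxE.
by move=> i j; move: (h ord0 (mxvec_index i j)); rewrite !mxvecE mxE.
Qed.

Lemma box_measure_sigma_finite p q (mu : {measure set 'M[R]_(p, q) -> \bar R}) :
  (forall a b : 'M[R]_(p, q), (forall i j, a i j <= b i j) ->
     mu (box a b) = (\prod_i \prod_j (b i j - a i j))%:E) ->
  sigma_finite setT mu.
Proof.
move=> h; exists (@big_box p q); first by rewrite big_box_cover.
move=> k; split; first exact: measurable_box.
by rewrite h ?ltry// => i j; rewrite !mxE (@le_trans _ _ 0)// ?oppr_le0.
Qed.

(** Aliases of [leb_mx] and [leb] on which sigma-finiteness is registered. *)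
Definition vol p q : set 'M[R]_(p, q) -> \bar R := leb_mx R p q.
HB.instance Definition _ p q := Measure.on (@vol p q).
HB.instance Definition _ p q := @Measure_isSigmaFinite.Build _ _ _ (@vol p q)
  (box_measure_sigma_finite (@leb_mx_boxE p q)).

Definition vol1 n : set 'rV[R]_n -> \bar R := leb R n.
HB.instance Definition _ n := Measure.on (@vol1 n).
HB.instance Definition _ n := @Measure_isSigmaFinite.Build _ _ _ (@vol1 n)
  (box_measure_sigma_finite (@leb_boxE n)).
End boxes.

Section measurability.
Context {R : realType}.

(** An open set is the countable union of the boxes with rational centre and
    inverse integral half-width that it contains. *)
Lemma open_measurable_mx p q (U : set 'M[R]_(p, q)) : open U -> measurable U.
Proof.
move=> oU.
pose B (ck : 'M[rat]_(p, q) * nat) : set 'M[R]_(p, q) :=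
  box (map_mx ratr ck.1 - const_mx ck.2.+1%:R^-1)
      (map_mx ratr ck.1 + const_mx ck.2.+1%:R^-1).
pose F ck := if `[< B ck `<=` U >] then B ck else set0.
rewrite (_ : U = \bigcup_ck F ck).
  apply: countable_bigcupT_measurable; first exact: countableP.
  move=> ck; rewrite /F; case: ifP => // _.
  exact: measurable_box.
apply/seteqP; split=> [x Ux|x [ck _]]; last first.
  by rewrite /F; case: ifPn => // /asboolP; exact.
have [d xdU] := nbhs_ex (open_nbhs_nbhs (conj oU Ux)).
pose e := d%:num; have e0 : 0 < e by rewrite /e.
have xeU : forall y, ball x e y -> U y by [].
have [k ke] : exists k : nat, 2 * k.+1%:R^-1 < e.
  exists (Num.truncn (2 / e)); rewrite -ltr_pdivlMl// mulrC -ltf_pV2 ?posrE//.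
    by rewrite invfM !invrK mulrC truncnS_gt.
  by rewrite mulr_gt0 ?invr_gt0.
have k0 : 0 < k.+1%:R^-1 :> R by rewrite invr_gt0.
have cx i j : exists c : rat, x i j - k.+1%:R^-1 < ratr c < x i j + k.+1%:R^-1.
  have [c] : exists c : rat, ratr c \in `](x i j - k.+1%:R^-1), (x i j + k.+1%:R^-1)[.
    by apply: rat_in_itvoo; rewrite ltrBlDr -addrA ltrDl addr_gt0.
  by rewrite in_itv/= => cP; exists c.
have [c cP] : exists c : 'M[rat]_(p, q), forall i j,
    x i j - k.+1%:R^-1 < ratr (c i j) < x i j + k.+1%:R^-1.
  exists (\matrix_(i, j) xchoose (cx i j)) => i j.
  by rewrite mxE; exact: (xchooseP (cx i j)).
exists (c, k) => //; rewrite /F asboolT.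
  move=> i j /=; move: (cP i j); rewrite !mxE.
  move: (k.+1%:R^-1) (ratr _) (x i j) => r u v /andP[? ?].
  by apply/andP; split; lra.
move=> y yc; apply: xeU; split=> // i j; rewrite /ball/= distrC ltr_norml.
have := yc i j; have := cP i j; rewrite !mxE.
move: ke; move: (k.+1%:R^-1) (ratr _) (x i j) (y i j) => r u v w ke'.
move=> /andP[c1 c2] /andP[y1 y2].
by apply/andP; split; lra.
Qed.

Lemma continuous_measurable_mx p q (f : 'M[R]_(p, q) -> R) : continuous f ->
  measurable_fun setT f.
Proof.
move=> cf; apply: (measurability (@RGenOpens.G R)).
  exact: RGenOpens.measurableE.
move=> _ [_ [a [b ->]] <-]; rewrite setTI; apply: open_measurable_mx.
by move/continuousP : cf; apply; exact: interval_open.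
Qed.

Lemma measurable_coord p q (i : 'I_p) (j : 'I_q) :
  measurable_fun setT (fun x : 'M[R]_(p, q) => x i j).
Proof. exact: measurable_mx_coord. Qed.

Lemma measurable_mx_fun d (T : measurableType d) p q (f : T -> 'M[R]_(p, q)) :
  (forall i j, measurable_fun setT (fun t => f t i j)) -> measurable_fun setT f.
Proof. exact: measurable_fun_mx. Qed.

Lemma measurable_row p q (i : 'I_p) :
  measurable_fun setT (fun x : 'M[R]_(p, q) => row i x).
Proof.
apply: measurable_mx_fun => k j.
under eq_fun do rewrite mxE.
exact: measurable_coord.
Qed.

Lemma measurable_mxD p q d (T : measurableType d) (f g : T -> 'M[R]_(p, q)) :
  measurable_fun setT f -> measurable_fun setT g ->
  measurable_fun setT (fun t => f t + g t).
Proof.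
move=> mf mg; apply: measurable_mx_fun => i j; under eq_fun do rewrite mxE.
by apply: measurable_funD;
  apply: (measurableT_comp (@measurable_coord p q i j)).
Qed.

End measurability.

Section lebesgue_structure.
Context {R : realType}.

Section translation.
Variables (p q : nat) (h : 'M[R]_(p, q)).

Lemma measurable_shift_mx : measurable_fun setT (fun x : 'M[R]_(p, q) => x + h).
Proof. by apply: measurable_mxD => //; exact: measurable_cst. Qed.

Lemma vol_shift A : measurable A ->
  pushforward (@vol R p q) (fun x => x + h) A = vol A.
Proof.
apply: (@box_measure_unique _ p q
  (image_measure (@vol R p q) measurable_shift_mx) (@vol R p q)) => a b ab.
  rewrite /= /pushforward/=.
  rewrite (_ : _ @^-1` _ = box (a - h) (b - h)).
    rewrite leb_mx_boxE; last by move=> i j; rewrite !mxE lerD2r.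
    by congr EFin; apply: eq_bigr => i _; apply: eq_bigr => j _; rewrite !mxE; ring.
  by apply/seteqP; split=> x /= H i j; move: (H i j); rewrite !mxE lerBlDr lerBrDr.
exact: leb_mx_boxE.
Qed.

Lemma ge0_integral_shift (f : 'M[R]_(p, q) -> \bar R) :
  measurable_fun setT f -> (forall x, (0 <= f x)%E) ->
  (\int[@vol R p q]_x f (x + h)%R = \int[@vol R p q]_x f x)%E.
Proof.
move=> mf f0.
rewrite -(@eq_measure_integral _ _ _ setT (@vol R p q)
  (image_measure (@vol R p q) measurable_shift_mx) f); last first.
  by move=> A mA _; exact: vol_shift.
by rewrite (ge0_integral_pushforward measurable_shift_mx).
Qed.

Lemma integrable_shift (f : 'M[R]_(p, q) -> \bar R) :
  (@vol R p q).-integrable setT f ->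
  (@vol R p q).-integrable setT (fun x => f (x + h)).
Proof.
move=> /integrableP[mf fi]; apply/integrableP; split.
  exact: (measurableT_comp mf measurable_shift_mx).
rewrite (ge0_integral_shift (f := fun x => `|f x|%E))//.
exact: measurableT_comp.
Qed.

Lemma integral_shift (f : 'M[R]_(p, q) -> \bar R) :
  (@vol R p q).-integrable setT f ->
  (\int[@vol R p q]_x f (x + h)%R = \int[@vol R p q]_x f x)%E.
Proof.
move=> fi; rewrite -(@eq_measure_integral _ _ _ setT (@vol R p q)
  (image_measure (@vol R p q) measurable_shift_mx) f); last first.
  by move=> A mA _; exact: vol_shift.
rewrite (integral_pushforward measurable_shift_mx)//.
  exact: measurable_int fi.
exact: integrable_shift.
Qed.

End translation.

Definition mx_cons m n (p : 'rV[R]_n * 'M[R]_(m, n)) : 'M[R]_(m.+1, n) :=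
  \matrix_(i, j) (if unlift ord0 i is Some k then p.2 k j else p.1 ord0 j).

Lemma row0_mx_cons m n (u : 'rV[R]_n) (v : 'M[R]_(m, n)) :
  row ord0 (mx_cons (u, v)) = u.
Proof. by apply/rowP => j; rewrite !mxE unlift_none. Qed.

Lemma rowS_mx_cons m n (u : 'rV[R]_n) (v : 'M[R]_(m, n)) (i : 'I_m) :
  row (lift ord0 i) (mx_cons (u, v)) = row i v.
Proof. by apply/rowP => j; rewrite !mxE liftK. Qed.

Lemma measurable_mx_cons m n : measurable_fun setT (@mx_cons m n).
Proof.
apply: measurable_mx_fun => i j.
have [k ik|i0] := unliftP ord0 i.
  apply: (eq_measurable_fun (fun p : 'rV[R]_n * 'M[R]_(m, n) => p.2 k j)).
    by move=> p _; rewrite mxE ik liftK.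
  exact: (measurableT_comp (measurable_coord k j) measurable_snd).
apply: (eq_measurable_fun (fun p : 'rV[R]_n * 'M[R]_(m, n) => p.1 ord0 j)).
  by move=> p _; rewrite mxE i0 unlift_none.
exact: (measurableT_comp (measurable_coord ord0 j) measurable_fst).
Qed.

Lemma vol_mx_cons m n A : measurable A ->
  pushforward (@vol1 R n \x @vol R m n)%E (@mx_cons m n) A = vol A.
Proof.
apply: (@box_measure_unique _ m.+1 n
  (image_measure (@vol1 R n \x @vol R m n)%E (@measurable_mx_cons m n)) (@vol R m.+1 n)) => a b ab.
  rewrite /= /pushforward/=.
  pose rest (c : 'M[R]_(m.+1, n)) : 'M[R]_(m, n) := \matrix_(i, j) c (lift ord0 i) j.
  rewrite (_ : _ @^-1` _ = box (row ord0 a) (row ord0 b) `*` box (rest a) (rest b)).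
    rewrite product_measure1E//; [|exact: measurable_box..].
    rewrite leb_boxE; last by move=> i j; rewrite !mxE.
    rewrite leb_mx_boxE; last by move=> i j; rewrite !mxE.
    rewrite big_ord1 big_ord_recl -EFinM; congr (_ * _)%:E.
      by apply: eq_bigr => j _; rewrite !mxE.
    by apply: eq_bigr => i _; apply: eq_bigr => j _; rewrite !mxE.
  apply/seteqP; split=> -[u v] /=.
    move=> H; split=> i j; rewrite !mxE.
      by move: (H ord0 j); rewrite !mxE unlift_none (ord1 i).
    by move: (H (lift ord0 i) j); rewrite !mxE liftK.
  move=> [H1 H2] i j; have [k ->|->] := unliftP ord0 i.
    by rewrite !mxE liftK; move: (H2 k j); rewrite !mxE.
  by rewrite !mxE unlift_none; move: (H1 ord0 j); rewrite !mxE.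
exact: leb_mx_boxE.
Qed.

Lemma ge0_integral_mx_cons m n (f : 'M[R]_(m.+1, n) -> \bar R) :
  measurable_fun setT f -> (forall x, (0 <= f x)%E) ->
  (\int[@vol R m.+1 n]_x f x =
   \int[@vol1 R n]_u \int[@vol R m n]_v f (mx_cons (u, v)))%E.
Proof.
move=> mf f0.
rewrite -(@eq_measure_integral _ _ _ setT (@vol R m.+1 n)
  (image_measure (@vol1 R n \x @vol R m n)%E (@measurable_mx_cons m n)) f); last first.
  by move=> A mA _; exact: vol_mx_cons.
rewrite (ge0_integral_pushforward (@measurable_mx_cons m n))// preimage_setT.
rewrite fubini_tonelli1//; last by move=> x; exact: f0.
exact: (measurableT_comp mf (@measurable_mx_cons m n)).
Qed.

Lemma integral_mx_cons m n (f : 'M[R]_(m.+1, n) -> \bar R) :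
  measurable_fun setT f ->
  (@vol1 R n \x @vol R m n)%E.-integrable setT (f \o @mx_cons m n) ->
  (\int[@vol R m.+1 n]_x f x =
   \int[@vol1 R n]_u \int[@vol R m n]_v f (mx_cons (u, v)))%E.
Proof.
move=> mf fi.
rewrite -(@eq_measure_integral _ _ _ setT (@vol R m.+1 n)
  (image_measure (@vol1 R n \x @vol R m n)%E (@measurable_mx_cons m n)) f); last first.
  by move=> A mA _; exact: vol_mx_cons.
rewrite (integral_pushforward (@measurable_mx_cons m n))// preimage_setT.
by rewrite -integral12_prod_meas1.
Qed.

(** A product of functions of the separate rows integrates to the product of
    the integrals. *)
Lemma ge0_integral_prod_rows m n (f : 'I_m -> 'rV[R]_n -> \bar R) :
  (forall i, measurable_fun setT (f i)) -> (forall i x, (0 <= f i x)%E) ->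
  (\int[@vol R m n]_y \prod_i f i (row i y) = \prod_i \int[@vol1 R n]_x f i x)%E.
Proof.
elim: m f => [|m IH] f mf f0.
  under eq_integral do rewrite big_ord0.
  rewrite big_ord0 integral_cst// mul1e.
  rewrite (_ : [set: 'M[R]_(0, n)] = box 0 0); last first.
    by apply/seteqP; split=> // x _ [].
  by rewrite leb_mx_boxE ?big_ord0// => -[].
have mP k (g : 'I_k -> 'rV[R]_n -> \bar R) : (forall i, measurable_fun setT (g i)) ->
    measurable_fun setT (fun y : 'M[R]_(k, n) => \prod_i g i (row i y))%E.
  move=> mg; elim: (index_enum _) => [|i s IHs].
    by under eq_fun do rewrite big_nil; exact: measurable_cst.
  under eq_fun do rewrite big_cons; apply: emeasurable_funM => //.
  exact: (measurableT_comp (mg i) (@measurable_row R k n i)).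
rewrite ge0_integral_mx_cons; [|exact: mP|by move=> x; exact: prode_ge0].
rewrite big_ord_recl.
under eq_integral => u _.
  under eq_integral => v _.
    rewrite big_ord_recl row0_mx_cons.
    under eq_bigr do rewrite rowS_mx_cons.
    over.
  rewrite ge0_integralZl//; [|exact: (mP m (fun i => f (lift ord0 i)))|by move=> v _; exact: prode_ge0].
  rewrite (IH (fun i => f (lift ord0 i)))//.
  over.
rewrite ge0_integralZr//; first by apply: prode_ge0 => i _; exact: integral_ge0.
Qed.

End lebesgue_structure.

(** * Complex-valued integrals *)

Section complex_integrals.
Context {R : realType}.
Local Notation Re := (@complex.Re R).
Local Notation Im := (@complex.Im R).
Local Notation normc := (@Normc.normc R).

Lemma ReM (x y : R[i]) : Re (x * y) = Re x * Re y - Im x * Im y.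
Proof. by case: x y => a b [c d]. Qed.

Lemma ImM (x y : R[i]) : Im (x * y) = Re x * Im y + Im x * Re y.
Proof. by case: x y => a b [c d]. Qed.

Lemma ReD (x y : R[i]) : Re (x + y) = Re x + Re y.
Proof. by case: x y => a b [c d]. Qed.

Lemma ImD (x y : R[i]) : Im (x + y) = Im x + Im y.
Proof. by case: x y => a b [c d]. Qed.

Lemma ReB (x y : R[i]) : Re (x - y) = Re x - Re y.
Proof. by case: x y => a b [c d]. Qed.

Lemma ImB (x y : R[i]) : Im (x - y) = Im x - Im y.
Proof. by case: x y => a b [c d]. Qed.

Lemma complex_eq (x y : R[i]) : Re x = Re y -> Im x = Im y -> x = y.
Proof. by case: x y => a b [c d] /= -> ->. Qed.

Lemma normcE (x : R[i]) : normc x = Num.sqrt (Re x ^+ 2 + Im x ^+ 2).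
Proof. by case: x. Qed.

Lemma normc_ge0 (x : R[i]) : 0 <= normc x.
Proof. by rewrite normcE sqrtr_ge0. Qed.

Lemma normRe_le (x : R[i]) : `|Re x| <= normc x.
Proof. by rewrite normcE -sqrtr_sqr ler_wsqrtr// lerDl sqr_ge0. Qed.

Lemma normIm_le (x : R[i]) : `|Im x| <= normc x.
Proof. by rewrite normcE -sqrtr_sqr ler_wsqrtr// lerDr sqr_ge0. Qed.

Lemma normc_le (x : R[i]) : normc x <= `|Re x| + `|Im x|.
Proof.
rewrite normcE -[leRHS]ger0_norm ?addr_ge0// -sqrtr_sqr ler_wsqrtr//.
rewrite sqrrD !real_normK ?num_real// addrAC lerDl mulrn_wge0// mulr_ge0.
Qed.

Lemma normc_cexpi (t : R) : normc (cexpi t) = 1.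
Proof. by rewrite normcE /= cos2Dsin2 sqrtr1. Qed.

Lemma cexpiD (s t : R) : cexpi (s + t) = cexpi s * cexpi t.
Proof. by apply: complex_eq; rewrite ?ReM ?ImM/= ?cosD ?sinD//; ring. Qed.

Lemma cexpi0 : cexpi (0 : R) = 1.
Proof. by rewrite /cexpi cos0 sin0. Qed.

Lemma cexpi_sum (I : Type) (r : seq I) (F : I -> R) :
  cexpi (\sum_(i <- r) F i) = \prod_(i <- r) cexpi (F i).
Proof.
by elim: r => [|i r IH]; rewrite ?big_nil ?cexpi0// !big_cons cexpiD IH.
Qed.

Lemma normc_prod (I : Type) (r : seq I) (F : I -> R[i]) :
  normc (\prod_(i <- r) F i) = \prod_(i <- r) normc (F i).
Proof.
by elim: r => [|i r IH]; rewrite ?big_nil ?Normc.normc1// !big_cons Normc.normcM IH.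
Qed.

Section measurability.
Context d (T : measurableType d).
Implicit Types f g : T -> R[i].

Definition cmeas f := measurable_fun setT (Re \o f) /\ measurable_fun setT (Im \o f).

Lemma cmeas_cst (c : R[i]) : cmeas (fun _ => c).
Proof. by split; exact: measurable_cst. Qed.

Lemma cmeasM f g : cmeas f -> cmeas g -> cmeas (fun t => f t * g t).
Proof.
move=> [f1 f2] [g1 g2]; split.
  rewrite (_ : _ \o _ = (Re \o f) \* (Re \o g) \- (Im \o f) \* (Im \o g)); last first.
    by apply/funext => t /=; rewrite ReM.
  by apply: measurable_funB; apply: measurable_funM.
rewrite (_ : _ \o _ = (Re \o f) \* (Im \o g) \+ (Im \o f) \* (Re \o g)); last first.
  by apply/funext => t /=; rewrite ImM.
by apply: measurable_funD; apply: measurable_funM.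
Qed.

Lemma cmeas_prod (I : Type) (r : seq I) (F : I -> T -> R[i]) :
  (forall i, cmeas (F i)) -> cmeas (fun t => \prod_(i <- r) F i t).
Proof.
move=> mF; elim: r => [|i r IH].
  by under eq_fun do rewrite big_nil; exact: cmeas_cst.
by under eq_fun do rewrite big_cons; exact: cmeasM.
Qed.

Lemma cmeas_real (f : T -> R) : measurable_fun setT f -> cmeas (fun t => (f t)%:C%C).
Proof. by move=> mf; split => //; exact: measurable_cst. Qed.

Lemma cmeas_cexpi (f : T -> R) : measurable_fun setT f -> cmeas (fun t => cexpi (f t)).
Proof.
move=> mf; split; apply: measurableT_comp => //.
  by apply: continuous_measurable_fun => x; exact: continuous_cos.
by apply: continuous_measurable_fun => x; exact: continuous_sin.
Qed.

Lemma measurable_normc f : cmeas f -> measurable_fun setT (normc \o f).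
Proof.
move=> [f1 f2].
rewrite (_ : _ \o _ = fun t => Num.sqrt ((Re \o f) t ^+ 2 + (Im \o f) t ^+ 2)); last first.
  by apply/funext => t /=; rewrite normcE.
apply: (measurableT_comp (continuous_measurable_fun (@sqrt_continuous R))).
by apply: measurable_funD; apply: measurable_funX.
Qed.

End measurability.

Lemma cmeas_comp d d' (T : measurableType d) (U : measurableType d')
  (f : U -> R[i]) (g : T -> U) : cmeas f -> measurable_fun setT g -> cmeas (f \o g).
Proof.
move=> [f1 f2] mg; split.
  exact: (measurableT_comp f1 mg).
exact: (measurableT_comp f2 mg).
Qed.

Section integrals.
Context d (T : measurableType d) (mu : {measure set T -> \bar R}).
Implicit Types f g : T -> R[i].

Lemma cintegrable_cmeas f : cintegrable mu f -> cmeas f.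
Proof.
by move=> [f1 f2]; split; apply/measurable_EFinP;
  [exact: measurable_int f1|exact: measurable_int f2].
Qed.

Lemma le_cintegrable f (g : T -> R) : cmeas f -> (forall x, normc (f x) <= g x) ->
  mu.-integrable setT (EFin \o g) -> cintegrable mu f.
Proof.
move=> [f1 f2] fg ig; split.
  apply: (le_integrable measurableT _ _ ig) => [|x _].
    exact/measurable_EFinP.
  rewrite /= lee_fin (le_trans (normRe_le _))// (le_trans (fg x))//.
  exact: ler_norm.
apply: (le_integrable measurableT _ _ ig) => [|x _].
  exact/measurable_EFinP.
rewrite /= lee_fin (le_trans (normIm_le _))// (le_trans (fg x))//.
exact: ler_norm.
Qed.

Lemma integrable_normc f : cintegrable mu f ->
  mu.-integrable setT (EFin \o (fun x => normc (f x))).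
Proof.
move=> fi; have mf := cintegrable_cmeas fi; have [f1 f2] := fi.
have i1 := integrable_norm f1; have i2 := integrable_norm f2.
have := integrableD measurableT i1 i2.
apply: (le_integrable measurableT); first exact/measurable_EFinP/measurable_normc.
move=> x _; rewrite /comp -EFinD /= lee_fin.
rewrite ger0_norm ?normc_ge0// [leRHS]ger0_norm ?addr_ge0//.
exact: normc_le.
Qed.

Lemma cintegrableP f : cmeas f ->
  cintegrable mu f <-> mu.-integrable setT (EFin \o (fun x => normc (f x))).
Proof.
by move=> mf; split=> [|fi]; [exact: integrable_normc|exact: (le_cintegrable mf _ fi)].
Qed.

Lemma cintegrableD f g : cintegrable mu f -> cintegrable mu g ->
  cintegrable mu (fun x => f x + g x).
Proof.
move=> [f1 f2] [g1 g2]; split.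
  have := integrableD measurableT f1 g1; apply: eq_integrable => // x _.
  by rewrite ReD.
have := integrableD measurableT f2 g2; apply: eq_integrable => // x _.
by rewrite ImD.
Qed.

Lemma cintegralD f g : cintegrable mu f -> cintegrable mu g ->
  cintegral mu (fun x => f x + g x) = cintegral mu f + cintegral mu g.
Proof.
move=> [f1 f2] [g1 g2]; apply: complex_eq; rewrite ?ReD ?ImD/=.
  by under eq_Rintegral do rewrite ReD; rewrite RintegralD.
by under eq_Rintegral do rewrite ImD; rewrite RintegralD.
Qed.

Lemma cintegrableZ (c : R[i]) f : cintegrable mu f ->
  cintegrable mu (fun x => c * f x).
Proof.
move=> fi; apply: (le_cintegrable (g := fun x => normc c * normc (f x))).
- by apply: cmeasM; [exact: cmeas_cst|exact: cintegrable_cmeas].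
- by move=> x; rewrite Normc.normcM.
- have := integrableZl measurableT (normc c) (integrable_normc fi).
  by apply: eq_integrable => // x _; rewrite /= EFinM.
Qed.

Lemma cintegralZ (c : R[i]) f : cintegrable mu f ->
  cintegral mu (fun x => c * f x) = c * cintegral mu f.
Proof.
move=> [f1 f2].
have Z (r : R) (h : T -> R) : mu.-integrable setT (EFin \o h) ->
    mu.-integrable setT (EFin \o (fun x => r * h x)).
  move=> hi; have := integrableZl measurableT r hi.
  by apply: eq_integrable => // x _; rewrite /= EFinM.
apply: complex_eq; rewrite ?ReM ?ImM/=.
  under eq_Rintegral do rewrite ReM.
  by rewrite RintegralB ?RintegralZl//; exact: Z.
under eq_Rintegral do rewrite ImM.
by rewrite RintegralD ?RintegralZl//; exact: Z.
Qed.

Lemma cintegrableB f g : cintegrable mu f -> cintegrable mu g ->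
  cintegrable mu (fun x => f x - g x).
Proof.
move=> fi gi; have := cintegrableD fi (cintegrableZ (-1) gi).
by under eq_fun do rewrite mulN1r.
Qed.

Lemma cintegralB f g : cintegrable mu f -> cintegrable mu g ->
  cintegral mu (fun x => f x - g x) = cintegral mu f - cintegral mu g.
Proof.
move=> fi gi.
transitivity (cintegral mu (fun x => f x + (-1) * g x)).
  by congr (cintegral mu _); apply/funext => x; rewrite mulN1r.
by rewrite cintegralD ?cintegralZ ?mulN1r//; exact: cintegrableZ.
Qed.

Lemma eq_cintegral f g : f =1 g -> cintegral mu f = cintegral mu g.
Proof. by move=> fg; congr cintegral; apply/funext. Qed.

(** The factor 2 comes from estimating the real and the imaginary part
    separately. *)
Lemma normc_cintegral f : cintegrable mu f ->
  normc (cintegral mu f) <= 2 * \int[mu]_x (normc (f x)).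
Proof.
move=> fi; have [f1 f2] := fi; have nf := integrable_normc fi.
rewrite (le_trans (normc_le _))//= mulr_natl mulr2n lerD//.
  rewrite (le_trans (le_normr_Rintegral measurableT f1))//.
  apply: le_Rintegral => //; first exact: integrable_norm.
  by move=> x _; exact: normRe_le.
rewrite (le_trans (le_normr_Rintegral measurableT f2))//.
apply: le_Rintegral => //; first exact: integrable_norm.
by move=> x _; exact: normIm_le.
Qed.

End integrals.

Section fubini.
Context d1 d2 (T1 : measurableType d1) (T2 : measurableType d2).
Variables (m1 : {sigma_finite_measure set T1 -> \bar R})
          (m2 : {sigma_finite_measure set T2 -> \bar R}).

Lemma RFubini (h : T1 * T2 -> R) :
  (m1 \x m2)%E.-integrable setT (EFin \o h) ->
  (forall x, m2.-integrable setT (fun y => (h (x, y))%:E)) ->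
  (forall y, m1.-integrable setT (fun x => (h (x, y))%:E)) ->
  \int[m1]_x (\int[m2]_y h (x, y)) = \int[m2]_y (\int[m1]_x h (x, y)).
Proof.
move=> hi h1 h2; rewrite /Rintegral; congr fine.
transitivity (\int[m1]_x \int[m2]_y (h (x, y))%:E)%E.
  by apply: eq_integral => x _; rewrite fineK//; exact: integrable_fin_num.
rewrite (Fubini hi)/=.
by apply: eq_integral => y _; rewrite fineK//; exact: integrable_fin_num.
Qed.

Lemma cFubini (h : T1 * T2 -> R[i]) :
  cintegrable (m1 \x m2)%E h ->
  (forall x, cintegrable m2 (fun y => h (x, y))) ->
  (forall y, cintegrable m1 (fun x => h (x, y))) ->
  cintegral m1 (fun x => cintegral m2 (fun y => h (x, y))) =
  cintegral m2 (fun y => cintegral m1 (fun x => h (x, y))).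
Proof.
move=> [hr hi] h1 h2; apply: complex_eq => /=.
  by apply: (RFubini hr) => [x|y]; [have [] := h1 x|have [] := h2 y].
by apply: (RFubini hi) => [x|y]; [have [] := h1 x|have [] := h2 y].
Qed.

End fubini.

Section prod_rows.
Variable n : nat.

Let cmeas_rows m (g : 'I_m -> 'rV[R]_n -> R[i]) : (forall i, cintegrable (@vol1 R n) (g i)) ->
  cmeas (fun y : 'M[R]_(m, n) => \prod_i g i (row i y)).
Proof.
move=> gi; apply: cmeas_prod => i.
exact: (cmeas_comp (cintegrable_cmeas (gi i)) (@measurable_row R m n i)).
Qed.

Lemma cintegrable_prod_rows m (g : 'I_m -> 'rV[R]_n -> R[i]) :
  (forall i, cintegrable (@vol1 R n) (g i)) ->
  cintegrable (@vol R m n) (fun y => \prod_i g i (row i y)).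
Proof.
move=> gi; apply/cintegrableP; first exact: cmeas_rows.
apply/integrableP; split; first exact/measurable_EFinP/measurable_normc/cmeas_rows.
under eq_integral.
  move=> y _; rewrite /= ger0_norm ?normc_ge0// normc_prod -prodEFin.
  over.
rewrite (ge0_integral_prod_rows (f := fun i x => (normc (g i x))%:E)); last 2 first.
- by move=> i; exact/measurable_EFinP/measurable_normc/(cintegrable_cmeas (gi i)).
- by move=> i x; rewrite lee_fin normc_ge0.
under eq_bigr.
  move=> i _; rewrite -(@fineK _ (\int[_]_x _)%E); last first.
    exact: integrable_fin_num (integrable_normc (gi i)).
  over.
by rewrite prodEFin ltry.
Qed.

Lemma cintegral_prod_rows m (g : 'I_m -> 'rV[R]_n -> R[i]) :
  (forall i, cintegrable (@vol1 R n) (g i)) ->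
  cintegral (@vol R m n) (fun y => \prod_i g i (row i y)) =
  \prod_i cintegral (@vol1 R n) (g i).
Proof.
elim: m g => [|m IH] g gi.
  rewrite big_ord0.
  have -> : (fun y : 'M[R]_(0, n) => \prod_(i < 0) g i (row i y)) = cst 1.
    by apply/funext => y; rewrite big_ord0.
  have v1 : @vol R 0 n setT = 1%E.
    rewrite (_ : [set: 'M[R]_(0, n)] = box 0 0); last first.
      by apply/seteqP; split=> // x _ [].
    by rewrite leb_mx_boxE ?big_ord0// => -[].
  apply: complex_eq; rewrite [LHS]/= Rintegral_cst// ?mul0r//.
  by rewrite [X in fine X](_ : _ = 1%E)//= mulr1.
rewrite big_ord_recl.
pose gS (i : 'I_m) := g (lift ord0 i).
have gSi : cintegrable (@vol R m n) (fun y => \prod_i gS i (row i y)).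
  by apply: cintegrable_prod_rows => i; exact: gi.
pose G v := \prod_i gS i (row i v).
have E u v : \prod_(i < m.+1) g i (row i (mx_cons (u, v))) = g ord0 u * G v.
  rewrite big_ord_recl row0_mx_cons; congr (_ * _).
  by apply: eq_bigr => i _; rewrite rowS_mx_cons.
have mall := cmeas_rows gi.
have ci : cintegrable (@vol1 R n \x @vol R m n)%E
    ((fun y : 'M[R]_(m.+1, n) => \prod_i g i (row i y)) \o @mx_cons R m n).
  have mm := cmeas_comp mall (@measurable_mx_cons R m n).
  apply/(cintegrableP _ mm).
  apply/integrable12ltyP; first exact/measurable_EFinP/measurable_normc.
  under eq_integral.
    move=> u _.
    under eq_integral.
      move=> v _; rewrite /= E Normc.normcM ger0_norm ?mulr_ge0 ?normc_ge0// EFinM.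
      over.
    rewrite ge0_integralZl//; last 3 first.
    - by apply/measurable_EFinP/measurable_normc; exact: (cintegrable_cmeas gSi).
    - by move=> v _; rewrite lee_fin normc_ge0.
    - by rewrite lee_fin normc_ge0.
    over.
  rewrite ge0_integralZr//; last 3 first.
  - by apply/measurable_EFinP/measurable_normc; exact: (cintegrable_cmeas (gi _)).
  - by move=> v _; rewrite lee_fin normc_ge0.
  - by apply: integral_ge0 => v _; rewrite lee_fin normc_ge0.
  rewrite -(fineK (integrable_fin_num measurableT (integrable_normc (gi ord0)))).
  rewrite -(fineK (integrable_fin_num measurableT (integrable_normc gSi))).
  by rewrite -EFinM ltry.
transitivity (cintegral (@vol1 R n) (fun u => cintegral (@vol R m n)
    (fun v => g ord0 u * G v))).
  have si u : cintegrable (@vol R m n) (fun v => g ord0 u * G v).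
    exact: cintegrableZ.
  have [mr mi] := mall; have [cr cim] := ci.
  apply: complex_eq => /=; rewrite /Rintegral.
    rewrite integral_mx_cons//; last exact/measurable_EFinP.
    congr fine; apply: eq_integral => u _.
    rewrite fineK; last by have [? _] := si u; exact: integrable_fin_num.
    by apply: eq_integral => v _; rewrite E.
  rewrite integral_mx_cons//; last exact/measurable_EFinP.
  congr fine; apply: eq_integral => u _.
  rewrite fineK; last by have [_ ?] := si u; exact: integrable_fin_num.
  by apply: eq_integral => v _; rewrite E.
under eq_cintegral do rewrite cintegralZ// mulrC.
by rewrite cintegralZ// mulrC -IH.
Qed.

End prod_rows.
End complex_integrals.

(** * Integration by parts *)

Section line_derivative.
Context {R : realType} (p q : nat).
Implicit Types (f g u : 'M[R]_(p, q) -> R) (E x z : 'M[R]_(p, q)).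

(** Directional derivatives are one-variable derivatives along lines, so the
    one-variable calculus applies to them. *)
Lemma is_derive_lineP f x E (t df : R) :
  is_derive (x + t *: E) E f df <-> is_derive t (1 : R) (fun s => f (x + s *: E)) df.
Proof.
have e : (fun h : R => h^-1 *: ((f \o shift (x + t *: E)) (h *: E) - f (x + t *: E))) =
    (fun h : R => h^-1 *: (((fun s => f (x + s *: E)) \o shift t) (h *: (1 : R)) - f (x + t *: E))).
  apply/funext => h /=; congr (_ *: (f _ - _)).
  have -> : h *: (1 : R) = h by rewrite /GRing.scale/= mulr1.
  by rewrite scalerDl addrCA.
split=> -[d1 d2].
  split; first by move: d1; rewrite /derivable e.
  by move: d2; rewrite /derive e.
split; first by move: d1; rewrite /derivable e.
by move: d2; rewrite /derive e.
Qed.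

Lemma is_derive_line0P f x E (df : R) :
  is_derive x E f df <-> is_derive (0 : R) (1 : R) (fun s => f (x + s *: E)) df.
Proof. by rewrite -is_derive_lineP scale0r addr0. Qed.

Lemma FTC_line g E x : (forall x, derivable g x E) -> continuous ('D_E g) ->
  (\int[lebesgue_measure]_(t in `[0%R, 1%R]) ('D_E g (x + t *: E)%R)%:E =
   (g (x + E))%:E - (g x)%:E)%E.
Proof.
move=> dg cg.
have dl t : is_derive t (1 : R) (fun s => g (x + s *: E)) ('D_E g (x + t *: E)).
  by apply/is_derive_lineP; split.
have cl : continuous (fun s : R => g (x + s *: E)).
  by move=> t; have [d _] := dl t; apply/differentiable_continuous/derivable1_diffP.
rewrite (@continuous_FTC2 _ (fun t => 'D_E g (x + t *: E)) (fun s => g (x + s *: E)))//.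
- by rewrite scale1r scale0r addr0.
- apply: continuous_subspaceT => t.
  apply: (@continuous_comp _ _ _ (fun t : R => x + t *: E) ('D_E g)); last exact: cg.
  by apply: cvgD; [exact: cvg_cst|apply: cvgZr_tmp; exact: cvg_id].
- split=> [t _||].
  + by have [d _] := dl t.
  + by apply: cvg_at_right_filter; exact: cl.
  + by apply: cvg_at_left_filter; exact: cl.
- by move=> t _; rewrite derive1E; have [_ ->] := dl t.
Qed.

(** The integral of a directional derivative vanishes: it is the integral of
    [g (x + E) - g x], by averaging over the translates [x + t *: E]. *)
Lemma integral_derive0 g E : (forall x, derivable g x E) -> continuous ('D_E g) ->
  (@vol R p q).-integrable setT (EFin \o g) ->
  (@vol R p q).-integrable setT (EFin \o ('D_E g)) ->
  \int[@vol R p q]_x 'D_E g x = 0.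
Proof.
move=> dg cg ig iDg.
have mD : measurable_fun setT ('D_E g) by exact: continuous_measurable_mx.
pose D : set (measurableTypeR R) := `[0%R, 1%R]%classic.
pose h (xt : 'M[R]_(p, q) * measurableTypeR R) : R :=
  'D_E g (xt.1 + (xt.2 : R) *: E) * \1_D xt.2.
have mh : measurable_fun setT h.
  apply: measurable_funM.
    apply: (measurableT_comp mD); apply: measurable_mxD; first exact: measurable_fst.
    apply: measurable_mx_fun => i j.
    apply: (eq_measurable_fun (fun xt : 'M[R]_(p, q) * measurableTypeR R => (xt.2 : R) * E i j)).
      by move=> xt _; rewrite mxE.
    by apply: measurable_funM => //; exact: measurable_snd.
  apply: measurableT_comp; last exact: measurable_snd.
  by apply: measurable_indic; exact: measurable_itv.
have mE : measurable_fun setT (EFin \o h) by exact/measurable_EFinP.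
have intD (F : 'M[R]_(p, q) -> \bar R) (t : R) :
    (\int[@vol R p q]_x (F x * (\1_D t)%:E) = (\int[@vol R p q]_x F x) * (\1_D t)%:E)%E.
  rewrite indicE; case: (_ \in _) => /=.
    by rewrite mule1; under eq_integral do rewrite mule1.
  rewrite mule0; under eq_integral do rewrite mule0.
  by rewrite integral0.
have lebD : (\int[@lebesgue_measure R]_t (\1_D t)%:E = 1)%E.
  rewrite integral_indic//; last exact: measurable_itv.
  rewrite setIT; have /= -> := @lebesgue_measure_itv R `[0%R, 1%R].
  by rewrite lte01 oppr0 adde0.
have hi : (@vol R p q \x @lebesgue_measure R)%E.-integrable setT (EFin \o h).
  apply/integrable21ltyP => //.
  under eq_integral => t _.
    under eq_integral => x _.
      rewrite /= /h normrM EFinM (_ : `|\1_D t| = \1_D t); last by rewrite ger0_norm.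
      over.
    rewrite (intD (fun x => (`|'D_E g (x + (t : R) *: E)|)%:E)).
    rewrite (@ge0_integral_shift _ _ _ ((t : R) *: E) (fun x => (`|'D_E g x|)%:E))//; last first.
      by apply/measurable_EFinP; exact: measurableT_comp.
    over.
  rewrite ge0_integralZl//; last 2 first.
  - by apply/measurable_EFinP; apply: measurable_indic; exact: measurable_itv.
  - by apply: integral_ge0 => x _; rewrite lee_fin.
  by rewrite lebD mule1; have /integrableP[_] := iDg.
have := Fubini hi.
have e1 x : (\int[@lebesgue_measure R]_t (EFin \o h) (x, t) = (g (x + E))%:E - (g x)%:E)%E.
  rewrite -FTC_line// [RHS]integral_mkcond; apply: eq_integral => t _ /=.
  rewrite /h/= indicE patchE; case: (_ \in _); first by rewrite mulr1.
  by rewrite mulr0.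
have e2 t : (\int[@vol R p q]_x (EFin \o h) (x, t) =
    (\int[@vol R p q]_x ('D_E g x)%:E) * (\1_D t)%:E)%E.
  rewrite -(integral_shift ((t : R) *: E) iDg).
  by rewrite -intD.
under eq_integral do rewrite e1.
under [RHS]eq_integral do rewrite e2.
rewrite integralB//; last exact: (integrable_shift E ig).
rewrite (integral_shift E ig) subee; last exact: integrable_fin_num.
have fin := integrable_fin_num measurableT iDg.
rewrite -(fineK fin) integralZl//; last first.
  apply/integrableP; split.
    by apply/measurable_EFinP; apply: measurable_indic; exact: measurable_itv.
  under eq_integral do rewrite gee0_abs ?lee_fin//.
  by rewrite lebD ltry.
rewrite lebD mule1 /Rintegral => /esym.
by rewrite (fineK fin) => ->.
Qed.

Lemma integral_is_derive0 g g' E : (forall x, is_derive x E g (g' x)) ->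
  continuous g' ->
  (@vol R p q).-integrable setT (EFin \o g) ->
  (@vol R p q).-integrable setT (EFin \o g') ->
  \int[@vol R p q]_x g' x = 0.
Proof.
move=> gg' cg' ig ig'.
have e : 'D_E g = g' by apply/funext => x; have [] := gg' x.
have := @integral_derive0 g E; rewrite e; exact.
Qed.

End line_derivative.

Section oscillatory_integrals.
Context {R : realType} (p q : nat).
Implicit Types (u b : 'M[R]_(p, q) -> R) (E x z : 'M[R]_(p, q)).

Definition mdot z x : R := \sum_i \sum_j z i j * x i j.

Lemma continuous_sum (T : topologicalType) (I : Type) (r : seq I) (F : I -> T -> R) :
  (forall i, continuous (F i)) -> continuous (fun t => \sum_(i <- r) F i t).
Proof.
move=> cF; elim: r => [|i r IH].
  by under eq_fun do rewrite big_nil; move=> t; exact: cvg_cst.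
under eq_fun do rewrite big_cons; move=> t.
by apply: cvgD; [exact: cF|exact: IH].
Qed.

Section continuity.
Variable T : topologicalType.
Implicit Types v w : T -> R.

Lemma contM v w : continuous v -> continuous w -> continuous (fun t => v t * w t).
Proof. by move=> cv cw t; exact: (cvgM (cv t) (cw t)). Qed.

Lemma contD v w : continuous v -> continuous w -> continuous (fun t => v t + w t).
Proof. by move=> cv cw t; exact: (cvgD (cv t) (cw t)). Qed.

Lemma contB v w : continuous v -> continuous w -> continuous (fun t => v t - w t).
Proof. by move=> cv cw t; exact: (cvgB (cv t) (cw t)). Qed.

Lemma contZ (c : R) v : continuous v -> continuous (fun t => c * v t).
Proof. by apply: contM => t; exact: cvg_cst. Qed.

End continuity.

Lemma continuous_coord i j : continuous (fun x : 'M[R]_(p, q) => x i j).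
Proof. by move=> x; exact: coord_continuous. Qed.

Lemma continuous_mdot z : continuous (mdot z).
Proof.
apply: continuous_sum => i; apply: continuous_sum => j.
by apply: contZ; exact: continuous_coord.
Qed.

Lemma mdot_line z x i0 j0 (s : R) :
  mdot z (x + s *: delta_mx i0 j0) = mdot z x + s * z i0 j0.
Proof.
rewrite /mdot; under eq_bigr => i _.
  under eq_bigr => j _ do rewrite !mxE mulrDr.
  rewrite big_split/=.
  over.
rewrite big_split/=; congr (_ + _).
rewrite (bigD1 i0)//= (bigD1 j0)//= !eqxx mulr1 mulrC.
rewrite !big1 ?addr0//.
  by move=> i ii0; rewrite big1// => j _; rewrite (negbTE ii0) !mulr0.
by move=> j jj0; rewrite (negbTE jj0) andbF !mulr0.
Qed.

Definition cosz z x : R := cos (2 * pi * mdot z x).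
Definition sinz z x : R := sin (2 * pi * mdot z x).

Lemma continuous_cosz z : continuous (cosz z).
Proof.
move=> x; apply: (@continuous_comp _ _ _ (fun x => 2 * pi * mdot z x) cos).
  by apply: contZ; exact: continuous_mdot.
exact: continuous_cos.
Qed.

Lemma continuous_sinz z : continuous (sinz z).
Proof.
move=> x; apply: (@continuous_comp _ _ _ (fun x => 2 * pi * mdot z x) sin).
  by apply: contZ; exact: continuous_mdot.
exact: continuous_sin.
Qed.

Lemma cosz_le1 z x : `|cosz z x| <= 1.
Proof. by rewrite ler_norml cos_geN1 cos_le1. Qed.

Lemma sinz_le1 z x : `|sinz z x| <= 1.
Proof. by rewrite ler_norml sin_geN1 sin_le1. Qed.

Section derivatives.
Variables (i0 : 'I_p) (j0 : 'I_q).
Local Notation E := (delta_mx i0 j0 : 'M[R]_(p, q)).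

Let phase z x : is_derive (0 : R) (1 : R)
  (fun s : R => 2 * pi * mdot z (x + s *: E)) (2 * pi * z i0 j0).
Proof.
have -> : (fun s : R => 2 * pi * mdot z (x + s *: E)) =
    (fun s : R => 2 * pi * mdot z x + s * (2 * pi * z i0 j0)).
  by apply/funext => s; rewrite mdot_line; ring.
apply: is_derive_eq.
by rewrite /GRing.scale/=; ring.
Qed.

Lemma is_derive_cosz z x : is_derive x E (cosz z) (- (2 * pi * z i0 j0 * sinz z x)).
Proof.
apply/is_derive_line0P.
have := @is_derive1_comp R cos (fun s : R => 2 * pi * mdot z (x + s *: E)) 0 _ _
  (is_derive_cos _) (phase z x).
by move=> h; apply: (is_derive_eq h); rewrite scale0r addr0 mulNr mulrC.
Qed.

Lemma is_derive_sinz z x : is_derive x E (sinz z) (2 * pi * z i0 j0 * cosz z x).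
Proof.
apply/is_derive_line0P.
have := @is_derive1_comp R sin (fun s : R => 2 * pi * mdot z (x + s *: E)) 0 _ _
  (is_derive_sin _) (phase z x).
by move=> h; apply: (is_derive_eq h); rewrite scale0r addr0 mulrC.
Qed.

End derivatives.

Lemma integrable_bounded_mul u b : (@vol R p q).-integrable setT (EFin \o u) ->
  measurable_fun setT b -> (forall x, `|b x| <= 1) ->
  (@vol R p q).-integrable setT (EFin \o (fun x => u x * b x)).
Proof.
move=> iu mb b1; apply: (le_integrable measurableT _ _ iu).
  apply/measurable_EFinP; apply: measurable_funM => //.
  by apply/measurable_EFinP; exact: measurable_int iu.
by move=> x _; rewrite /= lee_fin normrM ler_piMr.
Qed.

(** The derivatives of [u * cosz z] and [u * sinz z] have integral zero. *)
Lemma byparts u z i0 j0 (E := delta_mx i0 j0) :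
  (forall x, derivable u x E) -> continuous u -> continuous ('D_E u) ->
  (@vol R p q).-integrable setT (EFin \o u) ->
  (@vol R p q).-integrable setT (EFin \o ('D_E u)) ->
  \int[@vol R p q]_x ('D_E u x * cosz z x) =
    2 * pi * z i0 j0 * \int[@vol R p q]_x (u x * sinz z x) /\
  \int[@vol R p q]_x ('D_E u x * sinz z x) =
    - (2 * pi * z i0 j0 * \int[@vol R p q]_x (u x * cosz z x)).
Proof.
move=> du cu cDu iu iDu.
have mc : measurable_fun setT (cosz z) by apply: continuous_measurable_mx; exact: continuous_cosz.
have ms : measurable_fun setT (sinz z) by apply: continuous_measurable_mx; exact: continuous_sinz.
have ic v : (@vol R p q).-integrable setT (EFin \o v) ->
    (@vol R p q).-integrable setT (EFin \o (fun x => v x * cosz z x)).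
  by move=> iv; apply: integrable_bounded_mul => // x; exact: cosz_le1.
have is_ v : (@vol R p q).-integrable setT (EFin \o v) ->
    (@vol R p q).-integrable setT (EFin \o (fun x => v x * sinz z x)).
  by move=> iv; apply: integrable_bounded_mul => // x; exact: sinz_le1.
have iZ (c : R) v : (@vol R p q).-integrable setT (EFin \o v) ->
    (@vol R p q).-integrable setT (EFin \o (fun x => c * v x)).
  move=> iv; have := integrableZl measurableT c iv.
  by apply: eq_integrable => // x _; rewrite /= EFinM.
have du' x : is_derive x E u ('D_E u x) by split.
have Dc x : is_derive x E (u * cosz z) ('D_E u x * cosz z x - 2 * pi * z i0 j0 * (u x * sinz z x)).
  apply: (is_derive_eq (is_deriveM (du' x) (is_derive_cosz i0 j0 z x))).
  by rewrite /GRing.scale/=; ring.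
have Ds x : is_derive x E (u * sinz z) ('D_E u x * sinz z x - - (2 * pi * z i0 j0) * (u x * cosz z x)).
  apply: (is_derive_eq (is_deriveM (du' x) (is_derive_sinz i0 j0 z x))).
  by rewrite /GRing.scale/=; ring.
have cc := @continuous_cosz z; have cs := @continuous_sinz z.
split; apply/eqP; rewrite -subr_eq0.
  rewrite -RintegralZl//; last exact: is_.
  rewrite -RintegralB//; [|exact: ic|exact/iZ/is_].
  apply/eqP; apply: (integral_is_derive0 Dc).
  - by apply: contB; [exact: contM|apply: contZ; exact: contM].
  - exact: ic.
  - by apply: (integrableB _ (ic _ iDu) (iZ (2 * pi * z i0 j0) _ (is_ _ iu))).
rewrite -mulNr -RintegralZl//; last exact: ic.
rewrite -RintegralB//; [|exact: is_|exact/iZ/ic].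
apply/eqP; apply: (integral_is_derive0 Ds).
- by apply: contB; [exact: contM|apply: contZ; exact: contM].
- exact: is_.
- by apply: (integrableB _ (is_ _ iDu) (iZ (- (2 * pi * z i0 j0)) _ (ic _ iu))).
Qed.

Fixpoint L1_derivatives N E u : Prop :=
  [/\ continuous u, (@vol R p q).-integrable setT (EFin \o u) &
   if N is N'.+1 then (forall x, derivable u x E) /\ L1_derivatives N' E ('D_E u) else True].

Definition iterD N E u := iter N (fun v : 'M[R]_(p, q) -> R => 'D_E v) u.

Lemma L1_derivatives_cont N E u : L1_derivatives N E u -> continuous u.
Proof. by case: N => [|N] []. Qed.

Lemma L1_derivatives_int N E u : L1_derivatives N E u -> (@vol R p q).-integrable setT (EFin \o u).
Proof. by case: N => [|N] []. Qed.

Lemma L1_derivatives_iterD N E u : L1_derivatives N E u ->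
  (@vol R p q).-integrable setT (EFin \o iterD N E u).
Proof.
elim: N u => [|N IH] u; first by case.
by move=> [_ _ [_ h]]; rewrite /iterD iterSr; exact: IH.
Qed.

(** Integrating by parts exchanges the cosine and the sine, hence the
    simultaneous induction. *)
Lemma oscillatory_decay N i0 j0 (E := delta_mx i0 j0) u z : L1_derivatives N E u ->
  (2 * pi * `|z i0 j0|) ^+ N * `|\int[@vol R p q]_x (u x * cosz z x)| <=
    \int[@vol R p q]_x `|iterD N E u x| /\
  (2 * pi * `|z i0 j0|) ^+ N * `|\int[@vol R p q]_x (u x * sinz z x)| <=
    \int[@vol R p q]_x `|iterD N E u x|.
Proof.
have mc : measurable_fun setT (cosz z) by apply: continuous_measurable_mx; exact: continuous_cosz.
have ms : measurable_fun setT (sinz z) by apply: continuous_measurable_mx; exact: continuous_sinz.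
have pi0 : 0 <= 2 * (pi : R) by rewrite mulr_ge0// pi_ge0.
elim: N u => [|N IH] u.
  move=> [cu iu _]; rewrite !expr0 !mul1r.
  have bd b : measurable_fun setT b -> (forall x, `|b x| <= 1) ->
      `|\int[@vol R p q]_x (u x * b x)| <= \int[@vol R p q]_x `|u x|.
    move=> mb b1; have ib := integrable_bounded_mul iu mb b1.
    rewrite (le_trans (le_normr_Rintegral measurableT ib))//.
    apply: le_Rintegral => //; try exact: integrable_norm.
    by move=> x _; rewrite normrM ler_piMr.
  by split; apply: bd => // x; [exact: cosz_le1|exact: sinz_le1].
move=> [cu iu [du nu]]; have [IHc IHs] := IH _ nu.
have [bc bs] := byparts z du cu (L1_derivatives_cont nu) iu (L1_derivatives_int nu).
have e : 2 * pi * `|z i0 j0| = `|2 * pi * z i0 j0| by rewrite normrM (ger0_norm pi0).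
rewrite /iterD !iterSr -/(iterD _ _ _).
split.
  move: IHs; rewrite bs normrN normrM -e mulrA -exprSr.
  exact.
by move: IHc; rewrite bc normrM -e mulrA -exprSr; exact.
Qed.

End oscillatory_integrals.

(** * Gaussian factors *)

Section exponential_decay.
Context {R : realType}.

Lemma powRDp (x r s : R) : 0 < x -> x `^ (r + s) = x `^ r * x `^ s.
Proof. by move=> x0; rewrite powRD// (gt_eqF x0) implybT. Qed.

Lemma powR_expR_le (r : R) : 0 <= r ->
  exists2 C : R, 0 <= C & forall v, 0 < v -> v `^ r * expR (- (v / 2)) <= C.
Proof.
move=> r0; pose k := (Num.truncn r).+1.
have k0 : 0 < (2 * k)%:R :> R by rewrite ltr0n muln_gt0.
exists ((2 * k)%:R ^+ k); first by rewrite exprn_ge0// ltW.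
move=> v v0.
have le1 : v `^ r <= (1 + v) ^+ k.
  rewrite (@le_trans _ _ ((1 + v) `^ r))//.
    by apply: ge0_ler_powR => //; rewrite ?nnegrE ?lerDr// ?addr_ge0// ltW.
  rewrite -powR_mulrn; last by rewrite addr_ge0// ltW.
  by apply: ler_powR; [rewrite lerDl ltW|exact/ltW/truncnS_gt].
have le2 : (1 + v) ^+ k <= (2 * k)%:R ^+ k * expR (v / 2).
  have -> : expR (v / 2) = expR (v / (2 * k)%:R) ^+ k.
    rewrite -expRM_natl; congr expR; rewrite natrM -mulr_natr; field.
    by rewrite pnatr_eq0.
  have v1 : 0 <= 1 + v by rewrite addr_ge0// ltW.
  rewrite -exprMn; apply: lerXn2r; rewrite ?nnegrE ?mulr_ge0 ?expR_ge0//.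
  (* [1 + v <= 2k (1 + v / 2k)], and [1 + v / 2k <= expR (v / 2k)]. *)
  rewrite (@le_trans _ _ ((2 * k)%:R * (1 + v / (2 * k)%:R)))//.
    rewrite mulrDr mulr1 mulrCA divff ?mulr1 ?gt_eqF// lerD2r.
    by rewrite ler1n muln_gt0.
  by rewrite (ler_pM2l k0) expR_ge1Dx.
rewrite expRN ler_pdivrMr ?expR_gt0//.
exact: le_trans le1 le2.
Qed.

End exponential_decay.

Section gaussian_monomials.
Context {R : realType} (p q : nat).
Implicit Types (x : 'M[R]_(p, q)).

Lemma sum_sqr_ge0 x : 0 <= \sum_i \sum_j x i j ^+ 2.
Proof. by apply: sumr_ge0 => i _; apply: sumr_ge0 => j _; exact: sqr_ge0. Qed.

Lemma enorm_sqr x : enorm x ^+ 2 = \sum_i \sum_j x i j ^+ 2.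
Proof. by rewrite sqr_sqrtr// sum_sqr_ge0. Qed.

Lemma enorm_ge0 x : 0 <= enorm x.
Proof. exact: sqrtr_ge0. Qed.

Lemma coord_le_enorm x i j : `|x i j| <= enorm x.
Proof.
rewrite -sqrtr_sqr ler_wsqrtr// (bigD1 i)//= (bigD1 j)//= -addrA lerDl.
rewrite addr_ge0//; first by apply: sumr_ge0 => k _; exact: sqr_ge0.
by apply: sumr_ge0 => k _; apply: sumr_ge0 => l _; exact: sqr_ge0.
Qed.

Lemma continuous_enorm_sqr : continuous (fun x => enorm x ^+ 2).
Proof.
have -> : (fun x => enorm x ^+ 2) = (fun x => \sum_i \sum_j x i j * x i j).
  apply/funext => x; rewrite enorm_sqr.
  by apply: eq_bigr => i _; apply: eq_bigr => j _; rewrite expr2.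
apply: continuous_sum => i; apply: continuous_sum => j.
by apply: contM; exact: continuous_coord.
Qed.

Lemma continuous_enorm : continuous (@enorm R p q).
Proof.
have -> : @enorm R p q = (@Num.sqrt R) \o (fun x => enorm x ^+ 2).
  by apply/funext => x /=; rewrite sqrtr_sqr ger0_norm// enorm_ge0.
by move=> x; apply: continuous_comp; [exact: continuous_enorm_sqr|exact: sqrt_continuous].
Qed.

(** The Japanese bracket. *)
Definition jb x : R := 1 + enorm x.

Lemma jb_ge1 x : 1 <= jb x.
Proof. by rewrite lerDl enorm_ge0. Qed.

Lemma jb_gt0 x : 0 < jb x.
Proof. exact: lt_le_trans (jb_ge1 x). Qed.

Lemma coord_le_jb x i j : `|x i j| <= jb x.
Proof. by rewrite (le_trans (coord_le_enorm x i j))// lerDr. Qed.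

Lemma continuous_jb : continuous jb.
Proof. by apply: contD; [exact: cst_continuous|exact: continuous_enorm]. Qed.

Lemma jb_sqr_le x : jb x ^+ 2 <= 2 + 2 * enorm x ^+ 2.
Proof.
rewrite /jb -subr_ge0 (_ : _ - _ = (1 - enorm x) ^+ 2) ?sqr_ge0//; ring.
Qed.

Definition gauss (e : R) x : R := expR (- (e * enorm x ^+ 2)).

Lemma gauss_ge0 e x : 0 <= gauss e x.
Proof. exact: expR_ge0. Qed.

Lemma gauss_le1 e x : 0 <= e -> gauss e x <= 1.
Proof. by move=> e0; rewrite expR_le1 oppr_le0 mulr_ge0// sqr_ge0. Qed.

Lemma continuous_gauss e : continuous (gauss e).
Proof.
move=> x; apply: (@continuous_comp _ _ _ (fun x => - (e * enorm x ^+ 2)) expR); last exact: continuous_expR.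
have : continuous (fun x => (- e) * enorm x ^+ 2).
  by apply: contZ; exact: continuous_enorm_sqr.
by move=> /(_ x); under eq_fun do rewrite mulNr.
Qed.

Section directional.
Variables (i0 : 'I_p) (j0 : 'I_q).
Local Notation E := (delta_mx i0 j0 : 'M[R]_(p, q)).

(** The derivatives of Gaussians in a coordinate direction are combinations of
    these; each derivative lowers [l - 2 * j] by one. *)
Definition gmono (j l : nat) (e : R) x : R := e ^+ j * x i0 j0 ^+ l * gauss e x.

Lemma continuous_gmono j l e : continuous (gmono j l e).
Proof.
apply: contM; last exact: continuous_gauss.
apply: contZ; elim: l => [|l IH].
  by under eq_fun do rewrite expr0; exact: cst_continuous.
under eq_fun do rewrite exprS.
by apply: contM => //; exact: continuous_coord.
Qed.

Lemma enorm_sqr_line x (s : R) :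
  enorm (x + s *: E) ^+ 2 = enorm x ^+ 2 + s * (2 * x i0 j0) + s ^+ 2.
Proof.
rewrite !enorm_sqr (bigD1 i0)//= (bigD1 j0)//= [in RHS](bigD1 i0)//= [in RHS](bigD1 j0)//=.
rewrite !mxE !eqxx mulr1.
have -> : \sum_(i < q | i != j0) (x + s *: E) i0 i ^+ 2 = \sum_(i < q | i != j0) x i0 i ^+ 2.
  by apply: eq_bigr => j jj0; rewrite !mxE (negbTE jj0) andbF mulr0 addr0.
have -> : \sum_(i < p | i != i0) \sum_j (x + s *: E) i j ^+ 2 = \sum_(i < p | i != i0) \sum_j x i j ^+ 2.
  apply: eq_bigr => i ii0; apply: eq_bigr => j _.
  by rewrite !mxE (negbTE ii0) mulr0 addr0.
ring.
Qed.

Lemma is_derive_gmono j l e x : is_derive x E (gmono j l e)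
  (l%:R * gmono j l.-1 e x - 2 * gmono j.+1 l.+1 e x).
Proof.
apply/is_derive_line0P.
set c := x i0 j0; set a := enorm x ^+ 2.
have -> : (fun s : R => gmono j l e (x + s *: E)) =
    (fun s : R => e ^+ j * (c + s) ^+ l) * (expR \o (fun s : R => - (e * (a + s * (2 * c) + s ^+ 2)))).
  apply/funext => s; rewrite /gmono /gauss enorm_sqr_line.
  by rewrite !mxE !eqxx mulr1.
have P : is_derive (0 : R) (1 : R) (fun s : R => e ^+ j * (c + s) ^+ l) (e ^+ j * (l%:R * c ^+ l.-1)).
  case: l => [|l].
    rewrite (_ : (fun _ => _) = cst (e ^+ j)); last by apply/funext => s; rewrite expr0 mulr1.
    by apply: is_derive_eq; rewrite mul0r mulr0.
  have h1 : is_derive (0 : R) (1 : R) (cst c + id) (0 + 1).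
    by apply: is_deriveD.
  have h2 := is_deriveZ (e ^+ j) (is_deriveX l.+1 h1).
  rewrite (_ : (fun _ => _) = (e ^+ j) \*: (cst c + id : R -> R) ^+ l.+1); last first.
    by apply/funext => s; rewrite exprfctE.
  apply: (is_derive_eq h2).
  by rewrite /GRing.scale/= add0r mulr1 fctE/= addr0.
have Q : is_derive (0 : R) (1 : R) (fun s : R => - (e * (a + s * (2 * c) + s ^+ 2))) (- (e * (2 * c))).
  apply: is_derive_eq.
  by rewrite /GRing.scale/= ; ring.
have S := @is_derive1_comp R expR (fun s : R => - (e * (a + s * (2 * c) + s ^+ 2))) 0 _ _
  (is_derive_expR _) Q.
apply: (is_derive_eq (is_deriveM P S)).
rewrite /GRing.scale/= /gmono /gauss mul0r expr0n/= !addr0 -/c -/a exprSr exprS; ring.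
Qed.

End directional.

(** The Gaussian absorbs powers of [v = e * jb x ^ 2], so that [v ^ j] may be
    replaced by [v ^ s] for any [s <= j]. *)
Lemma gmono_bound i0 j0 j l (s : R) : s <= j%:R ->
  exists2 C : R, 0 <= C & forall e x, 0 < e -> e <= 1 ->
    `|gmono i0 j0 j l e x| <=
      C * ((e * jb x ^+ 2) `^ s * jb x `^ (l%:R - 2 * j%:R)).
Proof.
move=> sj; have [|C C0 hC] := @powR_expR_le R (j%:R - s); first by rewrite subr_ge0.
exists (C * expR 1); first by rewrite mulr_ge0// expR_ge0.
move=> e x e0 e1; have jb0 := jb_gt0 x.
set v := e * jb x ^+ 2; have v0 : 0 < v by rewrite mulr_gt0// exprn_gt0.
rewrite /gmono !normrM normrX (ger0_norm (ltW e0)) normrX (ger0_norm (gauss_ge0 _ _)).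
have le1 : e ^+ j * `|x i0 j0| ^+ l <= v `^ j%:R * jb x `^ (l%:R - 2 * j%:R).
  rewrite powR_mulrn; last exact: ltW.
  rewrite /v exprMn -mulrA ler_wpM2l ?exprn_ge0//; first exact: ltW.
  rewrite -exprM -(powR_mulrn _ (ltW jb0)) -powRDp//.
  rewrite natrM (addrC _ (_ - _)) subrK (powR_mulrn _ (ltW jb0)).
  by rewrite lerXn2r ?nnegrE ?coord_le_jb// ltW.
have le2 : gauss e x <= expR 1 * expR (- (v / 2)).
  rewrite /gauss -expRD ler_expR /v.
  have := jb_sqr_le x; rewrite -(ler_pM2l e0) => h.
  rewrite mulrDr (mulrCA e 2) in h.
  move: (e * jb x ^+ 2) (e * enorm x ^+ 2) h => A B; lra.
apply: (le_trans (ler_pM _ _ le1 le2)).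
- by rewrite mulr_ge0// exprn_ge0// ltW.
- exact: gauss_ge0.
have -> : v `^ j%:R = v `^ (j%:R - s) * v `^ s.
  by rewrite -powRDp ?subrK.
have h := hC _ v0.
set w := jb x `^ _; set v1 := v `^ _ in h *; set v2 := v `^ s.
rewrite (_ : v1 * v2 * w * _ = v1 * expR (- (v / 2)) * (expR 1 * (v2 * w))); last by ring.
rewrite -(mulrA C) ler_wpM2r// mulr_ge0 ?expR_ge0//.
by rewrite mulr_ge0// powR_ge0.
Qed.

End gaussian_monomials.

(** * Families of symbols *)

Section families.
Context {R : realType} (p q : nat) (P : Type) (D : set P).
Variables (E : 'M[R]_(p, q)) (rho : R).
Implicit Types (u v : P -> 'M[R]_(p, q) -> R) (Th : P -> 'M[R]_(p, q) -> R).

(** Symbol estimates in the single direction [E], with constants uniform over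
    the parameters in [D]; [Th] is an extra weight. *)
Fixpoint fam (N : nat) (r : R) Th u : Prop :=
  [/\ forall t, D t -> continuous (u t),
      exists2 C : R, 0 <= C & forall t x, D t ->
        `|u t x| <= C * (Th t x * jb x `^ r) &
      if N is N'.+1 then
        (forall t x, D t -> derivable (u t) x E) /\
        fam N' (r - rho) Th (fun t => 'D_E (u t))
      else True].

Lemma fam_bound N r Th u : fam N r Th u ->
  exists2 C : R, 0 <= C & forall t x, D t -> `|u t x| <= C * (Th t x * jb x `^ r).
Proof. by case: N => [|N] []. Qed.

Lemma fam_bound_iterD N r Th u : fam N r Th u ->
  exists2 C : R, 0 <= C & forall t x, D t ->
    `|iterD N E (u t) x| <= C * (Th t x * jb x `^ (r - rho * N%:R)).
Proof.
elim: N r u => [|N IH] r u.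
  by move=> /fam_bound; rewrite mulr0 subr0.
move=> [_ _ [_ /IH[C C0 h]]]; exists C => // t x Dt.
rewrite /iterD iterSr (le_trans (h t x Dt))//.
by rewrite -natr1 mulrDr mulr1 opprD addrA addrAC.
Qed.

Lemma fam_ext N r Th u v : (forall t, D t -> u t = v t) -> fam N r Th u -> fam N r Th v.
Proof.
elim: N r u v => [|N IH] r u v uv.
  move=> [cu [C C0 bu] _]; split=> // [t Dt|]; first by rewrite -uv//; exact: cu.
  by exists C => // t x Dt; rewrite -uv//; exact: bu.
move=> [cu [C C0 bu] [du fu]]; split.
- by move=> t Dt; rewrite -uv//; exact: cu.
- by exists C => // t x Dt; rewrite -uv//; exact: bu.
- split; first by move=> t x Dt; rewrite -uv//; exact: du.
  by apply: IH fu => t Dt; rewrite uv.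
Qed.

(** A power of [jb] may be moved between the weight and the order. *)
Lemma fam_weaken N r r' Th Th' u (A : R) : 0 <= A ->
  (forall t x, D t -> Th t x * jb x `^ r <= A * (Th' t x * jb x `^ r')) ->
  fam N r Th u -> fam N r' Th' u.
Proof.
move=> A0; elim: N r r' u => [|N IH] r r' u h [cu [C C0 bu] H]; split => //.
- exists (C * A); first exact: mulr_ge0.
  by move=> t x Dt; rewrite (le_trans (bu t x Dt))// -mulrA ler_wpM2l// h.
- exists (C * A); first exact: mulr_ge0.
  by move=> t x Dt; rewrite (le_trans (bu t x Dt))// -mulrA ler_wpM2l// h.
- case: H => du fu; split=> //; apply: IH fu => t x Dt.
  rewrite !powRDp ?jb_gt0// !mulrA ler_wpM2r ?powR_ge0//.
  by rewrite -mulrA h.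
Qed.

Lemma famS N r Th u : fam N.+1 r Th u -> fam N r Th u.
Proof.
elim: N r u => [|N IH] r u [cu bu [du fu]]; split=> //.
by split=> //; exact: IH.
Qed.

Lemma famD N r Th u v : fam N r Th u -> fam N r Th v -> fam N r Th (fun t x => u t x + v t x).
Proof.
elim: N r u v => [|N IH] r u v [cu [C C0 bu] Hu] [cv [C' C0' bv] Hv]; split.
- by move=> t Dt; apply: contD; [exact: cu|exact: cv].
- exists (C + C'); first exact: addr_ge0.
  move=> t x Dt; rewrite (le_trans (ler_normD _ _))// mulrDl lerD//; [exact: bu|exact: bv].
- by [].
- by move=> t Dt; apply: contD; [exact: cu|exact: cv].
- exists (C + C'); first exact: addr_ge0.
  move=> t x Dt; rewrite (le_trans (ler_normD _ _))// mulrDl lerD//; [exact: bu|exact: bv].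
case: Hu Hv => du fu [dv fv]; split.
  by move=> t x Dt; apply: derivableD; [exact: du|exact: dv].
apply: fam_ext (IH _ _ _ fu fv) => t Dt; apply/funext => x.
by rewrite (deriveD (du t x Dt) (dv t x Dt)).
Qed.

Lemma famZ N r Th (c : R) u : fam N r Th u -> fam N r Th (fun t x => c * u t x).
Proof.
elim: N r u => [|N IH] r u [cu [C C0 bu] Hu]; split.
- by move=> t Dt; apply: contZ; exact: cu.
- exists (`|c| * C); first exact: mulr_ge0.
  by move=> t x Dt; rewrite normrM -mulrA ler_wpM2l// bu.
- by [].
- by move=> t Dt; apply: contZ; exact: cu.
- exists (`|c| * C); first exact: mulr_ge0.
  by move=> t x Dt; rewrite normrM -mulrA ler_wpM2l// bu.
case: Hu => du fu; split.
  by move=> t x Dt; have := @derivableZ _ _ _ _ c _ _ (du t x Dt).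
apply: fam_ext (IH _ _ fu) => t Dt; apply/funext => x.
exact: esym (deriveZ c (du t x Dt)).
Qed.

Lemma famB N r Th u v : fam N r Th u -> fam N r Th v -> fam N r Th (fun t x => u t x - v t x).
Proof.
move=> fu fv; apply: fam_ext (famD fu (famZ (-1) fv)) => t _.
by apply/funext => x; rewrite mulN1r.
Qed.

Lemma famM N r1 r2 Th1 Th2 u v :
  fam N r1 Th1 u -> fam N r2 Th2 v ->
  fam N (r1 + r2) (fun t x => Th1 t x * Th2 t x) (fun t x => u t x * v t x).
Proof.
have bd w1 w2 C C' s1 s2 t x : `|w1 t x| <= C * (Th1 t x * jb x `^ s1) ->
    `|w2 t x| <= C' * (Th2 t x * jb x `^ s2) ->
    `|w1 t x * w2 t x| <= C * C' * (Th1 t x * Th2 t x * jb x `^ (s1 + s2)).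
  move=> b1 b2; rewrite normrM powRDp ?jb_gt0//.
  apply: (le_trans (ler_pM (normr_ge0 _) (normr_ge0 _) b1 b2)).
  by rewrite le_eqVlt; apply/orP; left; apply/eqP; ring.
elim: N r1 r2 u v => [|N IH] r1 r2 u v fu fv.
  move: fu fv => [cu [C C0 bu] _] [cv [C' C0' bv] _]; split.
  - by move=> t Dt; apply: contM; [exact: cu|exact: cv].
  - exists (C * C'); first exact: mulr_ge0.
    by move=> t x Dt; apply: bd; [exact: bu|exact: bv].
  - by [].
have fu' := famS fu; have fv' := famS fv.
move: fu fv => [cu [C C0 bu] [du fu]] [cv [C' C0' bv] [dv fv]]; split.
- by move=> t Dt; apply: contM; [exact: cu|exact: cv].
- exists (C * C'); first exact: mulr_ge0.
  by move=> t x Dt; apply: bd; [exact: bu|exact: bv].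
split.
  by move=> t x Dt; apply: derivableM; [exact: du|exact: dv].
have h1 := IH _ _ _ _ fu' fv; have h2 := IH _ _ _ _ fu fv'.
rewrite addrA in h1; rewrite addrAC in h2.
apply: fam_ext (famD h1 h2) => t Dt; apply/funext => x.
rewrite (deriveM (du t x Dt) (dv t x Dt)) /GRing.scale/=.
by rewrite [in RHS]addrC addrC (mulrC ('D_E (u t) x)).
Qed.

Lemma fam_L1_derivatives N r Th u t : D t ->
  (forall k, (k <= N)%N -> (@vol R p q).-integrable setT
     (fun x => (Th t x * jb x `^ (r - rho * k%:R))%:E)) ->
  fam N r Th u -> L1_derivatives N E (u t).
Proof.
move=> Dt; elim: N r u => [|N IH] r u iTh fu.
  have [cu [C C0 bu] _] := fu; split=> //; first exact: cu.
  apply: (le_integrable measurableT _ _ (integrableZl measurableT C (iTh 0%N isT))).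
    by apply/measurable_EFinP; apply: continuous_measurable_mx; exact: cu.
  move=> x _; rewrite mulr0 subr0 -EFinM /= lee_fin (le_trans (bu t x Dt))//.
  exact: ler_norm.
have [cu [C C0 bu] [du fu']] := fu; split; first exact: cu.
  apply: (le_integrable measurableT _ _ (integrableZl measurableT C (iTh 0%N isT))).
    by apply/measurable_EFinP; apply: continuous_measurable_mx; exact: cu.
  move=> x _; rewrite mulr0 subr0 -EFinM /= lee_fin (le_trans (bu t x Dt))//.
  exact: ler_norm.
split; first by move=> x; exact: du.
apply: (IH (r - rho) (fun t => 'D_E (u t))) => // k kN; have := iTh k.+1 kN.
by rewrite -natr1 mulrDr mulr1 opprD addrA addrAC.
Qed.

End families.

Section gaussian_families.
Context {R : realType} (p q : nat) (P : Type) (D : set P).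
Variables (i0 : 'I_p) (j0 : 'I_q) (rho : R).
Hypothesis rho01 : 0 <= rho <= 1.
Variable e : P -> R.
Hypothesis e01 : forall t, D t -> 0 < e t <= 1.
Local Notation E := (delta_mx i0 j0 : 'M[R]_(p, q)).
Local Notation Th s := (fun t (x : 'M[R]_(p, q)) => (e t * jb x ^+ 2) `^ s).

(** A derivative lowers the order of a Gaussian monomial by one, hence at
    least by [rho]. *)
Lemma fam_gmono N j l (s : R) : s <= j%:R ->
  fam D E rho N (l%:R - 2 * j%:R) (Th s) (fun t => gmono i0 j0 j l (e t)).
Proof.
elim: N j l => [|N IH] j l sj.
  split=> [t Dt||//]; first exact: continuous_gmono.
  have [C C0 h] := gmono_bound i0 j0 l sj.
  by exists C => // t x /e01/andP[? ?]; exact: h.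
split=> [t Dt||]; first exact: continuous_gmono.
  have [C C0 h] := gmono_bound i0 j0 l sj.
  by exists C => // t x /e01/andP[? ?]; exact: h.
split; first by move=> t x Dt; have [] := is_derive_gmono i0 j0 j l (e t) x.
apply: (@fam_ext _ _ _ _ _ _ _ _ _ _
    (fun t x => l%:R * gmono i0 j0 j l.-1 (e t) x - 2 * gmono i0 j0 j.+1 l.+1 (e t) x)).
  by move=> t Dt; apply/funext => x; have [_ ->] := is_derive_gmono i0 j0 j l (e t) x.
have [rho0 rho1] := andP rho01.
have W k : k%:R <= l%:R - 1 :> R -> forall t (x : 'M[R]_(p, q)), D t ->
    (e t * jb x ^+ 2) `^ s * jb x `^ (k%:R - 2 * j%:R) <=
    1 * ((e t * jb x ^+ 2) `^ s * jb x `^ (l%:R - 2 * j%:R - rho)).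
  move=> kl t x Dt; rewrite mul1r ler_wpM2l ?powR_ge0//.
  by apply: ler_powR; [exact: jb_ge1|lra].
apply: famB => //.
  case: l {IH} (IH j l.-1 sj) W => [|l] /= IHl W.
    have -> : (fun (t : P) x => 0 * gmono i0 j0 j 0 (e t) x) = (fun t x => 0 : R).
      by apply/funext => t; apply/funext => x; rewrite mul0r.
    elim: (N) (0 - 2 * j%:R - rho) => [|k IHk] r; split=> //.
    - by move=> t _; exact: cst_continuous.
    - by exists 0 => // t x _; rewrite normr0 mul0r.
    - by move=> t _; exact: cst_continuous.
    - by exists 0 => // t x _; rewrite normr0 mul0r.
    - split; first by move=> t x _; exact: derivable_cst.
      apply: fam_ext (IHk (r - rho)) => t _; apply/funext => x.
      by rewrite derive_cst.
  apply: famZ => //; apply: (fam_weaken _ (W l _) IHl) => //.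
  by rewrite -natr1 addrK.
apply: famZ => //; have sj1 : s <= j.+1%:R by rewrite (le_trans sj)// ler_nat.
apply: (fam_weaken _ _ (IH j.+1 l.+1 sj1)) => [|t x Dt]; first exact: ler01.
rewrite mul1r ler_wpM2l ?powR_ge0//.
apply: ler_powR; first exact: jb_ge1.
by rewrite -!natr1; lra.
Qed.

End gaussian_families.

(** * Dyadic decompositions *)

Section dyadic.
Context {R : realType}.

Lemma nat_le_pow2 (k : nat) : k%:R <= 2 ^+ k :> R.
Proof. by rewrite -natrX ler_nat ltnW// ltn_expl. Qed.

Lemma dyadic_up (x : R) : exists k : nat,
  x <= 2 ^+ k /\ 2 ^+ k <= Num.max 1 (2 * x).
Proof.
have ex : exists k : nat, x <= 2 ^+ k.
  exists (Num.truncn x).+1; apply: (le_trans (ltW (truncnS_gt x))).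
  exact: nat_le_pow2.
exists (ex_minn ex); case: ex_minnP => k xk kmin; split => //.
case: k xk kmin => [|k] _ kmin; first by rewrite expr0 le_max lexx.
rewrite le_max; apply/orP; right; rewrite exprS ler_pM2l//.
by rewrite leNgt; apply/negP => /ltW/kmin; rewrite ltnn.
Qed.

Lemma powR2_lt1 (t : R) : t < 0 -> 2 `^ t < 1.
Proof. by move=> t0; rewrite /powR pnatr_eq0/= expR_lt1 pmulr_llt0// ln_gt0// ltr1n. Qed.

Lemma nneseries_geometric_le (c r : R) : 0 <= c -> 0 < r -> r < 1 ->
  (\sum_(0 <= k <oo) (c * r ^+ k)%:E <= (c / (1 - r))%:E)%E.
Proof.
move=> c0 r0 r1; apply: lime_le.
  by apply: is_cvg_nneseries => k _ _; rewrite lee_fin mulr_ge0// exprn_ge0// ltW.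
apply: nearW => n /=; rewrite sumEFin lee_fin.
by apply: geometric_le_lim => //; rewrite ger0_norm// ltW.
Qed.

Lemma le_nneseries_term (u : nat -> \bar R) k : (forall k, (0 <= u k)%E) ->
  (u k <= \sum_(0 <= j <oo) u j)%E.
Proof.
move=> u0; apply: le_trans (nneseries_lim_ge k.+1 _); last by move=> *; exact: u0.
by rewrite big_nat_recr//= leeDr// sume_ge0.
Qed.

Section balls.
Variables p q : nat.

Definition sball (r : R) : set 'M[R]_(p, q) := box (const_mx (- r)) (const_mx r).

Lemma sballE r (x : 'M[R]_(p, q)) : sball r x <-> forall i j, `|x i j| <= r.
Proof.
split=> h i j; first by have := h i j; rewrite !mxE ler_norml.
by rewrite !mxE -ler_norml.
Qed.

Lemma measurable_sball r : measurable (sball r).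
Proof. exact: measurable_box. Qed.

Lemma vol_sball r : 0 <= r -> @vol R p q (sball r) = ((2 * r) ^+ (p * q))%:E.
Proof.
move=> r0; rewrite leb_mx_boxE; last by move=> i j; rewrite !mxE; lra.
congr EFin; under eq_bigr => i _.
  under eq_bigr => j _ do rewrite !mxE opprK -mulr2n -mulr_natl.
  rewrite prodr_const card_ord.
  over.
by rewrite prodr_const card_ord -exprM mulnC.
Qed.

(** [jb] is comparable to a power of two on each dyadic shell. *)
Lemma jb_dyadic (x : 'M[R]_(p, q)) : exists k : nat,
  sball (2 ^+ k) x /\ 2 ^+ k <= 2 * jb x.
Proof.
have [k [xk kx]] := dyadic_up (enorm x); exists k; split.
  by apply/sballE => i j; rewrite (le_trans (coord_le_enorm x i j)).
rewrite (le_trans kx)// /jb ge_max; have := enorm_ge0 x; lra.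
Qed.

Lemma measurable_jb_powR (s : R) : measurable_fun setT (fun x : 'M[R]_(p, q) => jb x `^ s).
Proof.
apply: (measurableT_comp (measurable_powR s)).
by apply: continuous_measurable_mx; exact: continuous_jb.
Qed.

Lemma integrable_jb (s : R) : s < - (p * q)%:R ->
  (@vol R p q).-integrable setT (fun x => (jb x `^ s)%:E).
Proof.
move=> sd; apply/integrableP; split; first by apply/measurable_EFinP; exact: measurable_jb_powR.
pose c := 2 `^ (- s).
pose r : R := 2 `^ (s + (p * q)%:R).
have r0 : 0 < r by rewrite powR_gt0.
have r1 : r < 1.
  by apply: powR2_lt1; lra.
pose g k (x : 'M[R]_(p, q)) := ((c * (2 ^+ k) `^ s)%:E * (\1_(sball (2 ^+ k)) x)%:E)%E.
have g0 k x : (0 <= g k x)%E by rewrite mule_ge0// lee_fin mulr_ge0// powR_ge0.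
have mg k : measurable_fun setT (g k).
  apply: emeasurable_funM; first exact: measurable_cst.
  by apply/measurable_EFinP; apply: measurable_indic; exact: measurable_sball.
have le1 : (\int[@vol R p q]_x `|(jb x `^ s)%:E| <= \int[@vol R p q]_x \sum_(0 <= k <oo) g k x)%E.
  apply: ge0_le_integral => //.
  - by apply: measurableT_comp => //; apply/measurable_EFinP; exact: measurable_jb_powR.
  - by apply: ge0_emeasurable_sum => // k _.
  move=> x _; have [k [xk kx]] := jb_dyadic x.
  apply: le_trans (le_nneseries_term k (fun k => g0 k x)).
  rewrite /g indicE mem_set//= mule1 lee_fin ger0_norm ?powR_ge0//.
  rewrite /c powRN mulrC ler_pdivlMr ?powR_gt0//.
  rewrite -powRM ?(ltW (jb_gt0 x))// mulrC.
  rewrite -[s]opprK !(powRN _ (- s)) lef_pV2 ?posrE ?powR_gt0 ?mulr_gt0 ?exprn_gt0 ?jb_gt0//.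
  apply: ge0_ler_powR; rewrite ?nnegrE ?exprn_ge0 ?mulr_ge0 ?(ltW (jb_gt0 x))//.
  by have : 0 <= (p * q)%:R :> R by []; lra.
apply: (le_lt_trans le1); rewrite integral_nneseries//.
pose C := c * 2 ^+ (p * q).
have C0 : 0 <= C by rewrite mulr_ge0 ?powR_ge0.
rewrite (@le_lt_trans _ _ (C / (1 - r))%:E) ?ltry//.
rewrite (le_trans _ (nneseries_geometric_le C0 r0 r1))//.
apply: lee_nneseries => [k *|k _]; first by apply: integral_ge0 => x _; exact: g0.
rewrite ge0_integralZl//; last 2 first.
- by apply/measurable_EFinP; apply: measurable_indic; exact: measurable_sball.
- by rewrite lee_fin mulr_ge0 ?powR_ge0.
rewrite integral_indic//; last exact: measurable_sball.
rewrite setIT [X in (_ * X)%E](_ : _ = ((2 * 2 ^+ k) ^+ (p * q))%:E); last first.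
  by apply: vol_sball; rewrite exprn_ge0.
rewrite -EFinM lee_fin /C /r exprMn le_eqVlt; apply/orP; left; apply/eqP.
have -> : (2 `^ (s + (p * q)%:R)) ^+ k = (2 ^+ k) `^ s * (2 ^+ k) ^+ (p * q) :> R.
  rewrite powRDp// exprMn; congr (_ * _); last by rewrite powR_mulrn// -!exprM mulnC.
  by rewrite -powR_mulrn ?powR_ge0// -powRrM mulrC powRrM powR_mulrn.
ring.
Qed.

End balls.
End dyadic.

(** * Symbols as oscillatory integrands *)

Section kernel_decay.
Context {R : realType} (p q : nat) (P : Type) (D : set P) (rho : R).
Hypotheses (p0 : (0 < p)%N) (q0 : (0 < q)%N).

Lemma two_pi_ge1 : 1 <= 2 * pi :> R.
Proof. by have := @pi_ge2 R; lra. Qed.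

Lemma norm_coord_ex (z : 'M[R]_(p, q)) : exists i j, `|z| = `|z i j|.
Proof.
have [z0|z0] := eqVneq `|z| 0.
  move: (z0) => /normr0_eq0 ze; exists (Ordinal p0), (Ordinal q0).
  by rewrite z0 ze mxE normr0.
by have [[i j] /= h] := mx_norm_neq0 z0; exists i, j.
Qed.

Lemma norm_le_sball r (z : 'M[R]_(p, q)) : `|z| <= r <-> sball r z.
Proof.
split; last by move=> /sballE h; have [i [j ->]] := norm_coord_ex z; exact: h.
move=> zr; apply/sballE => i j; apply: le_trans zr.
by rewrite /Num.norm/= mx_normrE; apply: (le_bigmax _ (fun ij : 'I_p * 'I_q => `|z ij.1 ij.2|) (i, j)).
Qed.

(** Integrating by parts in the coordinate in which [z] is largest. *)
Lemma family_decay N r Th (u : P -> 'M[R]_(p, q) -> R) :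
  (forall t x, D t -> 0 <= Th t x) ->
  (forall i j, fam D (delta_mx i j) rho N r Th u) ->
  (forall i j t, D t -> L1_derivatives N (delta_mx i j) (u t)) ->
  (forall t, D t -> (@vol R p q).-integrable setT
    (fun x => (Th t x * jb x `^ (r - rho * N%:R))%:E)) ->
  exists2 C : R, 0 <= C & forall t z, D t ->
    `|z| ^+ N * `|\int[@vol R p q]_x (u t x * cosz z x)| <=
      C * \int[@vol R p q]_x (Th t x * jb x `^ (r - rho * N%:R)) /\
    `|z| ^+ N * `|\int[@vol R p q]_x (u t x * sinz z x)| <=
      C * \int[@vol R p q]_x (Th t x * jb x `^ (r - rho * N%:R)).
Proof.
move=> Th0 fu nu iTh.
have /choice[C hC] : forall ij : 'I_p * 'I_q, exists C : R, 0 <= C /\ forall t x, D t ->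
    `|iterD N (delta_mx ij.1 ij.2) (u t) x| <= C * (Th t x * jb x `^ (r - rho * N%:R)).
  by move=> [i j] /=; have [C C0 h] := fam_bound_iterD (fu i j); exists C.
exists (\sum_ij C ij); first by apply: sumr_ge0 => ij _; have [] := hC ij.
move=> t z Dt; have [i [j zij]] := norm_coord_ex z.
have [hc hs] := oscillatory_decay z (nu i j t Dt).
have n0 := nu i j t Dt.
have bnd : \int[@vol R p q]_x `|iterD N (delta_mx i j) (u t) x| <=
    (\sum_ij C ij) * \int[@vol R p q]_x (Th t x * jb x `^ (r - rho * N%:R)).
  rewrite -RintegralZl//; last exact: iTh.
  apply: le_Rintegral => //.
  - exact: integrable_norm (L1_derivatives_iterD n0).
  - have := integrableZl measurableT (\sum_ij C ij) (iTh t Dt).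
    by apply: eq_integrable => // x _; rewrite /= EFinM.
  move=> x _; have [C0 h] := hC (i, j); apply: (le_trans (h t x Dt)).
  apply: ler_wpM2r; first by rewrite mulr_ge0 ?powR_ge0// Th0.
  by rewrite (bigD1 (i, j))//= lerDl sumr_ge0// => ij _; have [] := hC ij.
have pw (I0 : R) : 0 <= I0 -> `|z| ^+ N * I0 <= (2 * pi * `|z i j|) ^+ N * I0.
  move=> I00; apply: ler_wpM2r => //; rewrite zij; apply: lerXn2r; rewrite ?nnegrE//.
    by rewrite mulr_ge0// mulr_ge0// pi_ge0.
  by rewrite ler_peMl// two_pi_ge1.
by split; apply: le_trans (pw _ (normr_ge0 _)) _; [exact: le_trans hc bnd|exact: le_trans hs bnd].
Qed.

End kernel_decay.

Section symbol_families.
Context {R : realType} (m n : nat).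
Variables (rho delta tau : R) (a : 'rV[R]_n * 'M[R]_(m, n) -> R[i]).
Hypothesis ha : symbol_class tau rho delta a.

Lemma flatten_nseq_pred1 (T : eqType) (U : Type) (s : seq T) (t0 : T) (k : nat) (f : T -> U) :
  uniq s -> flatten [seq nseq (if t == t0 then k else 0%N) (f t) | t <- s] =
    if t0 \in s then nseq k (f t0) else [::].
Proof.
elim: s => [//|t s IH] /= /andP[ts us]; rewrite IH// inE.
have [tt0|//] := eqVneq t t0; rewrite -tt0 (negbTE ts) cats0.
by [].
Qed.

Lemma directions_pure i0 j0 k :
  @directions R m n (fun _ => 0%N)
    (fun i j => if (i, j) == (i0, j0) then k else 0%N) = nseq k (0, delta_mx i0 j0).
Proof.
rewrite /directions (_ : flatten _ = [::]) /=; last first.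
  by rewrite /image_mem; elim: (enum _).
have /= := @flatten_nseq_pred1 _ _ (enum {: 'I_m * 'I_n}) (i0, j0) k
  (fun ij : 'I_m * 'I_n => ((0, delta_mx ij.1 ij.2) : 'rV[R]_n * 'M[R]_(m, n))) (enum_uniq _).
rewrite mem_enum inE => <-; congr flatten.
Qed.

Variables (i0 : 'I_m) (j0 : 'I_n).
Local Notation E := (delta_mx i0 j0 : 'M[R]_(m, n)).
Local Notation E2 := ((0, E) : 'rV[R]_n * 'M[R]_(m, n)).
Let b k := cderives (nseq k E2) a.

Lemma symbol_pure_bound k : exists2 C : R, 0 <= C & forall x xi,
  Normc.normc (b k (x, xi)) <= C * jb xi `^ (tau - rho * k%:R).
Proof.
have [_ /(_ (fun _ => 0%N) (fun i j => if (i, j) == (i0, j0) then k else 0%N))[C hC]] := ha.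
exists `|C| => // x xi; move: (hC x xi); rewrite /partials directions_pure -/(b k).
rewrite pair_bigA/= (bigD1 (i0, j0))//= eqxx big1 ?addn0; last by move=> [i j] /negbTE ->.
rewrite big1// mulr0 addr0 => /le_trans; apply.
by rewrite ler_wpM2r ?powR_ge0// ler_norm.
Qed.

Let derive_slice (g : 'rV[R]_n * 'M[R]_(m, n) -> R) x xi :
  differentiable g (x, xi) ->
  is_derive xi E (fun xi => g (x, xi)) ('D_E2 g (x, xi)).
Proof.
move=> dg; have e : (fun h : R => h^-1 *: (((fun xi => g (x, xi)) \o shift xi) (h *: E) - g (x, xi))) =
    (fun h : R => h^-1 *: ((g \o shift (x, xi)) (h *: E2) - g (x, xi))).
  apply/funext => h /=; congr (_ *: (g _ - _)).
  by apply: injective_projections; rewrite /= ?scaler0 ?add0r.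
split.
  have := @diff_derivable _ _ _ g (x, xi) E2 dg; rewrite /derivable -e.
  exact.
by rewrite /derive e.
Qed.

Let continuous_slice (g : 'rV[R]_n * 'M[R]_(m, n) -> R) x :
  (forall pt, differentiable g pt) -> continuous (fun xi => g (x, xi)).
Proof.
move=> dg xi; apply: (@continuous_comp _ _ _ (fun xi => (x, xi)) g).
  exact: (@cvg_pair _ _ _ (nbhs xi) (nbhs x) (nbhs xi) _ _ _ (fun _ => x) id (cvg_cst x) cvg_id).
exact: differentiable_continuous.
Qed.

(** For fixed [x] the real and imaginary parts of the symbol satisfy symbol
    estimates in [xi], uniformly in [x]: a derivative of the slice in a
    coordinate direction is a partial derivative of the symbol. *)
Lemma fam_symbol (P : Type) (D : set P) (X : P -> 'rV[R]_n) N :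
  fam D E rho N tau (fun _ _ => 1) (fun t xi => complex.Re (a (X t, xi))) /\
  fam D E rho N tau (fun _ _ => 1) (fun t xi => complex.Im (a (X t, xi))).
Proof.
have [csm _] := ha.
suff H k : fam D E rho N (tau - rho * k%:R) (fun _ _ => 1) (fun t xi => complex.Re (b k (X t, xi))) /\
  fam D E rho N (tau - rho * k%:R) (fun _ _ => 1) (fun t xi => complex.Im (b k (X t, xi))).
  by have := H 0%N; rewrite mulr0 subr0.
elim: N k => [|N IH] k.
  have [C C0 h] := symbol_pure_bound k.
  split; split=> //.
  - by move=> t _; apply: (continuous_slice (g := fun pt => complex.Re (b k pt))) => pt; have [] := csm (nseq k E2) pt.
  - by exists C => // t x _; rewrite mul1r; exact: le_trans (normRe_le _) (h _ _).
  - by move=> t _; apply: (continuous_slice (g := fun pt => complex.Im (b k pt))) => pt; have [] := csm (nseq k E2) pt.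
  - by exists C => // t x _; rewrite mul1r; exact: le_trans (normIm_le _) (h _ _).
have [C C0 h] := symbol_pure_bound k; have [IHr IHi] := IH k.+1.
have dre t xi := derive_slice (proj1 (csm (nseq k E2) (X t, xi))).
have dim t xi := derive_slice (proj2 (csm (nseq k E2) (X t, xi))).
have ek : tau - rho * k%:R - rho = tau - rho * k.+1%:R by rewrite -natr1; ring.
split; split.
- by move=> t _; apply: (continuous_slice (g := fun pt => complex.Re (b k pt))) => pt; have [] := csm (nseq k E2) pt.
- by exists C => // t x _; rewrite mul1r; exact: le_trans (normRe_le _) (h _ _).
- split=> [t xi _|]; first by have [] := dre t xi.
  by rewrite ek; apply: fam_ext IHr => t _; apply/funext => xi; have [_ ->] := dre t xi.
- by move=> t _; apply: (continuous_slice (g := fun pt => complex.Im (b k pt))) => pt; have [] := csm (nseq k E2) pt.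
- by exists C => // t x _; rewrite mul1r; exact: le_trans (normIm_le _) (h _ _).
- split=> [t xi _|]; first by have [] := dim t xi.
  by rewrite ek; apply: fam_ext IHi => t _; apply/funext => xi; have [_ ->] := dim t xi.
Qed.

End symbol_families.

(** * Dyadic majorants of kernels *)

Section dyadic_weights.
Context {R : realType} (m d : nat) (s : R).
Hypotheses (d0 : (0 < d)%N) (s0 : 0 < s) (s4 : s <= 4^-1).

(** All powers of two: increasing to infinity along even indices, decreasing
    to zero along odd ones.  A single sequence lets both ranges of scales share
    one geometric series. *)
Definition rad (j : nat) : R := if odd j then 2 / 2 ^+ j./2 else 2 ^+ j./2.

(** The weight of the [j]-th ball is [ratio ^+ (j * m.+1)], i.e., the power
    [- s * j / 2] of two.  It is split into [m.+1] equal factors: one for each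
    of the [m] functions, and one that keeps the remaining sum finite. *)
Definition ratio : R := 2 `^ (- (s / (2 * m.+1%:R))).

Lemma rad_gt0 j : 0 < rad j.
Proof. by rewrite /rad; case: ifP => _; rewrite ?divr_gt0 ?exprn_gt0. Qed.

Lemma rad_odd k : rad k.*2.+1 = 2 / 2 ^+ k.
Proof. by rewrite /rad /= odd_double/= uphalf_double. Qed.

Lemma rad_even k : rad k.*2 = 2 ^+ k.
Proof. by rewrite /rad odd_double/= doubleK. Qed.

Lemma ratio_gt0 : 0 < ratio.
Proof. by rewrite powR_gt0. Qed.

Lemma ratio_lt1 : ratio < 1.
Proof. by apply: powR2_lt1; rewrite oppr_lt0 divr_gt0// mulr_gt0. Qed.

Lemma weightE j : ratio ^+ (j * m.+1) = 2 `^ (- (s * j%:R / 2)).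
Proof.
rewrite /ratio -powR_mulrn ?powR_ge0// -powRrM; congr (_ `^ _).
rewrite natrM; have : m.+1%:R != 0 :> R by rewrite pnatr_eq0.
by move: (m.+1%:R) => M M0; field.
Qed.

Lemma powR2_mono (x y : R) : x <= y -> 2 `^ x <= 2 `^ y :> R.
Proof. by move=> xy; apply: ler_powR => //; rewrite ler1n. Qed.

Lemma powR2_nat k : 2 `^ k%:R = 2 ^+ k :> R.
Proof. by rewrite powR_mulrn. Qed.

Definition dyadic_const : R := 4 * 2 ^+ d.

Lemma dyadic_const_gt0 : 0 < dyadic_const.
Proof. by rewrite /dyadic_const mulr_gt0// exprn_gt0. Qed.

(** The weight is comparable to [N ^ s] at the odd radii near [N <= 1], and
    at least of the order of [1 / N] at the even radii near [N >= 1]. *)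
Lemma dyadic_bound (C X N : R) : 0 < C -> 0 <= X -> 0 <= N ->
  (N <= 1 -> N ^+ d * X <= C * N `^ s) ->
  (1 <= N -> N ^+ d.+1 * X <= C) ->
  exists j, N <= rad j /\ X <= dyadic_const * C * (ratio ^+ (j * m.+1) / rad j ^+ d).
Proof.
move=> C0 X0 N0 h1 h2.
have [N00|Np] := eqVneq N 0.
  (* On the diagonal [X] is only known to be finite, so a ball small enough
     for [X] is chosen. *)
  have Cst0 : 0 < dyadic_const * C by rewrite mulr_gt0// mulr_gt0// exprn_gt0.
  pose l := (Num.truncn (X / (dyadic_const * C) * 2 ^+ d)).+1.
  exists (2 * l).*2.+1; split; first by rewrite N00 ltW// rad_gt0.
  rewrite mulrC -ler_pdivrMr//.
  have lX : X / (dyadic_const * C) * 2 ^+ d <= 2 ^+ l.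
    by apply: (le_trans (ltW (truncnS_gt _))); exact: nat_le_pow2.
  rewrite rad_odd weightE expr_div_n invf_div mulrA ler_pdivlMr ?exprn_gt0//.
  apply: (le_trans lX).
  have le1 : 2 ^+ (2 * l) <= (2 ^+ (2 * l)) ^+ d :> R.
    by rewrite -{1}[2 ^+ (2 * l)]expr1 ler_weXn2l// exprn_ege1// ler1n.
  apply: (le_trans _ (ler_wpM2l (powR_ge0 _ _) le1)).
  rewrite -!powR2_nat -powRDp//; apply: powR2_mono.
  have l1 : 1 <= l%:R :> R by rewrite ler1n.
  rewrite -natr1 -mul2n !natrM; have : s * (4 * l%:R + 1) <= 4^-1 * (4 * l%:R + 1).
    by rewrite ler_wpM2r//; lra.
  lra.
have {Np}N0' : 0 < N by rewrite lt_neqAle eq_sym Np.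
have [N1|N1] := leP N 1.
  have [k [Nk kN]] := dyadic_up N^-1.
  exists (k.*2.+1).
  have k0 : 0 < 2 ^+ k :> R by rewrite exprn_gt0.
  have kN' : 2 ^+ k * N <= 2.
    have : 2 ^+ k <= 2 * N^-1.
      by apply: (le_trans kN); rewrite ge_max lexx andbT; move: (invf_ge1 N0'); rewrite N1 => ?; lra.
    by rewrite ler_pdivlMr.
  rewrite rad_odd; split; first by rewrite ler_pdivlMr// mulrC.
  have X1 : X <= C * N `^ s / N ^+ d.
    by rewrite ler_pdivlMr ?exprn_gt0// mulrC h1.
  apply: (le_trans X1).
  have le1 : N `^ s <= 4 * ratio ^+ (k.*2.+1 * m.+1).
    rewrite weightE.
    have : N `^ s <= (2 / 2 ^+ k) `^ s.
      by apply: ge0_ler_powR; rewrite ?nnegrE ?(ltW s0) ?divr_ge0 ?(ltW N0')// ler_pdivlMr// mulrC.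
    move/le_trans; apply.
    have -> : 2 / 2 ^+ k = 2 `^ (1 - k%:R) :> R by rewrite powRDp// powRr1// powRN powR2_nat.
    have -> : 4 = 2 `^ 2%:R :> R by rewrite powR2_nat -natrX.
    rewrite -powRrM -powRDp//; apply: powR2_mono.
    have -> : k.*2.+1%:R = 2 * k%:R + 1 :> R by rewrite -[LHS]natr1 -mul2n natrM.
    rewrite -subr_ge0 (_ : _ - _ = 2 - s * 3 / 2); last by field.
    by move: s4; lra.
  have le2 : (N ^+ d)^-1 <= 2 ^+ d * ((2 / 2 ^+ k) ^+ d)^-1.
    have -> : 2 ^+ d * ((2 / 2 ^+ k) ^+ d)^-1 = (2 ^+ k) ^+ d :> R.
      by rewrite expr_div_n invf_div mulrCA divff ?mulr1// expf_neq0.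
    by rewrite -exprVn; apply: lerXn2r; rewrite ?nnegrE ?invr_ge0 ?(ltW k0).
  rewrite /dyadic_const.
  have := ler_pM (powR_ge0 _ _) _ le1 le2; rewrite invr_ge0 exprn_ge0 ?(ltW N0')// => /(_ isT).
  move=> /(ler_wpM2l (ltW C0)); rewrite mulrA => /le_trans; apply.
  by rewrite le_eqVlt; apply/orP; left; apply/eqP; ring.
have [k [Nk kN]] := dyadic_up N.
exists k.*2.
rewrite rad_even; split=> //.
have k0 : 0 < 2 ^+ k :> R by rewrite exprn_gt0.
have {}kN : 2 ^+ k <= 2 * N by apply: (le_trans kN); rewrite ge_max lexx andbT; lra.
have X1 : X <= C / N ^+ d.+1 by rewrite ler_pdivlMr ?exprn_gt0// mulrC h2// ltW.
apply: (le_trans X1).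
have iN : N^-1 <= 2 / 2 ^+ k by rewrite ler_pdivlMr// mulrC ler_pdivrMr.
have le1 : (N ^+ d.+1)^-1 <= (2 / 2 ^+ k) ^+ d.+1.
  by rewrite -[N ^- _]exprVn lerXn2r ?nnegrE ?invr_ge0 ?divr_ge0 ?(ltW k0).
apply: (le_trans (ler_wpM2l (ltW C0) le1)).
have le2 : (2 ^+ k)^-1 <= ratio ^+ (k.*2 * m.+1) :> R.
  rewrite weightE -powR2_nat -powRN; apply: powR2_mono.
  rewrite -mul2n natrM lerN2.
  have : s * k%:R <= 4^-1 * k%:R by rewrite ler_wpM2r.
  have : 0 <= k%:R :> R by []. lra.
rewrite exprSr expr_div_n.
have -> : C * (2 ^+ d / (2 ^+ k) ^+ d * (2 / 2 ^+ k)) =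
    (2 ^+ k)^-1 * (2 * C * (2 ^+ d / (2 ^+ k) ^+ d)) by ring.
apply: (le_trans (ler_wpM2r _ le2)).
  by rewrite mulr_ge0 ?divr_ge0// mulr_ge0// ltW.
rewrite /dyadic_const -subr_ge0.
have -> : 4 * 2 ^+ d * C * (ratio ^+ (k.*2 * m.+1) / (2 ^+ k) ^+ d) -
    ratio ^+ (k.*2 * m.+1) * (2 * C * (2 ^+ d / (2 ^+ k) ^+ d)) =
    2 * C * (2 ^+ d / (2 ^+ k) ^+ d) * ratio ^+ (k.*2 * m.+1) by ring.
by rewrite mulr_ge0 ?exprn_ge0 ?(ltW ratio_gt0)// mulr_ge0 ?divr_ge0// mulr_ge0// ltW.
Qed.

End dyadic_weights.

Section regularised_kernel.
Context {R : realType}.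
Local Notation normc := (@Normc.normc R).

Lemma ler_normcD (x y : R[i]) : normc (x + y) <= normc x + normc y.
Proof. exact: le_normcD. Qed.

(** The passage from the three basic estimates to dyadic ones.  [K e] stands
    for the regularised kernel at a fixed point at distance [N] from the
    diagonal; below the scale [e = N ^+ 2] the kernel no longer depends much
    on [e], above it the trivial size estimate is good enough. *)
Lemma interpolate (d : nat) (s C N : R) (K : R -> R[i]) :
  0 < s -> 2 * s <= d%:R -> 0 < C -> 0 < N -> N <= 1 ->
  (forall e, 0 < e -> e <= 1 -> normc (K e) <= C * e `^ (s - d%:R / 2)) ->
  (forall e h, 0 < e -> e <= h -> h <= 1 -> N ^+ d * normc (K e - K h) <= C * h `^ s) ->
  (forall e, 0 < e -> e <= 1 -> N ^+ d * normc (K e) <= 4 * C * N `^ s) /\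
  (forall e h, 0 < e -> e <= h -> h <= 1 ->
     N ^+ d * normc (K e - K h) <= 4 * C * h `^ (s / 2) * N `^ s).
Proof.
move=> s0 sd C0 N0 N1 h1 h2.
have mu0 : 0 < N ^+ 2 by rewrite exprn_gt0.
have mu1 : N ^+ 2 <= 1 by rewrite exprn_ile1// ltW.
have Nd0 : 0 <= N ^+ d by rewrite exprn_ge0// ltW.
have muE t : (N ^+ 2) `^ t = N `^ (2 * t) by rewrite -powR_mulrn ?(ltW N0)// -powRrM.
have big e : N ^+ 2 <= e -> e <= 1 -> N ^+ d * normc (K e) <= C * N `^ (2 * s).
  move=> Ne e1; have e0 := lt_le_trans mu0 Ne.
  apply: (le_trans (ler_wpM2l Nd0 (h1 e e0 e1))).
  rewrite mulrCA ler_pM2l//.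
  have : e `^ (s - d%:R / 2) <= N `^ (2 * s - d%:R).
    have -> : 2 * s - d%:R = 2 * (s - d%:R / 2) by field.
    rewrite -muE -[s - _]opprK !(powRN _ (- _)) lef_pV2 ?posrE ?powR_gt0//.
    by apply: ge0_ler_powR; rewrite ?nnegrE ?(ltW mu0) ?(ltW e0)//; lra.
  move/(ler_wpM2l Nd0)/le_trans; apply.
  by rewrite -powR_mulrn ?(ltW N0)// -powRDp// addrCA subrr addr0.
have all e : 0 < e -> e <= 1 -> N ^+ d * normc (K e) <= 2 * C * N `^ (2 * s).
  move=> e0 e1; have [Ne|eN] := leP (N ^+ 2) e.
    apply: (le_trans (big e Ne e1)).
    by rewrite ler_wpM2r ?powR_ge0//; lra.
  have := h2 e (N ^+ 2) e0 (ltW eN) mu1; rewrite muE => h.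
  have := big _ (lexx _) mu1 => h'.
  rewrite -[K e](subrK (K (N ^+ 2))).
  apply: (le_trans (ler_wpM2l Nd0 (ler_normcD _ _))).
  by rewrite mulrDr; lra.
have Ns : N `^ (2 * s) <= N `^ s.
  by apply: ger_powR; rewrite ?N0//; lra.
have CN : C * N `^ (2 * s) <= C * N `^ s by rewrite ler_pM2l.
have CN0 : 0 <= C * N `^ s by rewrite mulr_ge0 ?powR_ge0// ltW.
split=> [e e0 e1|e h e0 eh h1'].
  by apply: (le_trans (all e e0 e1)); rewrite -!mulrA; lra.
have h0 := lt_le_trans e0 eh.
have [hN|Nh] := leP h (N ^+ 2).
  apply: (le_trans (h2 e h e0 eh h1')).
  have -> : h `^ s = h `^ (s / 2) * h `^ (s / 2) by rewrite -powRDp//; congr (_ `^ _); field.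
  have : h `^ (s / 2) <= N `^ s.
    have -> : N `^ s = (N ^+ 2) `^ (s / 2) by rewrite muE; congr (_ `^ _); field.
    by apply: ge0_ler_powR; rewrite ?nnegrE ?(ltW mu0) ?(ltW h0)//; lra.
  have Ch0 : 0 <= C * h `^ (s / 2) by rewrite mulr_ge0 ?powR_ge0// ltW.
  move=> /(ler_wpM2l Ch0); rewrite -!mulrA => H; apply: (le_trans H).
  rewrite ler_peMl ?mulr_ge0 ?powR_ge0// ?(ltW C0)//; lra.
have H1 := all e e0 (le_trans eh h1'); have H2 := all h h0 h1'.
apply: (le_trans (ler_wpM2l Nd0 (ler_normcD _ _))).
rewrite normcN mulrDr.
have H3 : N `^ (2 * s) <= h `^ (s / 2) * N `^ s.
  rewrite (_ : 2 * s = s + s); last by lra.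
  rewrite powRDp// ler_wpM2r ?powR_ge0//.
  have -> : N `^ s = (N ^+ 2) `^ (s / 2) by rewrite muE; congr (_ `^ _); field.
  by apply: ge0_ler_powR; rewrite ?nnegrE ?(ltW mu0) ?(ltW h0) ?(ltW Nh)//; lra.
have H4 : C * N `^ (2 * s) <= C * (h `^ (s / 2) * N `^ s) by rewrite ler_pM2l.
by move: H1 H2 H4; rewrite -!mulrA; lra.
Qed.

End regularised_kernel.

Section kernel_estimates.
Context {R : realType} (m n : nat).
Hypotheses (m0 : (0 < m)%N) (n0 : (0 < n)%N).
Variables (rho tau : R).
Hypothesis hrho : 0 <= rho <= 1.
Hypothesis htau : tau < - ((m * n)%:R * (1 - rho)).
Local Notation d := (m * n)%N.
Local Notation E i j := (delta_mx i j : 'M[R]_(m, n)).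
Local Notation mu := (@vol R m n).

Let d1 : 1 <= d%:R :> R.
Proof. by rewrite ler1n muln_gt0 m0. Qed.

Let tau0 : tau < 0.
Proof.
apply: (lt_le_trans htau); rewrite oppr_le0 mulr_ge0// subr_ge0.
by have /andP[] := hrho.
Qed.

(** A parameter [(x, (e, h))] is a point and two damping scales. *)
Let P := ('rV[R]_n * (R * R))%type.
Let D : set P := [set t | 0 < t.2.1 /\ t.2.1 <= t.2.2 /\ t.2.2 <= 1].
(** The real or the imaginary part of the symbol. *)
Variable A : 'rV[R]_n -> 'M[R]_(m, n) -> R.
Hypothesis fA : forall N i j,
  fam D (E i j) rho N tau (fun _ _ => 1) (fun t xi => A t.1 xi).

Let e1 t : D t -> 0 < t.2.1 <= 1.
Proof. by move=> [-> [eh h1]]/=; exact: le_trans h1. Qed.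

Let h1 t : D t -> 0 < t.2.2 <= 1.
Proof. by move=> [e0 [eh ->]]; rewrite andbT; exact: lt_le_trans eh. Qed.

Let weightE (e q' s : R) (xi : 'M[R]_(m, n)) : 0 < e ->
  1 * (e * jb xi ^+ 2) `^ s * jb xi `^ q' = e `^ s * jb xi `^ (2 * s + q').
Proof.
move=> e0; rewrite mul1r powRM ?ltW// ?exprn_gt0 ?jb_gt0// -mulrA; congr (_ * _).
by rewrite -powR_mulrn ?(ltW (jb_gt0 _))// -powRrM powRDp// jb_gt0.
Qed.

Let fam_gauss (e : P -> R) N i j (s : R) : (forall t, D t -> 0 < e t <= 1) -> s <= 0 ->
  fam D (E i j) rho N 0 (fun t xi => (e t * jb xi ^+ 2) `^ s) (fun t => gauss (e t)).
Proof.
move=> e01 s0; have := fam_gmono i j hrho e01 N (j := 0) 0 s0.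
rewrite mulr0 subr0; apply: fam_ext => t _.
by apply/funext => xi; rewrite /gmono !expr0 !mul1r.
Qed.

Let is_derive_gauss i j e xi :
  is_derive xi (E i j) (gauss e) (- (2 * gmono i j 1 1 e xi)).
Proof.
have := is_derive_gmono i j 0 0 e xi; rewrite mul0r sub0r.
have -> // : gmono i j 0 0 e = gauss e.
by apply/funext => x; rewrite /gmono !expr0 !mul1r.
Qed.

(** The difference of two Gaussian factors gains a power of the larger
    parameter, at the price of a growing weight. *)
Let fam_gauss_diff N i j (s : R) : 0 <= s -> s <= 1 ->
  fam D (E i j) rho N 0 (fun t xi => (t.2.2 * jb xi ^+ 2) `^ s)
    (fun t xi => gauss t.2.1 xi - gauss t.2.2 xi).
Proof.
move=> s0 s1.
have cont (t : P) : continuous (fun xi : 'M[R]_(m, n) => gauss t.2.1 xi - gauss t.2.2 xi : R).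
  by apply: contB; exact: continuous_gauss.
have bnd : exists2 C : R, 0 <= C & forall t (xi : 'M[R]_(m, n)), D t ->
    `|gauss t.2.1 xi - gauss t.2.2 xi| <= C * ((t.2.2 * jb xi ^+ 2) `^ s * jb xi `^ 0).
  exists 1 => // t xi Dt; rewrite powRr0 mulr1 mul1r.
  have /andP[e0 e01] := e1 Dt; have /andP[hh0 hh1] := h1 Dt; have [_ [eh _]] := Dt.
  have geh : gauss t.2.2 xi <= gauss t.2.1 xi.
    by rewrite ler_expR lerN2 ler_wpM2r// sqr_ge0.
  rewrite ger0_norm ?subr_ge0//.
  have v0 : 0 < t.2.2 * jb xi ^+ 2 by rewrite mulr_gt0// exprn_gt0// jb_gt0.
  have g1 := @gauss_le1 R m n _ xi (ltW e0).
  have g0 := @gauss_ge0 R m n t.2.2 xi.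
  have [v1|v1] := leP (t.2.2 * jb xi ^+ 2) 1; last first.
    apply: (@le_trans _ _ 1); first lra.
    have <- : 1 `^ s = 1 :> R by rewrite powR1.
    by apply: ge0_ler_powR; rewrite ?nnegrE ?(ltW v0)// ltW.
  apply: (@le_trans _ _ (t.2.2 * jb xi ^+ 2)); last first.
    by apply: ger1_powR; rewrite ?v0.
  have : 1 - t.2.2 * enorm xi ^+ 2 <= gauss t.2.2 xi by exact: expR_ge1Dx.
  have : t.2.2 * enorm xi ^+ 2 <= t.2.2 * jb xi ^+ 2.
    by rewrite ler_pM2l// lerXn2r ?nnegrE ?enorm_ge0 ?(ltW (jb_gt0 _))// lerDr.
  lra.
case: N => [|N]; first by split.
split=> //; split.
  move=> t xi _; have [a1 _] := is_derive_gauss i j t.2.1 xi.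
  by have [a2 _] := is_derive_gauss i j t.2.2 xi; exact: derivableB.
have f1 := fam_gmono i j hrho e1 N 1 (s1 : s <= 1%:R).
have f2 := fam_gmono i j hrho h1 N 1 (s1 : s <= 1%:R).
have [rho0 rho1] := andP hrho.
have jbl (xi : 'M[R]_(m, n)) : jb xi `^ (1 - 2 * 1) <= jb xi `^ (0 - rho).
  by apply: ler_powR; [exact: jb_ge1|lra].
have f1' : fam D (E i j) rho N (0 - rho) (fun t xi => (t.2.2 * jb xi ^+ 2) `^ s)
    (fun t => gmono i j 1 1 t.2.1).
  apply: (fam_weaken ler01 _ f1) => t xi Dt; rewrite mul1r.
  have /andP[e0 _] := e1 Dt; have /andP[hh0 _] := h1 Dt; have [_ [eh _]] := Dt.
  apply: ler_pM; rewrite ?powR_ge0//.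
  apply: ge0_ler_powR; rewrite ?nnegrE ?mulr_ge0 ?(ltW e0) ?(ltW hh0) ?(ltW (jb_gt0 _))//.
  by rewrite ler_wpM2r// sqr_ge0.
have f2' : fam D (E i j) rho N (0 - rho) (fun t xi => (t.2.2 * jb xi ^+ 2) `^ s)
    (fun t => gmono i j 1 1 t.2.2).
  apply: (fam_weaken ler01 _ f2) => t xi Dt; rewrite mul1r.
  by apply: ler_pM; rewrite ?powR_ge0.
apply: fam_ext (famB (famZ (- 2) f1') (famZ (- 2) f2')) => t _.
apply/funext => xi.
have [a1 b1] := is_derive_gauss i j t.2.1 xi.
have [a2 b2] := is_derive_gauss i j t.2.2 xi.
by rewrite (deriveB a1 a2) b1 b2 !mulNr.
Qed.

Let U (t : P) xi := A t.1 xi * (gauss t.2.1 xi - gauss t.2.2 xi).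
Let V (t : P) xi := A t.1 xi * gauss t.2.1 xi.

Let integrable_weight (e : R) s q' : 0 < e -> 2 * s + q' < - d%:R ->
  mu.-integrable setT (fun xi => (1 * (e * jb xi ^+ 2) `^ s * jb xi `^ q')%:E).
Proof.
move=> e0 sq; have := integrableZl measurableT (e `^ s) (integrable_jb sq).
by apply: eq_integrable => // xi _; rewrite weightE// EFinM.
Qed.

Let L1_derivativesV N i j t : D t -> L1_derivatives N (E i j) (V t).
Proof.
move=> Dt; have s0 : - d%:R <= 0 :> R by rewrite oppr_le0.
apply: (fam_L1_derivatives Dt _ (famM (fA N i j) (fam_gauss N i j e1 s0))).
move=> k _; have /andP[e0 _] := e1 Dt.
apply: integrable_weight => //.
have : 0 <= rho * k%:R by rewrite mulr_ge0//; have /andP[] := hrho.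
by move: d1 tau0; lra.
Qed.

Let L1_derivativesU N i j t : D t -> L1_derivatives N (E i j) (U t).
Proof.
move=> Dt; have s0 : - d%:R <= 0 :> R by rewrite oppr_le0.
have fe := fam_gauss N i j e1 s0; have fh := fam_gauss N i j h1 s0.
have fh' : fam D (E i j) rho N 0 (fun t xi => (t.2.1 * jb xi ^+ 2) `^ (- d%:R)) (fun t => gauss t.2.2).
  apply: (fam_weaken ler01 _ fh) => {Dt t} t xi Dt; rewrite mul1r.
  have /andP[e0 _] := e1 Dt; have /andP[hh0 _] := h1 Dt; have [_ [eh _]] := Dt.
  apply: ler_pM; rewrite ?powR_ge0// !powRN lef_pV2 ?posrE ?powR_gt0 ?mulr_gt0 ?exprn_gt0 ?jb_gt0//.
  apply: ge0_ler_powR; rewrite ?nnegrE ?mulr_ge0 ?(ltW e0) ?(ltW hh0) ?(ltW (jb_gt0 _))//.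
  by rewrite ler_wpM2r// sqr_ge0.
apply: (fam_L1_derivatives Dt _ (famM (fA N i j) (famB fe fh'))).
move=> k _; have /andP[e0 _] := e1 Dt.
apply: integrable_weight => //.
have : 0 <= rho * k%:R by rewrite mulr_ge0//; have /andP[] := hrho.
by move: d1 tau0; lra.
Qed.

Let decay (e : P -> R) N s (u : P -> 'M[R]_(m, n) -> R) :
  (forall t, D t -> 0 < e t) ->
  2 * s + (tau - rho * N%:R) < - d%:R ->
  (forall i j, fam D (E i j) rho N tau (fun t xi => 1 * (e t * jb xi ^+ 2) `^ s) u) ->
  (forall i j t, D t -> L1_derivatives N (E i j) (u t)) ->
  exists2 C : R, 0 < C & forall t z, D t ->
    `|z| ^+ N * `|\int[mu]_xi (u t xi * cosz z xi)| <= C * e t `^ s /\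
    `|z| ^+ N * `|\int[mu]_xi (u t xi * sinz z xi)| <= C * e t `^ s.
Proof.
move=> e0 sq fu nu.
have [//|//|C C0 h] := family_decay m0 n0 _ fu nu.
- by move=> t xi _; rewrite mul1r powR_ge0.
- by move=> t Dt; apply: integrable_weight => //; exact: e0.
pose J := \int[mu]_xi (jb xi `^ (2 * s + (tau - rho * N%:R))).
have J0 : 0 <= J by apply: Rintegral_ge0 => xi _; exact: powR_ge0.
exists (C * J + 1); first by rewrite ltr_wpDl// mulr_ge0.
move=> t z Dt; have [h1' h2'] := h t z Dt.
have eI : \int[mu]_xi (1 * (e t * jb xi ^+ 2) `^ s * jb xi `^ (tau - rho * N%:R)) = e t `^ s * J.
  under eq_Rintegral do rewrite (weightE _ _ _ (e0 _ Dt)).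
  by rewrite RintegralZl//; exact: integrable_jb.
have le : C * (e t `^ s * J) <= (C * J + 1) * e t `^ s.
  rewrite mulrDl mul1r mulrCA mulrC lerDl powR_ge0//.
by rewrite eI in h1' h2'; split; exact: le_trans le.
Qed.

Variable s : R.
Hypotheses (s0 : 0 < s) (s4 : s <= 4^-1).
Hypothesis hs : 4 * s <= - tau - d%:R * (1 - rho).

Let rho_le N : (d <= N)%N -> rho * d%:R <= rho * N%:R.
Proof. by move=> dN; rewrite ler_wpM2l ?ler_nat//; have /andP[] := hrho. Qed.

Let sd : 2 * s + tau - rho * d%:R < - d%:R.
Proof. by have := hs; move: s0; rewrite mulrBr mulr1 (mulrC d%:R rho); lra. Qed.

Definition ckern z e x : R := \int[mu]_xi (A x xi * gauss e xi * cosz z xi).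
Definition skern z e x : R := \int[mu]_xi (A x xi * gauss e xi * sinz z xi).

Let integrable_AG e x : 0 < e -> e <= 1 ->
  mu.-integrable setT (EFin \o (fun xi => A x xi * gauss e xi)).
Proof.
move=> e0 e1'; have Dt : D (x, (e, e)) by split => //=.
exact: (L1_derivatives_int (L1_derivativesV 0 (Ordinal m0) (Ordinal n0) Dt)).
Qed.

Lemma integrable_regularised e x : 0 < e -> e <= 1 ->
  mu.-integrable setT (EFin \o (fun xi => A x xi * gauss e xi)).
Proof. exact: integrable_AG. Qed.

Let diffE (b : 'M[R]_(m, n) -> R) x e h : measurable_fun setT b -> (forall xi, `|b xi| <= 1) ->
  0 < e -> e <= h -> h <= 1 ->
  \int[mu]_xi (A x xi * gauss e xi * b xi) - \int[mu]_xi (A x xi * gauss h xi * b xi) =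
  \int[mu]_xi (U (x, (e, h)) xi * b xi).
Proof.
move=> mb b1 e0 eh h1'; rewrite -RintegralB//.
- by apply: eq_Rintegral => xi _; rewrite /U /=; ring.
- by apply: integrable_bounded_mul => //; apply: integrable_AG => //; exact: le_trans h1'.
- by apply: integrable_bounded_mul => //; apply: integrable_AG => //; exact: lt_le_trans eh.
Qed.

(** The Gaussian is at most a constant times [(e * |xi| ^ 2) ^ (s - d / 2)],
    which makes the integrand of order [2 * s - d + tau < - d]. *)
Lemma kernel_size : exists2 C : R, 0 < C & forall z x e, 0 < e -> e <= 1 ->
  `|ckern z e x| <= C * e `^ (s - d%:R / 2) /\ `|skern z e x| <= C * e `^ (s - d%:R / 2).
Proof.
have s'0 : s - d%:R / 2 <= 0 by move: d1 s4; lra.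
have [||i j|i j t Dt|C C0 h] := @decay (fun t => t.2.1) 0 (s - d%:R / 2) V.
- by move=> t /e1 /andP[].
- rewrite mulr0 subr0 mulrBr mulrCA divff// mulr1; move: hs; rewrite mulrBr mulr1.
  have : d%:R * rho <= d%:R * 1 by rewrite ler_wpM2l//; have /andP[] := hrho.
  by move: s0; lra.
- by have := famM (fA 0 i j) (fam_gauss 0 i j e1 s'0); rewrite addr0.
- exact: L1_derivativesV.
exists C => // z x e e0 e1'; have Dt : D (x, (e, e)) by split => //=.
by have := h _ z Dt; rewrite expr0 !mul1r.
Qed.

(** [N >= d] integrations by parts leave an integrand of order
    [tau - rho * N < - d]. *)
Lemma kernel_decay N : (d <= N)%N -> exists2 C : R, 0 < C & forall z x e, 0 < e -> e <= 1 ->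
  `|z| ^+ N * `|ckern z e x| <= C /\ `|z| ^+ N * `|skern z e x| <= C.
Proof.
move=> dN.
have [||i j|i j t Dt|C C0 h] := @decay (fun t => t.2.1) N 0 V.
- by move=> t /e1 /andP[].
- by have := rho_le dN; have := sd; move: s0; rewrite mulr0 add0r; lra.
- by have := famM (fA N i j) (fam_gauss N i j e1 (lexx 0)); rewrite addr0.
- exact: L1_derivativesV.
exists C => // z x e e0 e1'; have Dt : D (x, (e, e)) by split => //=.
by have := h _ z Dt; rewrite powRr0 mulr1.
Qed.

(** The difference of the Gaussians raises the order by [2 * s], which is
    still less than what the hypothesis on [tau] leaves. *)
Lemma kernel_diff N : (d <= N)%N -> exists2 C : R, 0 < C & forall z x e h, 0 < e -> e <= h -> h <= 1 ->
  `|z| ^+ N * `|ckern z e x - ckern z h x| <= C * h `^ s /\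
  `|z| ^+ N * `|skern z e x - skern z h x| <= C * h `^ s.
Proof.
move=> dN; have s1 : s <= 1 by move: s4; lra.
have [||i j|i j t Dt|C C0 h] := @decay (fun t => t.2.2) N s U.
- by move=> t /h1 /andP[].
- by have := rho_le dN; have := sd; lra.
- by have := famM (fA N i j) (fam_gauss_diff N i j (ltW s0) s1); rewrite addr0.
- exact: L1_derivativesU.
exists C => // z x e h' e0 eh h1'; have Dt : D (x, (e, h')) by split => //=.
rewrite /ckern /skern !diffE//.
- by have := h _ z Dt.
- by apply: continuous_measurable_mx; exact: continuous_sinz.
- exact: sinz_le1.
- by apply: continuous_measurable_mx; exact: continuous_cosz.
- exact: cosz_le1.
Qed.

End kernel_estimates.

Section complex_kernel.
Context {R : realType} (m n : nat).
Hypotheses (m0 : (0 < m)%N) (n0 : (0 < n)%N).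
Variables (rho delta tau : R) (a : 'rV[R]_n * 'M[R]_(m, n) -> R[i]).
Hypothesis hrho : 0 <= rho <= 1.
Hypothesis htau : tau < - ((m * n)%:R * (1 - rho)).
Hypothesis ha : symbol_class tau rho delta a.
Local Notation normc := (@Normc.normc R).
Local Notation d := (m * n)%N.
Local Notation mu := (@vol R m n).

(** The kernel of the operator with symbol damped by a Gaussian. *)
Definition kern (x : 'rV[R]_n) (e : R) (z : 'M[R]_(m, n)) : R[i] :=
  cintegral mu (fun xi => (gauss e xi)%:C%C * a (x, xi) * cexpi (2 * pi * mdot z xi)).

Let ar x (xi : 'M[R]_(m, n)) := complex.Re (a (x, xi)).
Let ai x (xi : 'M[R]_(m, n)) := complex.Im (a (x, xi)).

Let far N i j := (fam_symbol ha i j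
  [set t : 'rV[R]_n * (R * R) | 0 < t.2.1 /\ t.2.1 <= t.2.2 /\ t.2.2 <= 1] (fun t => t.1) N).1.
Let fai N i j := (fam_symbol ha i j
  [set t : 'rV[R]_n * (R * R) | 0 < t.2.1 /\ t.2.1 <= t.2.2 /\ t.2.2 <= 1] (fun t => t.1) N).2.

Let int_r x e (e0 : 0 < e) (e1 : e <= 1) :=
  @integrable_regularised R m n m0 n0 rho tau hrho htau ar far e x e0 e1.
Let int_i x e (e0 : 0 < e) (e1 : e <= 1) :=
  @integrable_regularised R m n m0 n0 rho tau hrho htau ai fai e x e0 e1.

Lemma cintegrable_regularised x e : 0 < e -> e <= 1 ->
  cintegrable mu (fun xi => (gauss e xi)%:C%C * a (x, xi)).
Proof.
move=> e0 e1; split.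
  apply: eq_integrable (int_r x e0 e1) => // xi _.
  by rewrite ReM /= mul0r subr0 mulrC.
apply: eq_integrable (int_i x e0 e1) => // xi _.
by rewrite ImM /= mul0r addr0 mulrC.
Qed.

Let mcos (z : 'M[R]_(m, n)) : measurable_fun setT (cosz z).
Proof. by apply: continuous_measurable_mx; exact: continuous_cosz. Qed.

Let msin (z : 'M[R]_(m, n)) : measurable_fun setT (sinz z).
Proof. by apply: continuous_measurable_mx; exact: continuous_sinz. Qed.

Let kernE x e z : 0 < e -> e <= 1 -> kern x e z =
  ((ckern ar z e x - skern ai z e x) +i* (skern ar z e x + ckern ai z e x))%C.
Proof.
move=> e0 e1; apply: complex_eq => /=.
  rewrite -RintegralB//; last 2 first.
  - by apply: integrable_bounded_mul (int_r x e0 e1) (mcos z) _; exact: cosz_le1.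
  - by apply: integrable_bounded_mul (int_i x e0 e1) (msin z) _; exact: sinz_le1.
  by apply: eq_Rintegral => xi _; rewrite !ReM ImM /= /cosz /sinz /ar /ai; ring.
rewrite -RintegralD//; last 2 first.
- by apply: integrable_bounded_mul (int_r x e0 e1) (msin z) _; exact: sinz_le1.
- by apply: integrable_bounded_mul (int_i x e0 e1) (mcos z) _; exact: cosz_le1.
by apply: eq_Rintegral => xi _; rewrite !ImM ReM /= /cosz /sinz /ar /ai; ring.
Qed.

Let normc4 (b1 b2 b3 b4 : R) :
  normc ((b1 - b2) +i* (b3 + b4))%C <= `|b1| + `|b2| + `|b3| + `|b4|.
Proof.
apply: (le_trans (normc_le _)) => /=; rewrite -addrA lerD//.
  exact: ler_normB.
exact: ler_normD.
Qed.

(** The differences are dominated by the same balls as the kernels, with a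
    power of the larger damping parameter to spare. *)
Lemma kernel_dyadic : exists s C : R, [/\ 0 < s, s <= 4^-1, 0 < C &
  forall x z,
   (forall e, 0 < e -> e <= 1 -> exists j, `|z| <= rad j /\
      normc (kern x e z) <= C * (ratio m s ^+ (j * m.+1) / rad j ^+ d)) /\
   (forall e h, 0 < e -> e <= h -> h <= 1 -> exists j, `|z| <= rad j /\
      normc (kern x e z - kern x h z) <=
        C * h `^ (s / 2) * (ratio m s ^+ (j * m.+1) / rad j ^+ d))].
Proof.
have d0 : (0 < d)%N by rewrite muln_gt0 m0.
(* [g] is the room left by the hypothesis on [tau]. *)
pose g : R := - tau - d%:R * (1 - rho).
have g0 : 0 < g by rewrite /g; move: htau; lra.
pose s : R := Num.min 4^-1 (g / 4).
have s0 : 0 < s by rewrite lt_min invr_gt0 ltr0n divr_gt0.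
have s4 : s <= 4^-1 by rewrite ge_min lexx.
have hs : 4 * s <= g by rewrite mulrC -ler_pdivlMr// ge_min lexx orbT.
have [C1 C10 hC1] := kernel_size m0 n0 hrho htau (A := ar) far s0 s4 hs.
have [C2 C20 hC2] := kernel_size m0 n0 hrho htau (A := ai) fai s0 s4 hs.
have [C3 C30 hC3] := kernel_decay m0 n0 hrho htau (A := ar) far s0 hs (leqnSn d).
have [C4 C40 hC4] := kernel_decay m0 n0 hrho htau (A := ai) fai s0 hs (leqnSn d).
have [C5 C50 hC5] := kernel_diff m0 n0 hrho htau (A := ar) far s0 s4 hs (leqnn d).
have [C6 C60 hC6] := kernel_diff m0 n0 hrho htau (A := ai) fai s0 s4 hs (leqnn d).
have [C7 C70 hC7] := kernel_diff m0 n0 hrho htau (A := ar) far s0 s4 hs (leqnSn d).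
have [C8 C80 hC8] := kernel_diff m0 n0 hrho htau (A := ai) fai s0 s4 hs (leqnSn d).
pose Ct := 2 * (C1 + C2 + C3 + C4 + C5 + C6 + C7 + C8).
have Ct0 : 0 < Ct by rewrite /Ct; lra.
have H1 x z e : 0 < e -> e <= 1 -> normc (kern x e z) <= Ct * e `^ (s - d%:R / 2).
  move=> e0 e1; rewrite kernE//; apply: (le_trans (normc4 _ _ _ _)).
  have [q1 q2] := hC1 z x e e0 e1; have [q3 q4] := hC2 z x e e0 e1.
  apply: (@le_trans _ _ ((2 * C1 + 2 * C2) * e `^ (s - d%:R / 2))); first by lra.
  by rewrite ler_wpM2r ?powR_ge0// /Ct; lra.
have H3 x z e : 0 < e -> e <= 1 -> `|z| ^+ d.+1 * normc (kern x e z) <= Ct.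
  move=> e0 e1; rewrite kernE//.
  have zd : 0 <= `|z| ^+ d.+1 by rewrite exprn_ge0.
  apply: (le_trans (ler_wpM2l zd (normc4 _ _ _ _))); rewrite !mulrDr.
  have [q1 q2] := hC3 z x e e0 e1; have [q3 q4] := hC4 z x e e0 e1.
  by rewrite /Ct; lra.
have H2 N C C' x z e h : (forall z x e h, 0 < e -> e <= h -> h <= 1 ->
    `|z| ^+ N * `|ckern ar z e x - ckern ar z h x| <= C * h `^ s /\
    `|z| ^+ N * `|skern ar z e x - skern ar z h x| <= C * h `^ s) ->
    (forall z x e h, 0 < e -> e <= h -> h <= 1 ->
    `|z| ^+ N * `|ckern ai z e x - ckern ai z h x| <= C' * h `^ s /\
    `|z| ^+ N * `|skern ai z e x - skern ai z h x| <= C' * h `^ s) ->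
    2 * (C + C') <= Ct ->
    0 < e -> e <= h -> h <= 1 -> `|z| ^+ N * normc (kern x e z - kern x h z) <= Ct * h `^ s.
  move=> hC hC' CC e0 eh h1.
  rewrite (kernE _ _ e0 (le_trans eh h1)) (kernE _ _ (lt_le_trans e0 eh) h1).
  set p1 := ckern ar z e x; set p2 := skern ai z e x; set p3 := skern ar z e x; set p4 := ckern ai z e x.
  set q1 := ckern ar z h x; set q2 := skern ai z h x; set q3 := skern ar z h x; set q4 := ckern ai z h x.
  rewrite (_ : _ - _ = (((p1 - q1) - (p2 - q2)) +i* ((p3 - q3) + (p4 - q4)))%C); last first.
    by apply: complex_eq; rewrite ?ReB ?ImB/=; ring.
  have zd : 0 <= `|z| ^+ N by rewrite exprn_ge0.
  apply: (le_trans (ler_wpM2l zd (normc4 _ _ _ _))); rewrite !mulrDr.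
  have [r1 r3] := hC z x e h e0 eh h1; have [r4 r2] := hC' z x e h e0 eh h1.
  apply: (@le_trans _ _ (2 * (C + C') * h `^ s)); first by rewrite /p1 /q1 /p2 /q2 /p3 /q3 /p4 /q4; lra.
  by rewrite ler_wpM2r ?powR_ge0.
have H2d x z e h : 0 < e -> e <= h -> h <= 1 ->
    `|z| ^+ d * normc (kern x e z - kern x h z) <= Ct * h `^ s.
  by apply: (H2 _ _ _ x z e h hC5 hC6); rewrite /Ct; lra.
have H2S x z e h : 0 < e -> e <= h -> h <= 1 ->
    `|z| ^+ d.+1 * normc (kern x e z - kern x h z) <= Ct * h `^ s.
  by apply: (H2 _ _ _ x z e h hC7 hC8); rewrite /Ct; lra.
exists s, (dyadic_const d * (4 * Ct)); split=> // [|x z].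
  by apply: mulr_gt0; [exact: dyadic_const_gt0|exact: mulr_gt0].
have sd : 2 * s <= d%:R.
  have : 1 <= d%:R :> R by rewrite ler1n.
  by move: s4; lra.
have I (z0 : 0 < `|z|) (z1 : `|z| <= 1) := interpolate s0 sd Ct0 z0 z1 (H1 x z) (H2d x z).
split=> [e e0 e1|e h e0 eh h1].
  apply: (@dyadic_bound R m d s d0 s0 s4); [exact: mulr_gt0|exact: normc_ge0|exact: normr_ge0|..].
    have [->|z0] := eqVneq `|z| 0.
      by rewrite expr0n eqn0Ngt d0 mul0r mulr_ge0 ?powR_ge0// mulr_ge0 ?ltW.
    by move=> z1; apply: (I _ z1).1 => //; rewrite lt_neqAle eq_sym z0 normr_ge0.
  by move=> z1; apply: (le_trans (H3 x z e e0 e1)); lra.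
have h0 := lt_le_trans e0 eh.
have Ct40 : 0 < 4 * Ct * h `^ (s / 2) by rewrite (mulr_gt0 (mulr_gt0 _ Ct0))// powR_gt0.
rewrite -(mulrA _ _ (h `^ _)).
apply: (@dyadic_bound R m d s d0 s0 s4); [exact: Ct40|exact: normc_ge0|exact: normr_ge0|..].
- have [->|z0] := eqVneq `|z| 0.
    by rewrite expr0n eqn0Ngt d0 mul0r mulr_ge0 ?powR_ge0// mulr_ge0 ?powR_ge0// mulr_ge0 ?ltW.
  by move=> z1; apply: (I _ z1).2 => //; rewrite lt_neqAle eq_sym z0 normr_ge0.
- move=> z1; apply: (le_trans (H2S x z e h e0 eh h1)).
  have : h `^ s <= h `^ (s / 2) by apply: ger_powR; [rewrite h0|move: s0; lra].
  have : 0 <= h `^ s by exact: powR_ge0.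
  move=> p1 p2; apply: (@le_trans _ _ (Ct * h `^ (s / 2))); first by rewrite ler_pM2l.
  by rewrite ler_wpM2r ?powR_ge0//; lra.
Qed.

End complex_kernel.

(** * The operator as a limit of kernel operators *)

Section fubini_more.
Context {R : realType} d1 d2 (T1 : measurableType d1) (T2 : measurableType d2).
Variables (m1 : {sigma_finite_measure set T1 -> \bar R})
          (m2 : {sigma_finite_measure set T2 -> \bar R}).
Local Notation normc := (@Normc.normc R).

Lemma cintegrable_fubini (h : T1 * T2 -> R[i]) :
  cintegrable (m1 \x m2)%E h ->
  (forall x, cintegrable m2 (fun y => h (x, y))) ->
  cintegrable m1 (fun x => cintegral m2 (fun y => h (x, y))).
Proof.
move=> [hr hi] h1; split.
  apply: eq_integrable (integrable_fubini_F hr) => // x _.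
  by rewrite /fubini_F/= fineK//; have [? _] := h1 x; exact: integrable_fin_num.
apply: eq_integrable (integrable_fubini_F hi) => // x _.
by rewrite /fubini_F/= fineK//; have [_ ?] := h1 x; exact: integrable_fin_num.
Qed.

(** A measurable function dominated by a tensor product of integrable
    functions satisfies all hypotheses of Fubini at once. *)
Lemma cintegrable_tensor (u : T1 -> R[i]) (v : T2 -> R[i]) (h : T1 * T2 -> R[i]) :
  cintegrable m1 u -> cintegrable m2 v -> cmeas h ->
  (forall x y, normc (h (x, y)) <= normc (u x) * normc (v y)) ->
  [/\ cintegrable (m1 \x m2)%E h,
      forall x, cintegrable m2 (fun y => h (x, y)) &
      forall y, cintegrable m1 (fun x => h (x, y))].
Proof.
move=> iu iv mh huv.
have nu := integrable_normc iu; have nv := integrable_normc iv.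
have [mr mi] := mh.
split.
- apply/(cintegrableP _ mh).
  apply/integrable12ltyP; first by apply/measurable_EFinP; exact: measurable_normc.
  have mn : measurable_fun setT (fun z : T1 * T2 => (normc (h z))%:E).
    by apply/measurable_EFinP; exact: measurable_normc.
  apply: (@le_lt_trans _ _ (\int[m1]_x ((normc (u x))%:E * \int[m2]_y (normc (v y))%:E))%E).
    apply: ge0_le_integral => //.
    + by move=> x _; exact: integral_ge0.
    + have := measurable_fun_fubini_tonelli_F (m2 := m2) _ mn.
      move=> /(_ (fun z => _)) h0; have {}h0 := h0 _.
      under eq_fun.
        move=> x; under eq_integral do rewrite /= ger0_norm ?normc_ge0//.
        over.
      by apply: h0 => z; rewrite lee_fin normc_ge0.
    + by apply: emeasurable_funM => //; apply/measurable_EFinP; exact: measurable_normc (cintegrable_cmeas iu).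
    move=> x _; rewrite -ge0_integralZl//; last 3 first.
    + by apply/measurable_EFinP; exact: measurable_normc (cintegrable_cmeas iv).
    + by move=> y _; rewrite lee_fin normc_ge0.
    + by rewrite lee_fin normc_ge0.
    apply: ge0_le_integral => //.
    + apply: measurableT_comp => //; exact: (measurable_fun_pair2 x mn).
    + apply: emeasurable_funM; first exact: measurable_cst.
      by apply/measurable_EFinP; exact: measurable_normc (cintegrable_cmeas iv).
    by move=> y _; rewrite -EFinM /= lee_fin ger0_norm ?normc_ge0.
  rewrite ge0_integralZr//; last 3 first.
  + by apply/measurable_EFinP; exact: measurable_normc (cintegrable_cmeas iu).
  + by move=> v' _; rewrite lee_fin normc_ge0.
  + by apply: integral_ge0 => v' _; rewrite lee_fin normc_ge0.
  rewrite -(fineK (integrable_fin_num measurableT nu)).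
  rewrite -(fineK (integrable_fin_num measurableT nv)).
  by rewrite -EFinM ltry.
- move=> x; apply: (le_cintegrable (g := fun y => normc (u x) * normc (v y))) => //.
    by split; [exact: (measurable_fun_pair2 x mr)|exact: (measurable_fun_pair2 x mi)].
  have := integrableZl measurableT (normc (u x)) nv.
  by apply: eq_integrable => // y _; rewrite /= EFinM.
- move=> y; apply: (le_cintegrable (g := fun x => normc (u x) * normc (v y))) => //.
    by split; [exact: (measurable_fun_pair1 y mr)|exact: (measurable_fun_pair1 y mi)].
  have := integrableZr measurableT (normc (v y)) nu.
  by apply: eq_integrable => // x _; rewrite /= EFinM.
Qed.

End fubini_more.

Section representation.
Context {R : realType} (m n : nat).
Hypotheses (m0 : (0 < m)%N) (n0 : (0 < n)%N).
Variables (rho delta tau : R) (a : 'rV[R]_n * 'M[R]_(m, n) -> R[i]).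
Hypothesis hrho : 0 <= rho <= 1.
Hypothesis htau : tau < - ((m * n)%:R * (1 - rho)).
Hypothesis ha : symbol_class tau rho delta a.
Local Notation normc := (@Normc.normc R).
Local Notation mu := (@vol R m n).
Implicit Types (f : 'I_m -> 'rV[R]_n -> R[i]) (x : 'rV[R]_n) (y xi : 'M[R]_(m, n)).

Definition Treg (e : R) f x : R[i] :=
  cintegral mu (fun xi => (gauss e xi)%:C%C * fio_integrand a f x xi).

Definition tensor f y : R[i] := \prod_i f i (row i y).

Definition diag x : 'M[R]_(m, n) := \matrix_(i, j) x ord0 j.

Let G e x xi : R[i] := (gauss e xi)%:C%C * a (x, xi).

Let H e f x (p : 'M[R]_(m, n) * 'M[R]_(m, n)) : R[i] :=
  tensor f p.1 * (G e x p.2 * cexpi (2 * pi * mdot (diag x - p.1) p.2)).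

Lemma cintegrable_tensor_rows f : (forall i, L1 (f i)) -> cintegrable mu (tensor f).
Proof. by move=> Lf; apply: cintegrable_prod_rows => i; exact: Lf. Qed.

Let HP e f x : (forall i, L1 (f i)) -> 0 < e -> e <= 1 ->
  [/\ cintegrable (mu \x mu)%E (H e f x),
      forall y, cintegrable mu (fun xi => H e f x (y, xi)) &
      forall xi, cintegrable mu (fun y => H e f x (y, xi))].
Proof.
move=> Lf e0 e1.
have iG := cintegrable_regularised m0 n0 hrho htau ha x e0 e1.
have iF := cintegrable_tensor_rows Lf.
apply: (cintegrable_tensor iF iG).
  apply: cmeasM; first exact: (cmeas_comp (cintegrable_cmeas iF) measurable_fst).
  apply: cmeasM; first exact: (cmeas_comp (cintegrable_cmeas iG) measurable_snd).
  apply: cmeas_cexpi; apply: measurable_funM; first exact: measurable_cst.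
  apply: measurable_sum => i; apply: measurable_sum => j.
  apply: measurable_funM.
    under eq_fun do rewrite !mxE.
    apply: measurable_funB; first exact: measurable_cst.
    exact: (measurableT_comp (measurable_coord i j) measurable_fst).
  exact: (measurableT_comp (measurable_coord i j) measurable_snd).
by move=> y xi; rewrite /H !Normc.normcM normc_cexpi mulr1.
Qed.

Let phaseE x y xi :
  cexpi (2 * pi * mdot (diag x - y) xi) =
  cexpi (2 * pi * dotp x (\sum_i row i xi)) *
  \prod_i cexpi (- (2 * pi * dotp (row i y) (row i xi))).
Proof.
rewrite -cexpi_sum -cexpiD; congr cexpi.
rewrite sumrN -mulr_sumr -mulrBr; congr (_ * _).
have -> : dotp x (\sum_i row i xi) = \sum_i \sum_j x ord0 j * xi i j.
  rewrite /dotp exchange_big/=; apply: eq_bigr => j _.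
  rewrite summxE mulr_sumr; apply: eq_bigr => i _.
  by rewrite mxE.
rewrite -sumrB; apply: eq_bigr => i _.
rewrite -sumrB; apply: eq_bigr => j _.
by rewrite !mxE mulrBl.
Qed.

Lemma cintegrable_modulated f xi i : (forall i, L1 (f i)) ->
  cintegrable (@vol1 R n) (fun u => f i u * cexpi (- (2 * pi * dotp u (row i xi)))).
Proof.
move=> Lf; apply: (le_cintegrable (g := fun u => normc (f i u))); last 2 first.
- by move=> u; rewrite Normc.normcM normc_cexpi mulr1.
- exact: (integrable_normc (Lf i)).
apply: cmeasM; first exact: (cintegrable_cmeas (Lf i)).
apply: cmeas_cexpi; apply: measurableT_comp => //.
apply: measurable_funM; first exact: measurable_cst.
apply: measurable_sum => j; apply: measurable_funM; first exact: measurable_coord.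
exact: measurable_cst.
Qed.

(** Thanks to the Gaussian the double integral over [(y, xi)] converges
    absolutely, and may be computed in either order. *)
Lemma Treg_kern e f x : (forall i, L1 (f i)) -> 0 < e -> e <= 1 ->
  cintegrable mu (fun y => tensor f y * kern a x e (diag x - y)) /\
  Treg e f x = cintegral mu (fun y => tensor f y * kern a x e (diag x - y)).
Proof.
move=> Lf e0 e1; have [i0 i1 i2] := HP x Lf e0 e1.
have inner y : cintegral mu (fun xi => H e f x (y, xi)) = tensor f y * kern a x e (diag x - y).
  rewrite /H /= cintegralZ//.
  have iG := cintegrable_regularised m0 n0 hrho htau ha x e0 e1.
  apply: (le_cintegrable (g := fun xi => normc (G e x xi))).
  - apply: cmeasM; first exact: (cintegrable_cmeas iG).
    apply: cmeas_cexpi; apply: measurable_funM; first exact: measurable_cst.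
    by apply: continuous_measurable_mx; exact: continuous_mdot.
  - by move=> xi; rewrite Normc.normcM normc_cexpi mulr1.
  - exact: integrable_normc.
split.
  have := cintegrable_fubini i0 i1.
  by under eq_fun do rewrite inner.
transitivity (cintegral mu (fun xi => cintegral mu (fun y => H e f x (y, xi)))).
  apply: eq_cintegral => xi; rewrite /fio_integrand.
  pose g i u := f i u * cexpi (- (2 * pi * dotp u (row i xi))).
  have gi i : cintegrable (@vol1 R n) (g i) by exact: cintegrable_modulated.
  rewrite -[X in _ * (_ * X)](cintegral_prod_rows gi) mulrA.
  rewrite -cintegralZ; last exact: cintegrable_prod_rows.
  apply: eq_cintegral => y; rewrite /H /= phaseE /tensor /g big_split/= /G; ring.
rewrite -(cFubini i0 i1 i2).
by apply: eq_cintegral => y; exact: inner.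
Qed.

(** Gaussian regularisation is harmless where the integral converges. *)
Lemma gauss_limit (u : 'M[R]_(m, n) -> R) : mu.-integrable setT (EFin \o u) ->
  (fun e : R => \int[mu]_xi (gauss e xi * u xi)) @ 0^'+ --> \int[mu]_xi u xi.
Proof.
move=> iu; apply/cvg_at_rightP => w [w0 wl].
have mg e : measurable_fun setT (gauss e : 'M[R]_(m, n) -> R).
  by apply: continuous_measurable_mx; exact: continuous_gauss.
have mu' : measurable_fun setT u by apply/measurable_EFinP; exact: measurable_int iu.
pose f_ k xi := (gauss (w k) xi * u xi)%:E.
have [|||||_ _ h] := @dominated_convergence _ _ _ mu setT measurableT f_ (EFin \o u) (abse \o (EFin \o u)).
- by move=> k; apply/measurable_EFinP; exact: measurable_funM.
- exact/measurable_EFinP.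
- apply: aeW => xi _; apply: cvg_EFin; first by apply: nearW.
  rewrite /comp/= -[X in _ --> X]mul1r; apply: cvgM; last exact: cvg_cst.
  have -> : 1 = gauss 0 xi :> R by rewrite /gauss mul0r oppr0 expR0.
  have ce : continuous (fun e : R => gauss e xi).
    have ci : continuous (fun e : R => e * - enorm xi ^+ 2).
      by apply: contM; [move=> t; exact: cvg_id|exact: cst_continuous].
    rewrite (_ : (fun e => _) = expR \o (fun e : R => e * - enorm xi ^+ 2)); last first.
      by apply/funext => e; rewrite /gauss/= mulrN.
    by move=> e; apply: continuous_comp; [exact: ci|exact: continuous_expR].
  exact: (cvg_comp _ _ wl (ce 0)).
- exact: integrable_abse.
- apply: aeW => xi k _; rewrite /f_ /= lee_fin normrM ler_piMl//.
  by rewrite ger0_norm ?gauss_ge0// gauss_le1// ltW.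
rewrite /Rintegral; apply: fine_cvg.
by rewrite fineK//; exact: integrable_fin_num.
Qed.

(** Where the defining integral converges absolutely, dominated convergence
    identifies it with the limit. *)
Lemma fio_clim0 f x : (forall i, L1 (f i)) -> fio a f x = clim0 (fun e => Treg e f x).
Proof.
move=> Lf; rewrite /fio; case: ifPn => // /asboolP [ir ii].
have lr := gauss_limit ir; have li := gauss_limit ii.
apply: complex_eq => /=; apply/esym/cvg_lim => //.
  apply: cvg_trans lr; apply: near_eq_cvg; apply: nearW => e.
  by apply: eq_Rintegral => xi _; rewrite ReM /= mul0r subr0.
apply: cvg_trans li; apply: near_eq_cvg; apply: nearW => e.
by apply: eq_Rintegral => xi _; rewrite ImM /= mul0r addr0.
Qed.

End representation.

(** * Integrating against the dyadic kernel bounds *)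

Section local_integrals.
Context {R : realType} (n : nat).
Local Notation normc := (@Normc.normc R).
Local Notation nu := (@vol1 R n).
Implicit Types (f : 'rV[R]_n -> R[i]) (x c u : 'rV[R]_n).

Lemma cube_box c l : cube c l = box (c - const_mx (l / 2)) (c + const_mx (l / 2)).
Proof.
apply/seteqP; split=> u /= h.
  move=> i j; rewrite !mxE ord1.
  by have := h j; rewrite ler_norml => /andP[? ?]; apply/andP; split; lra.
move=> j; have := h ord0 j; rewrite !mxE => /andP[? ?].
by rewrite ler_norml; apply/andP; split; lra.
Qed.

Lemma measurable_cube c l : measurable (cube c l).
Proof. by rewrite cube_box; exact: measurable_box. Qed.

Lemma vol_cube c l : 0 <= l -> nu (cube c l) = (l ^+ n)%:E.
Proof.
move=> l0; rewrite cube_box leb_boxE; last by move=> i j; rewrite !mxE; lra.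
congr EFin; rewrite big_ord1 (eq_bigr (fun _ => l)) ?prodr_const ?card_ord//.
by move=> j _; rewrite !mxE; field.
Qed.

(** [r] is a half-width, to match the radii of balls. *)
Definition locint f x r : R := \int[nu]_u (normc (f u) * \1_(cube x (2 * r)) u).

Lemma integrable_locint f x r : L1 f ->
  nu.-integrable setT (EFin \o (fun u => normc (f u) * \1_(cube x (2 * r)) u)).
Proof.
move=> Lf; have nf := @integrable_normc R _ _ nu f Lf.
apply: (le_integrable measurableT _ _ nf).
  apply/measurable_EFinP; apply: measurable_funM.
    by apply/measurable_EFinP; exact: measurable_int nf.
  by apply: measurable_indic; exact: measurable_cube.
move=> u _; rewrite /= lee_fin normrM ler_piMr//.
by rewrite indicE; case: (_ \in _); rewrite ?normr1// normr0.
Qed.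

Lemma locintE f x r : L1 f ->
  (\int[nu]_u ((normc (f u))%:E * (\1_(cube x (2 * r)) u)%:E) = (locint f x r)%:E)%E.
Proof.
move=> Lf; rewrite /locint /Rintegral fineK; last first.
  exact: integrable_fin_num (integrable_locint x r Lf).
by apply: eq_integral => u _; rewrite EFinM.
Qed.

Lemma locint_ge0 f x r : 0 <= locint f x r.
Proof. by apply: Rintegral_ge0 => u _; rewrite mulr_ge0 ?normc_ge0. Qed.

Lemma locint_sub f x c r r' : L1 f -> cube x (2 * r) `<=` cube c (2 * r') ->
  locint f x r <= locint f c r'.
Proof.
move=> Lf xc; apply: le_Rintegral => //; try exact: integrable_locint.
move=> u _; rewrite ler_wpM2l ?normc_ge0// !indicE.
by case: (boolP (u \in cube x _)) => //; rewrite inE => /xc ux; rewrite mem_set.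
Qed.

Lemma avg_locint f c r : L1 f -> 0 < r ->
  avg f (cube c (2 * r)) = (((2 * r) ^+ n)^-1 * locint f c r)%:E.
Proof.
move=> Lf r0; rewrite /avg EFinM; congr (_ * _)%E.
  by rewrite [X in fine X](vol_cube c (l := 2 * r))//= mulr_ge0// ltW.
rewrite -locintE// integral_mkcond; apply: eq_integral => u _.
by rewrite patchE indicE; case: (_ \in _); rewrite ?mule1// mule0.
Qed.

Hypothesis n0 : (0 < n)%N.

Lemma cube_sub_side c c' l l' : 0 < l -> cube c l `<=` cube c' l' -> l <= l'.
Proof.
move=> l0 cc'; pose j0 := Ordinal n0.
have p1 : cube c l (c + const_mx (l / 2)).
  by move=> j; rewrite !mxE addrAC subrr add0r ger0_norm// divr_ge0// ltW.
have p2 : cube c l (c - const_mx (l / 2)).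
  by move=> j; rewrite !mxE addrAC subrr add0r normrN ger0_norm// divr_ge0// ltW.
have := cc' _ p1 j0; have := cc' _ p2 j0; rewrite !mxE !ler_norml.
by move=> /andP[? ?] /andP[? ?]; lra.
Qed.

Lemma avg_sup_le f c l : L1 f -> 0 < l ->
  (avg_sup (@cubes R n) f (cube c l) <= ((l ^+ n)^-1 * \int[nu]_u normc (f u))%:E)%E.
Proof.
move=> Lf l0; have nf := @integrable_normc R _ _ nu f Lf.
apply: ge_ereal_sup => _ [Q' [[c' [l' [l'0 ->]]] sub] <-].
have ll' := cube_sub_side l0 sub.
have -> : l' = 2 * (l' / 2) by rewrite mulrCA divff// mulr1.
rewrite avg_locint ?divr_gt0// lee_fin.
have -> : 2 * (l' / 2) = l' by rewrite mulrCA divff// mulr1.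
apply: ler_pM; rewrite ?invr_ge0 ?exprn_ge0 ?(ltW l'0) ?locint_ge0//.
  by rewrite lef_pV2 ?posrE ?exprn_gt0// lerXn2r ?nnegrE// ltW.
apply: le_Rintegral => //; first exact: integrable_locint.
by move=> u _; rewrite ler_piMr ?normc_ge0.
Qed.

Lemma avg_sup_fin f c l : L1 f -> 0 < l ->
  exists2 S : R, 0 <= S & avg_sup (@cubes R n) f (cube c l) = S%:E.
Proof.
move=> Lf l0; have ub := avg_sup_le c Lf l0.
have lb : (0 <= avg_sup (@cubes R n) f (cube c l))%E.
  apply: (@le_trans _ _ (avg f (cube c l))).
    rewrite /avg mule_ge0 ?lee_fin ?invr_ge0 ?fine_ge0 ?measure_ge0//.
    by apply: integral_ge0 => u _; rewrite lee_fin normc_ge0.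
  by apply: ereal_sup_ubound; exists (cube c l) => //; split=> //; exists c, l.
move: ub lb; case: (avg_sup _ _ _) => [S| |]//= _; rewrite lee_fin => S0.
by exists S.
Qed.

(** The average over any larger concentric cube is among those whose
    supremum is taken. *)
Lemma locint_le_avg_sup f c l r S : L1 f -> 0 < r -> l <= 2 * r ->
  avg_sup (@cubes R n) f (cube c l) = S%:E -> locint f c r <= (2 * r) ^+ n * S.
Proof.
move=> Lf r0 lr SE.
have r2 : 0 < 2 * r by rewrite mulr_gt0.
have : (avg f (cube c (2 * r)) <= S%:E)%E.
  rewrite -SE; apply: ereal_sup_ubound; exists (cube c (2 * r)) => //.
  split; first by exists c, (2 * r).
  by move=> u uc j; rewrite (le_trans (uc j))// ler_pM2r.
by rewrite avg_locint// lee_fin mulrC ler_pdivrMr ?exprn_gt0// mulrC.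
Qed.

End local_integrals.

Section majorant.
Context {R : realType} (m n : nat).
Hypotheses (m0 : (0 < m)%N) (n0 : (0 < n)%N).
Variable s : R.
Hypothesis s0 : 0 < s.
Local Notation d := (m * n)%N.
Local Notation normc := (@Normc.normc R).
Local Notation mu := (@vol R m n).
Local Notation rho := (ratio m s).
Implicit Types (f : 'I_m -> 'rV[R]_n -> R[i]) (x c : 'rV[R]_n) (y : 'M[R]_(m, n)).

(** A ball for the sup norm in [m * n] variables is a product of cubes, hence
    the factorisation in [tensor_dball]. *)
Definition dball x (r : R) : set 'M[R]_(m, n) := [set y | forall i, cube x (2 * r) (row i y)].

Lemma dballE x r y : 0 <= r -> dball x r y <-> `|diag m x - y| <= r.
Proof.
move=> r0; rewrite norm_le_sball//; split.
  move=> h; apply/sballE => i j; have := h i j; rewrite !mxE distrC.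
  by rewrite mulrAC divff// mul1r.
by move=> /sballE h i j; have := h i j; rewrite !mxE distrC mulrAC divff// mul1r.
Qed.

Lemma measurable_dball x r : measurable (dball x r).
Proof.
rewrite (_ : dball x r = \bigcap_(i in [set: 'I_m]) [set y | cube x (2 * r) (row i y)]).
  apply: fin_bigcap_measurable => // i _.
  have := @measurable_row R m n i measurableT _ (measurable_cube x (2 * r)).
  by rewrite setTI.
by apply/seteqP; split=> y /= h; [move=> i _; exact: h|move=> i; exact: h].
Qed.

Lemma indic_dball x r y : \1_(dball x r) y = \prod_i \1_(cube x (2 * r)) (row i y) :> R.
Proof.
have [yb|yb] := pselect (dball x r y).
  rewrite indicE mem_set// big1// => i _.
  by rewrite indicE mem_set.
rewrite indicE memNset//; move: yb => /existsNP[i yi].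
by rewrite (bigD1 i)//= indicE memNset ?mul0r.
Qed.

Definition weight j : R := rho ^+ (j * m.+1) / rad j ^+ d.

Lemma weight_ge0 j : 0 <= weight j.
Proof. by rewrite divr_ge0 ?exprn_ge0// ltW ?ratio_gt0 ?rad_gt0. Qed.

(** Each [y] is paid for by the one ball in which [k] is known to be small. *)
Lemma majorant x (g k : 'M[R]_(m, n) -> R[i]) (B : R) : 0 <= B ->
  cmeas g -> cmeas (fun y => g y * k y) ->
  (forall y, exists j, `|diag m x - y| <= rad j /\ normc (k y) <= B * weight j) ->
  (\int[mu]_y (normc (g y * k y))%:E <= B%:E * \sum_(0 <= j <oo) ((weight j)%:E *
     \int[mu]_y ((normc (g y))%:E * (\1_(dball x (rad j)) y)%:E)))%E.
Proof.
move=> B0 mg mgk hk.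
pose T j y := ((B * weight j)%:E * ((normc (g y))%:E * (\1_(dball x (rad j)) y)%:E))%E.
have mi j : measurable_fun setT (fun y => ((normc (g y))%:E * (\1_(dball x (rad j)) y)%:E)%E).
  apply: emeasurable_funM; first by apply/measurable_EFinP; exact: measurable_normc.
  by apply/measurable_EFinP; apply: measurable_indic; exact: measurable_dball.
have i0 j y : (0 <= (normc (g y))%:E * (\1_(dball x (rad j)) y)%:E)%E.
  by rewrite mule_ge0// lee_fin normc_ge0.
have T0 j y : (0 <= T j y)%E by rewrite mule_ge0// lee_fin mulr_ge0// weight_ge0.
have mT j : measurable_fun setT (T j) by apply: emeasurable_funM => //; exact: measurable_cst.
apply: (@le_trans _ _ (\int[mu]_y \sum_(0 <= j <oo) T j y)%E).
  apply: ge0_le_integral => //.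
  - by move=> y _; rewrite lee_fin normc_ge0.
  - by apply/measurable_EFinP; exact: measurable_normc.
  - by apply: ge0_emeasurable_sum => // j _.
  move=> y _; have [j [yj kj]] := hk y.
  apply: le_trans (le_nneseries_term j (fun j => T0 j y)).
  have jb : dball x (rad j) y by apply/dballE => //; exact: ltW (rad_gt0 j).
  rewrite /T indicE mem_set//= mule1 -EFinM lee_fin Normc.normcM mulrC.
  by rewrite ler_wpM2r ?normc_ge0.
rewrite integral_nneseries// -nneseriesZl//; last first.
  by move=> j _; rewrite mule_ge0 ?lee_fin ?weight_ge0// integral_ge0.
apply: lee_nneseries => [j *|j _]; first exact: integral_ge0.
rewrite /T ge0_integralZl//; last by rewrite lee_fin mulr_ge0// weight_ge0.
by rewrite EFinM muleA.
Qed.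

Lemma tensor_dball f x r : (forall i, L1 (f i)) ->
  (\int[mu]_y ((normc (tensor f y))%:E * (\1_(dball x r) y)%:E) =
   (\prod_i locint (f i) x r)%:E)%E.
Proof.
move=> Lf.
under eq_integral.
  move=> y _; rewrite -EFinM indic_dball normc_prod -big_split/= -prodEFin.
  over.
rewrite (ge0_integral_prod_rows (f := fun i u => (normc (f i u) * \1_(cube x (2 * r)) u)%:E)); last 2 first.
- by move=> i; exact: measurable_int (integrable_locint x r (Lf i)).
- by move=> i u; rewrite lee_fin mulr_ge0 ?normc_ge0.
- rewrite -prodEFin; apply: eq_bigr => i _; rewrite -locintE//.
Qed.

(** The part of the tensor product with some variable far from the cube. *)
Definition off f (Q : set 'rV[R]_n) y : R[i] :=
  tensor f y - tensor (fun i => indic_mul (f i) Q) y.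

(** If every row of [y] is within [2 * l] of a point of the cube, then all rows
    lie in the cube dilated by five. *)
Lemma off_near f c l x r y : cube c l x -> r < 2 * l -> dball x r y ->
  off f (cube c (5 * l)) y = 0.
Proof.
move=> xc rl yb; rewrite /off /tensor.
rewrite [X in _ - X](eq_bigr (fun i => f i (row i y))) ?subrr// => i _.
rewrite /indic_mul mem_set// => j.
have := yb i j; have := xc j; rewrite mulrAC divff// mul1r => h1 h2.
have := ler_normD (row i y ord0 j - x ord0 j) (x ord0 j - c ord0 j).
by rewrite addrA subrK => /le_trans; apply; lra.
Qed.

Lemma normc_off f Q y : normc (off f Q y) <= normc (tensor f y).
Proof.
rewrite /off /tensor.
have [h|/existsNP[i hi]] := pselect (forall i, Q (row i y)).
  rewrite [X in _ - X](eq_bigr (fun i => f i (row i y))).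
    by rewrite subrr Normc.normc0 normc_ge0.
  by move=> i _; rewrite /indic_mul mem_set.
rewrite [X in _ - X](bigD1 i)//= {1}/indic_mul memNset// mul0r subr0.
exact: lexx.
Qed.

Definition off_const : R := 4 ^+ d / (1 - rho ^+ m.+1).

Lemma off_const_gt0 : 0 < off_const.
Proof.
rewrite divr_gt0 ?exprn_gt0// subr_gt0 exprn_ilt1// ?ratio_lt1//.
by rewrite ltW// ratio_gt0.
Qed.

(** Away from the diagonal, only radii comparable to the cube or larger
    contribute, and there the local integrals are averages over larger cubes. *)
Lemma off_bound f c l x (k : 'M[R]_(m, n) -> R[i]) (B : R) (S : 'I_m -> R) :
  0 <= B -> 0 < l -> cube c l x -> (forall i, L1 (f i)) ->
  cmeas (off f (cube c (5 * l))) ->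
  cmeas (fun y => off f (cube c (5 * l)) y * k y) ->
  (forall y, exists j, `|diag m x - y| <= rad j /\ normc (k y) <= B * weight j) ->
  (forall i, 0 <= S i) ->
  (forall i, avg_sup (@cubes R n) (f i) (cube c l) = (S i)%:E) ->
  (\int[mu]_y (normc (off f (cube c (5 * l)) y * k y))%:E <=
   (B * off_const * \prod_i S i)%:E)%E.
Proof.
move=> B0 l0 xc Lf mo mok hk S0 SE.
apply: (le_trans (majorant B0 mo mok hk)).
rewrite -mulrA EFinM lee_wpmul2l ?lee_fin//.
have S00 : 0 <= \prod_i S i by apply: prodr_ge0.
have r0 : 0 < rho ^+ m.+1 by rewrite exprn_gt0// ratio_gt0.
have r1 : rho ^+ m.+1 < 1 by rewrite exprn_ilt1// ?ratio_lt1// ltW// ratio_gt0.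
have C0 : 0 <= 4 ^+ d * \prod_i S i by rewrite mulr_ge0// exprn_ge0.
rewrite /off_const (_ : _ * _ = 4 ^+ d * \prod_i S i / (1 - rho ^+ m.+1)); last by rewrite mulrAC.
apply: le_trans (nneseries_geometric_le C0 r0 r1).
have mtens : cmeas (tensor f).
  apply: cmeas_prod => i.
  exact: (cmeas_comp (@cintegrable_cmeas _ _ _ (@vol1 R n) _ (Lf i)) (@measurable_row R m n i)).
have i0 (g : 'M[R]_(m, n) -> R[i]) j y : (0 <= (normc (g y))%:E * (\1_(dball x (rad j)) y)%:E)%E.
  by rewrite mule_ge0// lee_fin normc_ge0.
apply: lee_nneseries => [j *|j _].
  by rewrite mule_ge0 ?lee_fin ?weight_ge0// integral_ge0.
have rj := rad_gt0 (R := R) j.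
have [lr|rl] := leP (2 * l) (rad j); last first.
  rewrite (eq_integral (cst 0%E)).
    by rewrite integral0 mule0 lee_fin mulr_ge0// exprn_ge0// ltW.
  move=> y _; rewrite /= indicE; case: (boolP (y \in _)) => [|_]; last by rewrite mule0.
  by rewrite inE => /(off_near f xc rl) ->; rewrite Normc.normc0 mul0e.
apply: (@le_trans _ _ ((weight j)%:E * (\prod_i locint (f i) x (rad j))%:E)%E).
  rewrite lee_wpmul2l ?lee_fin ?weight_ge0// -tensor_dball//.
  apply: ge0_le_integral => //.
  - apply: emeasurable_funM; first by apply/measurable_EFinP; exact: measurable_normc.
    by apply/measurable_EFinP; apply: measurable_indic; exact: measurable_dball.
  - apply: emeasurable_funM; first by apply/measurable_EFinP; exact: measurable_normc.
    by apply/measurable_EFinP; apply: measurable_indic; exact: measurable_dball.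
  by move=> y _; rewrite -!EFinM lee_fin ler_wpM2r// normc_off.
rewrite -EFinM lee_fin.
have le1 : \prod_i locint (f i) x (rad j) <= (4 * rad j) ^+ d * \prod_i S i.
  apply: (@le_trans _ _ (\prod_i ((4 * rad j) ^+ n * S i))).
    apply: ler_prod => i _; rewrite locint_ge0/=.
    apply: (@le_trans _ _ (locint (f i) c (2 * rad j))).
      apply: locint_sub => // u ux j'.
      have := ux j'; have := xc j'; rewrite mulrAC divff// mul1r => h1 h2.
      have := ler_normD (u ord0 j' - x ord0 j') (x ord0 j' - c ord0 j').
      by rewrite addrA subrK => /le_trans; apply; lra.
    have -> : 4 * rad j = 2 * (2 * rad j) :> R by lra.
    apply: (locint_le_avg_sup (Lf i) _ _ (SE i)); first by rewrite mulr_gt0.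
    by lra.
  by rewrite big_split/= prodr_const card_ord -exprM (mulnC n).
apply: (le_trans (ler_wpM2l (weight_ge0 j) le1)).
rewrite /weight exprMn mulnC exprM le_eqVlt; apply/orP; left; apply/eqP.
by field; rewrite expf_neq0// gt_eqF.
Qed.

End majorant.

(** * Potentials finite almost everywhere *)

Section good_points.
Context {R : realType} (n : nat).
Local Notation normc := (@Normc.normc R).
Local Notation nu := (@vol1 R n).
Implicit Types (f : 'rV[R]_n -> R[i]) (x u : 'rV[R]_n).

Let near_diag (r : R) : set ('rV[R]_n * 'rV[R]_n) := [set p | cube p.1 (2 * r) p.2].

Let measurable_near_diag r : measurable (near_diag r).
Proof.
rewrite (_ : near_diag r = \bigcap_(j in [set: 'I_n])
    ((fun p : 'rV[R]_n * 'rV[R]_n => p.2 ord0 j - p.1 ord0 j) @^-1` `[- r, r]%classic)).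
  apply: fin_bigcap_measurable => // j _.
  rewrite -[X in measurable X]setTI.
  have : measurable_fun setT (fun p : 'rV[R]_n * 'rV[R]_n => p.2 ord0 j - p.1 ord0 j).
    apply: measurable_funB.
      exact: (measurableT_comp (measurable_coord ord0 j) measurable_snd).
    exact: (measurableT_comp (measurable_coord ord0 j) measurable_fst).
  by apply => //; exact: measurable_itv.
apply/seteqP; split=> p /= h j.
  by move=> _ /=; have := h j; rewrite in_itv/= -ler_norml mulrAC divff// mul1r.
by have := h j Logic.I; rewrite /= in_itv/= -ler_norml mulrAC divff// mul1r.
Qed.

Let density f r (p : 'rV[R]_n * 'rV[R]_n) : \bar R :=
  ((normc (f p.2))%:E * (\1_(near_diag r) p)%:E)%E.

Let density_ge0 f r p : (0 <= density f r p)%E.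
Proof. by rewrite mule_ge0// lee_fin normc_ge0. Qed.

Let measurable_density f r : L1 f -> measurable_fun setT (density f r).
Proof.
move=> Lf; apply: emeasurable_funM.
  apply/measurable_EFinP; apply: measurable_normc.
  exact: (cmeas_comp (@cintegrable_cmeas _ _ _ nu _ Lf) measurable_snd).
by apply/measurable_EFinP; apply: measurable_indic; exact: measurable_near_diag.
Qed.

Let locint_density f x r : L1 f -> ((locint f x r)%:E = \int[nu]_u density f r (x, u))%E.
Proof. by move=> Lf; rewrite -locintE. Qed.

Lemma measurable_locint f r : L1 f -> measurable_fun setT (fun x => (locint f x r)%:E).
Proof.
move=> Lf.
have md := measurable_density r Lf.
have := @measurable_fun_fubini_tonelli_F _ _ 'rV[R]_n 'rV[R]_n R nu (density f r) md (density_ge0 f r).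
apply: eq_measurable_fun => x _; by rewrite locint_density.
Qed.

(** By Tonelli: [u] is counted by the [x] in the cube of half-width [r] about
    [u]. *)
Lemma integral_locint f r : L1 f -> 0 <= r ->
  (\int[nu]_x (locint f x r)%:E = ((2 * r) ^+ n)%:E * \int[nu]_u (normc (f u))%:E)%E.
Proof.
move=> Lf r0; under eq_integral do rewrite locint_density//.
have md := measurable_density r Lf.
rewrite (@fubini_tonelli _ _ 'rV[R]_n 'rV[R]_n R nu nu (density f r) md (density_ge0 f r)).
have mf : measurable_fun setT (fun u => (normc (f u))%:E).
  by apply/measurable_EFinP; apply: measurable_normc; exact: (@cintegrable_cmeas _ _ _ nu _ Lf).
rewrite -ge0_integralZl//; last 2 first.
- by move=> u _; rewrite lee_fin normc_ge0.
- by rewrite lee_fin exprn_ge0// mulr_ge0.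
apply: eq_integral => u _.
rewrite (_ : (\int[nu]_x density f r (x, u) =
  \int[nu]_x ((normc (f u))%:E * (\1_(near_diag r) (x, u))%:E))%E)//.
rewrite ge0_integralZl//; last 2 first.
- have mi : measurable_fun setT (fun p : 'rV[R]_n * 'rV[R]_n => (\1_(near_diag r) p : R)).
    by apply: measurable_indic; exact: measurable_near_diag.
  by apply/measurable_EFinP; exact: (measurable_fun_pair1 u mi).
- by rewrite lee_fin normc_ge0.
rewrite muleC; congr (_ * _)%E.
rewrite (eq_integral (fun x => (\1_(cube u (2 * r)) x)%:E)).
  rewrite integral_indic//; last exact: measurable_cube.
  by rewrite setIT; apply: vol_cube; rewrite mulr_ge0.
move=> x _; rewrite !indicE; congr ((nat_of_bool _)%:R%:E).
by apply/idP/idP; rewrite !inE /near_diag /= => h j; rewrite distrC.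
Qed.

Section dyadic_sum.
Variables (m : nat) (s : R).
Hypotheses (m0 : (0 < m)%N) (s0 : 0 < s).
Local Notation rho := (ratio m s).

(** A dyadic form of a Riesz-type potential, damped at both ends by the
    geometric factor. *)
Definition dyadic_sum f x : \bar R :=
  (\sum_(0 <= j <oo) (rho ^+ j / rad j ^+ n)%:E * (locint f x (rad j))%:E)%E.

Let c0 j : 0 <= rho ^+ j / rad j ^+ n.
Proof. by rewrite divr_ge0 ?exprn_ge0// ltW ?ratio_gt0 ?rad_gt0. Qed.

Let term_ge0 f x j : (0 <= (rho ^+ j / rad j ^+ n)%:E * (locint f x (rad j))%:E)%E.
Proof. by rewrite mule_ge0 ?lee_fin ?locint_ge0. Qed.

Lemma dyadic_sum_ge f x j S : dyadic_sum f x = S%:E ->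
  rho ^+ j / rad j ^+ n * locint f x (rad j) <= S.
Proof.
by move=> SE; have := le_nneseries_term j (term_ge0 f x); rewrite [X in (_ <= X)%E]SE -EFinM lee_fin.
Qed.

(** The integral of the [j]-th term is at most a constant times
    [rho ^+ j], so the sum is integrable. *)
Lemma dyadic_sum_fin f : L1 f -> {ae nu, forall x, exists S, dyadic_sum f x = S%:E}.
Proof.
move=> Lf.
pose T j x := ((rho ^+ j / rad j ^+ n)%:E * (locint f x (rad j))%:E)%E.
have mT j : measurable_fun setT (T j).
  by apply: emeasurable_funM; [exact: measurable_cst|exact: measurable_locint].
have r0 : 0 < rho := ratio_gt0 m s.
have r1 : rho < 1 by exact: ratio_lt1.
pose I := \int[nu]_u normc (f u).
have I0 : 0 <= I by apply: Rintegral_ge0 => u _; exact: normc_ge0.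
have C0 : 0 <= 2 ^+ n * I by rewrite mulr_ge0// exprn_ge0.
have IE : (\int[nu]_u (normc (f u))%:E = I%:E)%E.
  by rewrite /I /Rintegral fineK//; exact: integrable_fin_num (integrable_normc Lf).
have int : nu.-integrable setT (dyadic_sum f).
  apply/integrableP; split.
    have : measurable_fun setT (fun x => \sum_(0 <= j <oo) T j x)%E.
      by apply: ge0_emeasurable_sum => // j x _ _; exact: term_ge0.
    exact.
  have abs x : `|dyadic_sum f x|%E = dyadic_sum f x.
    by rewrite gee0_abs//; apply: nneseries_ge0 => j _ _; exact: term_ge0.
  under eq_integral do rewrite abs.
  rewrite /dyadic_sum integral_nneseries//.
  apply: le_lt_trans (ltry ((2 ^+ n * I) / (1 - rho))).
  apply: le_trans (nneseries_geometric_le C0 r0 r1).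
  apply: lee_nneseries => [j *|j _]; first exact: integral_ge0.
  rewrite ge0_integralZl//; last 3 first.
  - exact: measurable_locint.
  - by move=> x _; rewrite lee_fin locint_ge0.
  - by rewrite lee_fin.
  have rj := rad_gt0 (R := R) j.
  rewrite integral_locint// ?(ltW rj)// IE -!EFinM lee_fin le_eqVlt; apply/orP; left; apply/eqP.
  by rewrite exprMn; field; rewrite expf_neq0// gt_eqF.
have := integrable_ae measurableT int.
apply: filterS => x /(_ Logic.I) h; exists (fine (dyadic_sum f x)); by rewrite fineK.
Qed.

Local Notation mu := (@vol R m n).
Hypothesis n0 : (0 < n)%N.

(** At a point where all the dyadic sums are finite, each weight gives one factor
    [rho ^+ j] to each of them and keeps one for a geometric series. *)
Lemma tensor_bound (f : 'I_m -> 'rV[R]_n -> R[i]) x (k : 'M[R]_(m, n) -> R[i]) (B : R) (S : 'I_m -> R) :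
  0 <= B -> (forall i, L1 (f i)) ->
  cmeas (fun y => tensor f y * k y) ->
  (forall y, exists j, `|diag m x - y| <= rad j /\ normc (k y) <= B * weight m n s j) ->
  (forall i, dyadic_sum (f i) x = (S i)%:E) ->
  (\int[mu]_y (normc (tensor f y * k y))%:E <= (B * (\prod_i S i / (1 - rho)))%:E)%E.
Proof.
move=> B0 Lf mk hk SE.
have r0 : 0 < rho := ratio_gt0 m s.
have r1 : rho < 1 by exact: ratio_lt1.
have S0 i : 0 <= S i.
  by apply: le_trans (dyadic_sum_ge 0 (SE i)); rewrite mulr_ge0// locint_ge0.
have mt := cintegrable_cmeas (cintegrable_tensor_rows Lf).
apply: (le_trans (majorant m0 n0 B0 mt mk hk)).
rewrite [leRHS]EFinM lee_wpmul2l ?lee_fin//.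
have P0 : 0 <= \prod_i S i by exact: prodr_ge0.
apply: le_trans (nneseries_geometric_le P0 r0 r1).
apply: lee_nneseries => [j *|j _].
  rewrite mule_ge0 ?lee_fin ?weight_ge0//.
  by apply: integral_ge0 => y _; rewrite mule_ge0// lee_fin normc_ge0.
rewrite tensor_dball// -EFinM lee_fin.
have -> : weight m n s j * \prod_i locint (f i) x (rad j) =
    \prod_i (rho ^+ j / rad j ^+ n * locint (f i) x (rad j)) * rho ^+ j.
  rewrite big_split/= prodr_const card_ord /weight.
  rewrite mulnS exprD expr_div_n -!exprM (mulnC n m); ring.
rewrite ler_wpM2r ?exprn_ge0 ?(ltW r0)//.
by apply: ler_prod => i _; rewrite mulr_ge0 ?locint_ge0//= dyadic_sum_ge.
Qed.

End dyadic_sum.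
End good_points.

Section right_limits.
Context {R : realType}.

Lemma small_power (eps A kap : R) : 0 < eps -> 0 <= A -> 0 < kap ->
  exists h : R, [/\ 0 < h, h <= 1 & A * h `^ kap < eps].
Proof.
move=> e0 A0 k0; pose t := eps / (A + 1).
have t0 : 0 < t by rewrite divr_gt0// ltr_wpDl.
pose h := Num.min 1 (t `^ kap^-1).
have h0 : 0 < h by rewrite lt_min ltr01 powR_gt0.
exists h; split=> //; first by rewrite ge_min lexx.
have hk : h `^ kap <= t.
  have -> : t = (t `^ kap^-1) `^ kap by rewrite -powRrM mulVf ?gt_eqF// powRr1// ltW.
  by apply: ge0_ler_powR; rewrite ?nnegrE ?powR_ge0 ?(ltW k0) ?(ltW h0)// ge_min lexx orbT.
apply: (le_lt_trans (ler_wpM2l A0 hk)).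
rewrite /t mulrA ltr_pdivrMr ?ltr_wpDl// mulrC ltr_pM2l//; lra.
Qed.

Lemma is_cvg_right (g : R -> R) (A kap : R) : 0 <= A -> 0 < kap ->
  (forall e h, 0 < e -> e <= h -> h <= 1 -> `|g e - g h| <= A * h `^ kap) ->
  cvg (g @ 0^'+).
Proof.
move=> A0 k0 H; apply/cauchy_cvgP; apply: cauchy_exP => eps eps0.
have [h [h0 h1 hA]] := small_power eps0 A0 k0.
exists (g h).
have : \forall e \near 0^'+, ball (g h) eps (g e).
  near=> e; rewrite /ball/= distrC; apply: (le_lt_trans _ hA); apply: H => //.
  by near: e; exact: nbhs_right_le.
exact.
Unshelve. all: end_near. Qed.

Lemma cvg_right_eq (F G : R -> R) (L : R) : (forall e, 0 < e -> e <= 1 -> F e = G e) ->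
  G @ 0^'+ --> L -> F @ 0^'+ --> L.
Proof.
move=> FG; apply: cvg_trans; apply: near_eq_cvg; near=> e.
by apply/esym/FG => //; near: e; exact: nbhs_right_le.
Unshelve. all: end_near. Qed.

Lemma is_cvg_right_eq (F G : R -> R) : (forall e, 0 < e -> e <= 1 -> F e = G e) ->
  cvg (G @ 0^'+) -> cvg (F @ 0^'+).
Proof. by move=> FG /cvg_ex[L GL]; apply/cvg_ex; exists L; exact: cvg_right_eq GL. Qed.

Lemma right_lim_le (g : R -> R) (K : R) : cvg (g @ 0^'+) ->
  (forall e, 0 < e -> e <= 1 -> `|g e| <= K) -> `|lim (g @ 0^'+)| <= K.
Proof.
move=> cg gK; rewrite ler_norml; apply/andP; split.
  apply: limr_ge => //; near=> e.
  have : `|g e| <= K by apply: gK => //; near: e; exact: nbhs_right_le.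
  by rewrite ler_norml => /andP[].
apply: limr_le => //; near=> e.
have : `|g e| <= K by apply: gK => //; near: e; exact: nbhs_right_le.
by rewrite ler_norml => /andP[].
Unshelve. all: end_near. Qed.

(** Either both functions converge or neither does, and in the second case both
    limits are the same default value. *)
Lemma lim_right_sub (g h : R -> R) (K : R) : 0 <= K -> cvg ((fun e => g e - h e) @ 0^'+) ->
  (forall e, 0 < e -> e <= 1 -> `|g e - h e| <= K) ->
  `|lim (g @ 0^'+) - lim (h @ 0^'+)| <= K.
Proof.
move=> K0 cd dK; have [ch|ch] := pselect (cvg (h @ 0^'+)).
  have cg : cvg (g @ 0^'+).
    rewrite (_ : g = (fun e => (g e - h e) + h e)); first exact: is_cvgD.
    by apply/funext => e; rewrite subrK.
  rewrite -limB//; exact: right_lim_le.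
have cg : ~ cvg (g @ 0^'+).
  move=> cg; apply: ch.
  rewrite (_ : h = (fun e => g e - (g e - h e))); first exact: is_cvgB.
  by apply/funext => e; rewrite opprB addrC subrK.
by rewrite (dvgP ch) (dvgP cg) subrr normr0.
Qed.

End right_limits.

(** * Convergence of the regularised operators *)

Section convergence.
Context {R : realType} (m n : nat).
Hypotheses (m0 : (0 < m)%N) (n0 : (0 < n)%N).
Variables (rho delta tau : R) (a : 'rV[R]_n * 'M[R]_(m, n) -> R[i]).
Hypothesis hrho : 0 <= rho <= 1.
Hypothesis htau : tau < - ((m * n)%:R * (1 - rho)).
Hypothesis ha : symbol_class tau rho delta a.
Variables s C : R.
Hypotheses (s0 : 0 < s) (C0 : 0 < C).
Hypothesis kern_size : forall x z e, 0 < e -> e <= 1 -> exists j, `|z| <= rad j /\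
  Normc.normc (kern a x e z) <= C * weight m n s j.
Hypothesis kern_diff : forall x z e h, 0 < e -> e <= h -> h <= 1 -> exists j, `|z| <= rad j /\
  Normc.normc (kern a x e z - kern a x h z) <= C * h `^ (s / 2) * weight m n s j.
Local Notation normc := (@Normc.normc R).
Local Notation mu := (@vol R m n).
Local Notation nu := (@vol1 R n).
Implicit Types (f : 'I_m -> 'rV[R]_n -> R[i]) (x c : 'rV[R]_n) (y : 'M[R]_(m, n)).

Let normc_cintegral_le (F : 'M[R]_(m, n) -> R[i]) B : cintegrable mu F ->
  (\int[mu]_y (normc (F y))%:E <= B%:E)%E -> normc (cintegral mu F) <= 2 * B.
Proof.
move=> iF hB; apply: (le_trans (normc_cintegral iF)); rewrite ler_pM2l//.
by rewrite -lee_fin /Rintegral fineK//; exact: integrable_fin_num (integrable_normc iF).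
Qed.

(** Integrability against every kernel dominated by the dyadic weights gives
    convergence of the regularised integrals.  This is applied at almost every
    point to the tensor product itself, and at every point of a cube to its
    part away from that cube. *)
Lemma kernel_limit (g : 'M[R]_(m, n) -> R[i]) x (K : R) : 0 <= K ->
  (forall e, 0 < e -> e <= 1 -> cintegrable mu (fun y => g y * kern a x e (diag m x - y))) ->
  (forall k B, 0 <= B -> cmeas (fun y => g y * k y) ->
    (forall y, exists j, `|diag m x - y| <= rad j /\ normc (k y) <= B * weight m n s j) ->
    (\int[mu]_y (normc (g y * k y))%:E <= (B * K)%:E)%E) ->
  let I e := cintegral mu (fun y => g y * kern a x e (diag m x - y)) in
  [/\ forall e, 0 < e -> e <= 1 -> normc (I e) <= 2 * (C * K),
      cvg ((fun e => complex.Re (I e)) @ 0^'+) &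
      cvg ((fun e => complex.Im (I e)) @ 0^'+)].
Proof.
move=> K0 ig bnd I.
have bI e : 0 < e -> e <= 1 -> normc (I e) <= 2 * (C * K).
  move=> e0 e1; apply: (normc_cintegral_le (ig e e0 e1)); apply: bnd; first exact: ltW.
    exact: cintegrable_cmeas (ig e e0 e1).
  by move=> y; exact: kern_size.
have dI e h : 0 < e -> e <= h -> h <= 1 -> normc (I e - I h) <= 2 * C * K * h `^ (s / 2).
  move=> e0 eh h1; have e1 := le_trans eh h1; have h0 := lt_le_trans e0 eh.
  rewrite /I -cintegralB; [|exact: ig|exact: ig].
  have gE : (fun y => g y * kern a x e (diag m x - y) - g y * kern a x h (diag m x - y)) =
            (fun y => g y * (kern a x e (diag m x - y) - kern a x h (diag m x - y))).
    by apply/funext => y; rewrite mulrBr.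
  have := cintegrableB (ig e e0 e1) (ig h h0 h1); rewrite gE => id.
  have -> : 2 * C * K * h `^ (s / 2) = 2 * (C * h `^ (s / 2) * K) by ring.
  apply: (normc_cintegral_le id); apply: bnd.
  - by rewrite mulr_ge0 ?powR_ge0// ltW.
  - exact: cintegrable_cmeas id.
  - by move=> y; exact: kern_diff.
have A0 : 0 <= 2 * C * K by rewrite mulr_ge0// mulr_ge0// ltW.
have k0 : 0 < s / 2 by rewrite divr_gt0.
split=> //; apply: (is_cvg_right A0 k0) => e h e0 eh h1.
  by rewrite -ReB; apply: (le_trans (normRe_le _)); exact: dI.
by rewrite -ImB; apply: (le_trans (normIm_le _)); exact: dI.
Qed.

Definition converges (F : R -> R[i]) :=
  cvg ((fun e => complex.Re (F e)) @ 0^'+) /\ cvg ((fun e => complex.Im (F e)) @ 0^'+).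

Lemma Treg_converges_ae f : (forall i, L1 (f i)) ->
  {ae nu, forall x, converges (fun e => Treg a e f x)}.
Proof.
move=> Lf.
have good : {ae nu, forall x, forall i, exists S, dyadic_sum m s (f i) x = S%:E}.
  by apply: filter_forall => i; exact: dyadic_sum_fin.
apply: filterS good => x good.
pose S i := sval (cid (good i)).
have SE i : dyadic_sum m s (f i) x = (S i)%:E by rewrite /S; case: cid.
have S0 i : 0 <= S i.
  apply: le_trans (dyadic_sum_ge 0 (SE i)).
  by rewrite mulr_ge0 ?locint_ge0// divr_ge0 ?exprn_ge0// ltW ?ratio_gt0 ?rad_gt0.
have K0 : 0 <= \prod_i S i / (1 - ratio m s).
  by rewrite divr_ge0 ?prodr_ge0// subr_ge0 ltW// ratio_lt1.
have TK e := Treg_kern m0 n0 hrho htau ha (e := e) x Lf.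
have [|k B B0 mk hk|_ cr ci] := kernel_limit (g := tensor f) (x := x) K0.
- by move=> e e0 e1; exact: (TK e e0 e1).1.
- exact: (tensor_bound m0 s0 n0 B0 Lf mk hk SE).
split; [apply: is_cvg_right_eq cr|apply: is_cvg_right_eq ci] => e e0 e1.
  by rewrite (TK e e0 e1).2.
by rewrite (TK e e0 e1).2.
Qed.

Lemma L1_indic (u : 'rV[R]_n -> R[i]) Q : measurable Q -> L1 u -> L1 (indic_mul u Q).
Proof.
move=> mQ Lu; apply: (le_cintegrable (g := fun v => normc (u v))).
- rewrite (_ : indic_mul u Q = (fun v => (\1_Q v)%:C%C * u v)).
    apply: cmeasM; last exact: (@cintegrable_cmeas _ _ _ nu _ Lu).
    by apply: cmeas_real; exact: measurable_indic.
  by apply/funext => v; rewrite /indic_mul indicE; case: ifPn; rewrite ?mul1r ?mul0r.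
- by move=> v; rewrite /indic_mul; case: ifPn => // _; rewrite Normc.normc0 normc_ge0.
- exact: (@integrable_normc _ _ _ nu _ Lu).
Qed.

(** The regularised integrals at [x] need not converge, for [f] or for its
    restriction to the dilated cube; their difference does, and is bounded by
    averages over larger cubes. *)
Lemma fio_local f c l x (S : 'I_m -> R) : 0 < l -> cube c l x ->
  (forall i, L1 (f i)) -> (forall i, 0 <= S i) ->
  (forall i, avg_sup (@cubes R n) (f i) (cube c l) = (S i)%:E) ->
  normc (fio a f x - fio a (fun i => indic_mul (f i) (cube c (5 * l))) x) <=
    4 * C * off_const m n s * \prod_i S i.
Proof.
move=> l0 xc Lf S0 SE; pose f1 i := indic_mul (f i) (cube c (5 * l)).
have Lf1 i : L1 (f1 i) by apply: L1_indic => //; exact: measurable_cube.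
have mo : cmeas (off f (cube c (5 * l))).
  exact: (cintegrable_cmeas (cintegrableB (cintegrable_tensor_rows Lf) (cintegrable_tensor_rows Lf1))).
have K0 : 0 <= off_const m n s * \prod_i S i.
  by rewrite mulr_ge0 ?prodr_ge0// ltW// off_const_gt0.
have TK e := Treg_kern m0 n0 hrho htau ha (e := e) x Lf.
have TK1 e := Treg_kern m0 n0 hrho htau ha (e := e) x Lf1.
have offE e : (fun y => off f (cube c (5 * l)) y * kern a x e (diag m x - y)) =
    (fun y => tensor f y * kern a x e (diag m x - y) - tensor f1 y * kern a x e (diag m x - y)).
  by apply/funext => y; rewrite -mulrBl.
have [|k B B0 mk hk|bI cr ci] := kernel_limit (g := off f (cube c (5 * l))) (x := x) K0.
- by move=> e e0 e1; rewrite offE; apply: cintegrableB; [exact: (TK e e0 e1).1|exact: (TK1 e e0 e1).1].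
- by rewrite mulrA; exact: (off_bound m0 n0 s0 B0 l0 xc Lf mo mk hk S0 SE).
have DE e : 0 < e -> e <= 1 -> Treg a e f x - Treg a e f1 x =
    cintegral mu (fun y => off f (cube c (5 * l)) y * kern a x e (diag m x - y)).
  move=> e0 e1; rewrite (TK e e0 e1).2 (TK1 e e0 e1).2 offE cintegralB//.
    exact: (TK e e0 e1).1.
  exact: (TK1 e e0 e1).1.
rewrite (fio_clim0 a x Lf) (fio_clim0 a x Lf1).
apply: (le_trans (normc_le _)); rewrite ReB ImB.
have C0K : 0 <= 2 * (C * (off_const m n s * \prod_i S i)).
  by rewrite mulr_ge0// mulr_ge0// ltW.
rewrite (_ : 4 * _ * _ * _ = 2 * (C * (off_const m n s * \prod_i S i)) +
  2 * (C * (off_const m n s * \prod_i S i))); last by ring.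
apply: lerD.
  apply: (lim_right_sub (g := fun e => complex.Re (Treg a e f x))
    (h := fun e => complex.Re (Treg a e f1 x))) => //.
    by apply: is_cvg_right_eq cr => e e0 e1; rewrite -ReB DE.
  by move=> e e0 e1; rewrite -ReB DE//; apply: (le_trans (normRe_le _)); exact: bI.
apply: (lim_right_sub (g := fun e => complex.Im (Treg a e f x))
  (h := fun e => complex.Im (Treg a e f1 x))) => //.
  by apply: is_cvg_right_eq ci => e e0 e1; rewrite -ImB DE.
by move=> e e0 e1; rewrite -ImB DE//; apply: (le_trans (normIm_le _)); exact: bI.
Qed.

Lemma clim0_linear (F A B : R -> R[i]) (b : R[i]) : converges A -> converges B ->
  (forall e, 0 < e -> e <= 1 -> F e = b * A e + B e) ->
  clim0 F = b * clim0 A + clim0 B.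
Proof.
move=> [Ar Ai] [Br Bi] FE.
apply: complex_eq; rewrite ?ReD ?ImD ?ReM ?ImM /=; apply/cvg_lim => //.
  apply: (cvg_right_eq (G := fun e => complex.Re b * complex.Re (A e) -
    complex.Im b * complex.Im (A e) + complex.Re (B e))).
    by move=> e e0 e1; rewrite FE// ReD ReM.
  by apply: cvgD => //; apply: cvgB; apply: cvgM => //; exact: cvg_cst.
apply: (cvg_right_eq (G := fun e => complex.Re b * complex.Im (A e) +
    complex.Im b * complex.Re (A e) + complex.Im (B e))).
  by move=> e e0 e1; rewrite FE// ImD ImM.
by apply: cvgD => //; apply: cvgD; apply: cvgM => //; exact: cvg_cst.
Qed.

Lemma tensor_upd f i (u v : 'rV[R]_n -> R[i]) (b : R[i]) y :
  tensor (upd f i (fun z => b * u z + v z)) y =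
  b * tensor (upd f i u) y + tensor (upd f i v) y.
Proof.
have E w : \prod_(j | j != i) upd f i w j (row j y) = \prod_(j | j != i) f j (row j y).
  by apply: eq_bigr => j /negPf ji; rewrite /upd ji.
by rewrite /tensor !(bigD1 i (P := predT))//= !E /upd eqxx; ring.
Qed.

Lemma L1_upd f i u : (forall j, L1 (f j)) -> L1 u -> forall j, L1 (upd f i u j).
Proof. by move=> Lf Lu j; rewrite /upd; case: ifP. Qed.

Lemma fio_multilinear : multilinear_L1 (fio a).
Proof.
move=> f i u v b Lf Lu Lv.
have Lw : L1 (fun z => b * u z + v z).
  by apply: cintegrableD => //; exact: cintegrableZ.
have Lfu := L1_upd i Lf Lu; have Lfv := L1_upd i Lf Lv; have Lfw := L1_upd i Lf Lw.
have au := Treg_converges_ae Lfu; have av := Treg_converges_ae Lfv.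
apply: filterS2 au av => x cu cv.
rewrite (fio_clim0 a x Lfu) (fio_clim0 a x Lfv).
rewrite (fio_clim0 a x Lfw).
apply: clim0_linear => // e e0 e1.
have [iu ->] := Treg_kern m0 n0 hrho htau ha x Lfu e0 e1.
have [iv ->] := Treg_kern m0 n0 hrho htau ha x Lfv e0 e1.
have [_ ->] := Treg_kern m0 n0 hrho htau ha x Lfw e0 e1.
rewrite -cintegralZ// -cintegralD//; last exact: cintegrableZ.
by apply: eq_cintegral => y; rewrite tensor_upd mulrDl mulrA.
Qed.

(** A function supported in the cube of side [10 * l] has integral at most that
    over this cube, and every cube containing [cube c l] has volume at least
    [l ^+ n]. *)
Lemma avg_sup_indic (u : 'rV[R]_n -> R[i]) c l : L1 u -> 0 < l ->
  exists A S : R, [/\ 0 <= S, S <= 10 ^+ n * A, avg u (cube c (10 * l)) = A%:E &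
    avg_sup (@cubes R n) (indic_mul u (cube c (10 * l))) (cube c l) = S%:E].
Proof.
move=> Lu l0; have m10 := measurable_cube c (10 * l).
have Lv := L1_indic m10 Lu.
have [S S0 SE] := avg_sup_fin n0 c Lv l0.
have l5 : 0 < 5 * l by rewrite mulr_gt0.
have lE : 10 * l = 2 * (5 * l) by rewrite mulrA -natrM.
exists (((2 * (5 * l)) ^+ n)^-1 * locint u c (5 * l)), S; split=> //; last by rewrite lE avg_locint.
have := avg_sup_le n0 c Lv l0; rewrite SE lee_fin => /le_trans; apply.
rewrite (_ : \int[nu]_v normc _ = locint u c (5 * l)); last first.
  apply: eq_Rintegral => v _; rewrite /indic_mul -lE indicE.
  by case: ifPn; rewrite ?mulr1// mulr0 Normc.normc0.
rewrite [leRHS]mulrA ler_wpM2r ?locint_ge0// -lE exprMn le_eqVlt; apply/orP; left; apply/eqP.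
by field; rewrite !expf_neq0//= gt_eqF.
Qed.

Lemma fio_bounded_oscillation : bounded_oscillation (@cubes R n) (@cube5 R n) (fio a).
Proof.
split; first exact: fio_multilinear.
pose K := 4 * C * off_const m n s.
have K0 : 0 < K by rewrite mulr_gt0 ?off_const_gt0// mulr_gt0.
exists (K * (10 ^+ n) ^+ m), (2 * K); split.
- by rewrite mulr_gt0// !exprn_gt0.
- by rewrite mulr_gt0.
- move=> _ [c [l [l0 ->]]]; have l20 : 0 < 2 * l by rewrite mulr_gt0.
  (* The dilated cube is then [cube c (10 * l)]. *)
  exists (cube c (2 * l)); split.
  + by exists c, (2 * l).
  + split; last first.
      by move=> /(cube_sub_side n0 l20); move: l0; lra.
    by move=> u uc j; apply: (le_trans (uc j)); move: l0; lra.
  move=> f Lf x xc; rewrite !cube5E//.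
  have -> : 5 * (2 * l) = 10 * l by lra.
  pose f' i := indic_mul (f i) (cube c (10 * l)).
  have Lf' i : L1 (f' i) by apply: L1_indic => //; exact: measurable_cube.
  have ex i := avg_sup_indic c (Lf i) l0.
  pose A i := sval (cid (ex i)); pose S i := sval (cid (svalP (cid (ex i)))).
  have SP i : [/\ 0 <= S i, S i <= 10 ^+ n * A i, avg (f i) (cube c (10 * l)) = (A i)%:E &
      avg_sup (@cubes R n) (f' i) (cube c l) = (S i)%:E].
    exact: (svalP (cid (svalP (cid (ex i))))).
  have f'E : (fun i => indic_mul (f i) (cube c (5 * l))) = (fun i => indic_mul (f' i) (cube c (5 * l))).
    apply/funext => i; apply/funext => u; rewrite /f' /indic_mul.
    case: ifPn => //; rewrite inE => u5; rewrite mem_set// => j.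
    by apply: (le_trans (u5 j)); move: l0; lra.
  rewrite f'E (eq_bigr (fun i => (A i)%:E)); last by move=> i _; case: (SP i).
  rewrite prodEFin -EFinM lee_fin.
  have S0 i : 0 <= S i by case: (SP i).
  have SE i : avg_sup (@cubes R n) (f' i) (cube c l) = (S i)%:E by case: (SP i).
  apply: (le_trans (fio_local l0 xc Lf' S0 SE)); rewrite -/K -[leRHS]mulrA ler_pM2l//.
  apply: (@le_trans _ _ (\prod_i (10 ^+ n * A i))).
    by apply: ler_prod => i _; rewrite S0/=; case: (SP i).
  by rewrite big_split/= prodr_const card_ord.
- move=> _ [c [l [l0 ->]]] f Lf x x' xc xc'; rewrite cube5E//.
  have ex i := avg_sup_fin n0 c (Lf i) l0.
  pose S i := sval (cid2 (ex i)).
  have S0 i : 0 <= S i by rewrite /S; case: cid2.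
  have SE i : avg_sup (@cubes R n) (f i) (cube c l) = (S i)%:E by rewrite /S; case: cid2.
  rewrite (eq_bigr (fun i => (S i)%:E)); last by move=> i _.
  rewrite prodEFin -EFinM lee_fin.
  apply: (le_trans (ler_normcD _ _)); rewrite normcN.
  have := fio_local l0 xc Lf S0 SE; have := fio_local l0 xc' Lf S0 SE; rewrite -/K.
  rewrite (_ : 2 * K * _ = K * \prod_i S i + K * \prod_i S i); last by ring.
  by move=> h1 h2; exact: (lerD h2 h1).
Qed.

End convergence.

Theorem theorem2p20 (R : realType) (m n : nat) (hm : (0 < m)%N) (hn : (0 < n)%N)
    (rho delta tau : R) (a : 'rV[R]_n * 'M[R]_(m, n) -> R[i])
    (hrho : 0 <= rho <= 1) (hdelta : 0 <= delta <= 1)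
    (htau : tau < - ((m * n)%:R * (1 - rho)))
    (ha : symbol_class tau rho delta a) :
  bounded_oscillation (@cubes R n) (@cube5 R n) (fio a).
Proof.
have [s [C [s0 _ C0 hk]]] := kernel_dyadic hm hn hrho htau ha.
apply: (fio_bounded_oscillation hm hn hrho htau ha s0 C0).
  by move=> x z; have [h _] := hk x z; exact: h.
by move=> x z; have [_ h] := hk x z; exact: h.
Qed.
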